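(* For any $\bar x\in\bar H$, the process $\{\bar X_t:t\ge0\}$ defined by $$\bar X_t=\bar T_t\bar x+\tilde Y_t+\int_0^t\bar T_{t-s}\bar A\tilde Y_s\,ds,\qquad t\ge0,$$ is a càdlàg strong Markov process in $\bar H$ with transition semigroup $(Q_t^{\bar\mu})_{t\ge0}$.
   Context: $H$ is a real separable Hilbert space with dual $H^*$ (identified with $H$), $(T_t)_{t\ge0}$ is a strongly continuous semigroup of bounded linear operators on $H$ with $\|T_t\|\le c_0e^{b_0t}$ for constants $c_0,b_0\ge0$, and $(U_\alpha)_{\alpha>b_0}$ is its resolvent. An entrance path for $(T_t)_{t\ge0}$ is a path $\tilde x=\{\tilde x(s):s>0\}$ in $H$ with $\tilde x(r+t)=T_t\tilde x(r)$ for all $r,t>0$; it is locally square integrable if $\int_0^l\|\tilde x(s)\|^2ds<\infty$ for some $l>0$. The entrance space $\tilde H$ is the set of all locally square integrable entrance paths, with inner product $\langle\tilde x,\tilde y\rangle_\sim=\int_0^\infty e^{-2bs}\langle\tilde x(s),\tilde y(s)\rangle ds$ for a fixed $b>b_0$ and norm $\|\cdot\|_\sim$; it is a separable Hilbert space. The map $J:H\to\tilde H$ is $Jx=\{T_sx:s>0\}$ (a continuous dense embedding). The strongly continuous semigroup $(\tilde T_t)_{t\ge0}$ on $\tilde H$ is $(\tilde T_t\tilde x)(s)=\tilde x(t+s)$, $s>0$. Fix $\alpha>b_0$. $\bar H$ is the completion of $\tilde H$ with respect to the norm $\|\cdot\|_-$ of the inner product $\langle\tilde x,\tilde y\rangle_-=\int_0^\infty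 e^{-2bs}\langle U_\alpha\tilde x(s),U_\alpha\tilde y(s)\rangle ds$; $\tilde H$ is continuously embedded in $\bar H$. Each $\tilde T_t$ extends uniquely to a bounded operator $\bar T_t$ on $\bar H$, and $(\bar T_t)_{t\ge0}$ is a strongly continuous semigroup on $\bar H$ with generator $\bar A$ and domain $D(\bar A)\supset\tilde H$; the restriction of $\bar A$ to $\tilde H$ is continuous from $(\tilde H,\|\cdot\|_\sim)$ to $(\bar H,\|\cdot\|_-)$. A skew convolution semigroup (SC-semigroup) on a Hilbert space $K$ associated with a semigroup $(S_t)_{t\ge0}$ of operators is a family $(\mu_t)_{t\ge0}$ of probability measures with $\mu_{r+t}=(S_t\mu_r)*\mu_t$ for all $r,t\ge0$ ($S_t\mu_r$ is the image measure, $*$ is convolution); it is centered if each $\mu_t$ has mean zero. Let $\lambda_0$ be a centered infinitely divisible probability measure on $\tilde H$ with $\int_{\tilde H}\|\tilde x\|_\sim^2\lambda_0(d\tilde x)<\infty$, and let $\tilde\psi_0$ be the continuous function on $\tilde H^*$ with $\tilde\psi_0(0)=0$ and $\int_{\tilde H}e^{i\langle\tilde x,\tilde a\rangle_\sim}\lambda_0(d\tilde x)=e^{-\tilde\psi_0(\tilde a)}$. Let $(\mu_t)_{t\ge0}$ be the centered SC-semigroup on $H$ associated with $(T_t)_{t\ge0}$ with characteristic functionals $\hat\mu_t(a)=\int_He^{i\langle x,a\rangle}\mu_t(dx)=\exp\{-\int_0^t\psi_s(a)ds\}$, $a\in H^*$, where $\psi_s$ is the unique continuous function on $H^*$ with $\psi_s(0)=0$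 and $\exp\{-\psi_s(a)\}=\int_{\tilde H}e^{i\langle\tilde x(s),a\rangle}\lambda_0(d\tilde x)$, $s>0$. Let $\tilde\mu_t=J\mu_t$ be the image of $\mu_t$ on $\tilde H$, and let $\bar\mu_t$ be the probability measure on $\bar H$ whose restriction to $\tilde H$ is $\tilde\mu_t$; $(\bar\mu_t)_{t\ge0}$ is an SC-semigroup associated with $(\bar T_t)_{t\ge0}$. The generalized Mehler semigroup $(Q_t^{\bar\mu})_{t\ge0}$ on $\bar H$ is $Q_t^{\bar\mu}f(\bar x)=\int_{\bar H}f(\bar T_t\bar x+\bar y)\,\bar\mu_t(d\bar y)$ for bounded Borel $f$ on $\bar H$. $\{\tilde Y_t:t\ge0\}$ is a càdlàg $\tilde H$-valued process with $\tilde Y_0=0$ and independent increments such that for $t\ge r\ge0$ the increment $\tilde Y_t-\tilde Y_r$ has distribution $\gamma_{t-r}$ with characteristic functional $\hat\gamma_{t-r}(\tilde a)=\exp\{-(t-r)\tilde\psi_0(\tilde a)\}$, $\tilde a\in\tilde H^*$ (such a process exists). *)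

(* Defs.v *)
From HB Require Import structures.
From mathcomp Require Import all_boot all_order all_algebra.
From mathcomp Require Import all_classical all_reals all_analysis.
From mathcomp Require Import complex.

Set Implicit Arguments.
Unset Strict Implicit.
Unset Printing Implicit Defensive.

Import Order.TTheory GRing.Theory Num.Theory.
Import numFieldNormedType.Exports.

Local Open Scope classical_set_scope.
Local Open Scope ring_scope.
Local Open Scope complex_scope.

HB.mixin Record CompleteNormedModule_isHilbert (R : realType) V
    of CompleteNormedModule R V := {
  inner : V -> V -> R ;
  innerC : forall x y, inner x y = inner y x ;
  innerDl : forall x y z, inner (x + y) z = inner x z + inner y z ;
  innerZl : forall (a : R) x y, inner (a *: x) y = a * inner x y ;
  inner_norm : forall x, inner x x = `|x| ^+ 2
}.

#[short(type="hilbertType")]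
HB.structure Definition Hilbert (R : realType) :=
  {V of CompleteNormedModule R V & CompleteNormedModule_isHilbert R V}.

Definition separable (T : topologicalType) : Prop :=
  exists D : set T, countable D /\ dense D.

Notation borel K := (g_sigma_algebraType (@open K)).

Section bochner.
Context d (T : measurableType d) (R : realType) (V : normedModType R).
Implicit Types (mu : set T -> \bar R) (D : set T) (f : T -> V)
  (s : seq (set T * V)).

(* The list of pairs (A, v) stands for the simple function \sum 1_A v. *)
Definition simple_fun s (x : T) : V := \sum_(p <- s) \1_(p.1) x *: p.2.

Definition simple_integral mu s : V := \sum_(p <- s) fine (mu p.1) *: p.2.

Definition simple_on mu D s : Prop :=
  forall i, (i < size s)%N ->
    let A := (nth (set0, 0) s i).1 in
    [/\ measurable A, A `<=` D & (mu A < +oo)%E].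

Definition is_bochner_integral mu D f (v : V) : Prop :=
  exists g : nat -> seq (set T * V),
    [/\ forall n, simple_on mu D (g n),
        forall x, D x -> simple_fun (g n) x @[n --> \oo] --> f x,
        (\int[mu]_(x in D) (`|f x - simple_fun (g n) x|)%:E)%E
          @[n --> \oo] --> 0%E &
        simple_integral mu (g n) @[n --> \oo] --> v].

Definition bochner_integrable mu D f : Prop :=
  exists v, is_bochner_integral mu D f v.

Definition bochner_integral mu D f : V :=
  xget 0 [set v | is_bochner_integral mu D f v].

End bochner.

Section charfun.
Context {R : realType}.

Definition cexp (z : R[i]) : R[i] :=
  (expR (complex.Re z))%:C * (cos (complex.Im z) +i* sin (complex.Im z)).

Definition cintegral d (T : measurableType d) (mu : {measure set T -> \bar R})
    (D : set T) (f : T -> R[i]) : R[i] :=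
  (\int[mu]_(x in D) complex.Re (f x)) +i* (\int[mu]_(x in D) complex.Im (f x)).

(* The dual of a Hilbert space is identified with the space itself. *)
Definition charfun (K : hilbertType R) (mu : probability (borel K) R) (a : K)
    : R[i] :=
  cintegral mu setT (fun x : borel K => cexp (0 +i* inner (x : K) a)).

End charfun.

(* Semigroups and processes are indexed by R, but only t >= 0 is relevant. *)

Section semigroup.
Context {R : realType}.

Definition bounded_operator (V W : normedModType R) (f : V -> W) : Prop :=
  linear f /\ continuous f.

Definition strongly_continuous_semigroup (V : normedModType R)
    (S : R -> V -> V) : Prop :=
  [/\ forall t, 0 <= t -> bounded_operator (S t),
      forall x, S 0 x = x,
      forall r t x, 0 <= r -> 0 <= t -> S (r + t) x = S r (S t x) &
      forall x, S t x @[t --> 0^'+] --> x].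

Definition generator (V : normedModType R) (S : R -> V -> V) (x : V) : V :=
  lim (h^-1 *: (S h x - x) @[h --> 0^'+]).

Definition resolvent (V : normedModType R) (S : R -> V -> V) (alpha : R)
    (x : V) : V :=
  bochner_integral (@lebesgue_measure R) `[0, +oo[
    (fun s : R => expR (- (alpha * s)) *: S s x).

End semigroup.

Section entrance.
Context {R : realType} (H : hilbertType R) (T : R -> H -> H).

(* Paths indexed by s > 0 are functions on R, the values at s <= 0 being
   irrelevant. *)
Definition entrance_path (p : R -> H) : Prop :=
  forall r t, 0 < r -> 0 < t -> p (r + t) = T t (p r).

Definition locally_square_integrable (p : R -> H) : Prop :=
  exists l : R, 0 < l /\
    (\int[@lebesgue_measure R]_(s in `]0%R, l]) ((`|p s| ^+ 2)%:E) < +oo)%E.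

(* The Hilbert space Ht, whose element x has the path [ev x], is the entrance
   space.  Injectivity of [ev] on s > 0 follows from the formula for the inner
   product, so Ht is determined up to a unique isometry. *)
Definition is_entrance_space (b : R) (Ht : hilbertType R) (ev : Ht -> R -> H)
    : Prop :=
  [/\ forall x, entrance_path (ev x) /\ locally_square_integrable (ev x),
      forall p, entrance_path p -> locally_square_integrable p ->
        exists x, forall s, 0 < s -> ev x s = p s,
      forall (c : R) x y s, 0 < s ->
        ev (c *: x + y) s = c *: ev x s + ev y s &
      forall x y, inner x y = \int[@lebesgue_measure R]_(s in `]0%R, +oo[)
        (expR (- (2 * b * s)) * inner (ev x s) (ev y s))].

(* Hb, with embedding [iota], is the completion of Ht for the norm |.|_- *)
Definition is_minus_completion (b alpha : R) (Ht : hilbertType R)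
    (ev : Ht -> R -> H) (Hb : hilbertType R) (iota : Ht -> Hb) : Prop :=
  [/\ linear iota,
      dense (range iota) &
      forall x y, inner (iota x) (iota y) =
        \int[@lebesgue_measure R]_(s in `]0%R, +oo[)
          (expR (- (2 * b * s)) *
           inner (resolvent T alpha (ev x s)) (resolvent T alpha (ev y s)))].

End entrance.

Section convolution.
Context {R : realType} (K : hilbertType R).

Definition convolution (m n : set (borel K) -> \bar R) : set (borel K) -> \bar R :=
  fun B => (\int[n]_y m [set x | B ((x : K) + (y : K))%R])%E.

Definition infinitely_divisible (m : probability (borel K) R) : Prop :=
  forall n, (0 < n)%N -> exists nu : probability (borel K) R,
    forall B : set (borel K), measurable B ->
      m B = iter n (fun k => convolution k nu) (@dirac _ (borel K) (0 : K) R) B.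

Definition centered (m : probability (borel K) R) : Prop :=
  is_bochner_integral m setT (fun x : borel K => (x : K)) 0.

Definition sc_semigroup (S : R -> K -> K) (mu : R -> probability (borel K) R)
    : Prop :=
  forall r t, 0 <= r -> 0 <= t ->
  forall B : set (borel K), measurable B ->
    mu (r + t) B =
    convolution (pushforward (mu r) (S t : borel K -> borel K)) (mu t) B.

Definition mehler (S : R -> K -> K) (mu : R -> probability (borel K) R)
    (t : R) (f : K -> R) (x : K) : R :=
  \int[mu t]_y f (S t x + (y : K)).

End convolution.

Definition cadlag {R : realType} (V : normedModType R) (x : R -> V) : Prop :=
  (forall t, 0 <= t -> x s @[s --> t^'+] --> x t) /\
  (forall t, 0 < t -> cvg (x s @[s --> t^'-])).

Section processes.
Context {R : realType} d (Omega : measurableType d) (P : probability Omega R).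
Context (K : hilbertType R).
Implicit Types (X : R -> Omega -> K) (F : R -> set (set Omega)).

Definition measurable_process X : Prop :=
  forall t, 0 <= t -> measurable_fun setT (X t : Omega -> borel K).

Definition independent_increments X : Prop :=
  forall (n : nat) (t : nat -> R), 0 <= t 0%N ->
    (forall i, t i <= t i.+1) ->
  forall B : nat -> set (borel K), (forall i, measurable (B i)) ->
    P (\bigcap_(i < n) [set w | B i (X (t i.+1) w - X (t i) w)]) =
    (\prod_(i < n) P [set w | B i (X (t i.+1) w - X (t i) w)%R])%E.

Definition natural_filtration X (t : R) : set (set Omega) :=
  <<s [set A | exists s (B : set (borel K)),
         [/\ 0 <= s <= t, measurable B & A = X s @^-1` B]] >>.

Definition right_limit_filtration F (t : R) : set (set Omega) :=
  [set A | forall u, t < u -> F u A].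

Definition stopping_time F (tau : Omega -> \bar R) : Prop :=
  (forall w, (0 <= tau w)%E) /\
  (forall t, 0 <= t -> F t [set w | (tau w <= t%:E)%E]).

Definition stopped_sigma_algebra F (tau : Omega -> \bar R) : set (set Omega) :=
  [set A | measurable A /\
     forall t, 0 <= t -> F t (A `&` [set w | (tau w <= t%:E)%E])].

(* On the event E, the variable W is a version of the conditional expectation
   of Z given the sub-sigma-algebra G. *)
Definition cond_expectation_on (G : set (set Omega)) (E : set Omega)
    (Z W : Omega -> R) : Prop :=
  [/\ P.-integrable E (EFin \o Z),
      forall B : set R, measurable B -> G (E `&` W @^-1` B) &
      forall A, G A -> \int[P]_(w in A `&` E) W w = \int[P]_(w in A `&` E) Z w].

(* Strong Markov property with respect to the right-continuous filtration
   F_{t+} generated by X: on {tau < oo},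
   E[f(X_{tau+t}) | F_{tau+}] = Q_t f(X_tau). *)
Definition strong_markov X (Q : R -> (K -> R) -> K -> R) : Prop :=
  let F := right_limit_filtration (natural_filtration X) in
  forall tau, stopping_time F tau ->
  forall t, 0 <= t ->
  forall f : K -> R, measurable_fun setT (f : borel K -> R) ->
    (exists M, forall x, `|f x| <= M) ->
    cond_expectation_on (stopped_sigma_algebra F tau)
      [set w | (tau w < +oo)%E]
      (fun w => f (X (fine (tau w) + t) w))
      (fun w => Q t f (X (fine (tau w)) w)).

End processes.

(* Main.v *)
(* Let A be the generator of the extended semigroup on Hb, restricted to Ht, and let k_u
   be the adjoint of Tb_u on Ht.  The resolvent acts on entrance paths by an operator V with
   |iota x| = |V x|, whence A is bounded from Ht to Hb and Tb_(t-v) x is differentiable in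
   v with derivative - Tb_(t-v) A x.  A cadlag path Y is bounded on compact intervals, so the
   integral defining X exists, and summation by parts shows that <X_t, a> - <Tb_(t-s) X_s, a>
   is the limit of the sums of <Y_(u+) - Y_u, k_(t-u) a> over grids of [s, t].  Independence of
   the increments of Y then makes its characteristic function, given the past of X,
   exp (- int_0^(t-s) psit0 (k_u a) du).  As psi_u and psit0 are continuous logarithms
   vanishing at 0, psi_u ((iota J)^* a) = psit0 (k_u a), so this is the characteristic
   functional of mub_(t-s).  This is the Markov property tested on exp (i <X_t, a>); since
   Q_t maps such a function to a continuous one, right continuity extends it from grid-valued
   stopping times to all stopping times of the right-continuous filtration, and a monotone
   class argument extends it from trigonometric to bounded Borel functions. *)
Require Import Defs.
From HB Require Import structures.
From mathcomp Require Import all_boot all_order all_algebra.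
From mathcomp Require Import all_classical all_reals all_analysis.
From mathcomp Require Import complex.
From mathcomp Require Import measurable_realfun.
From mathcomp Require Import ring lra.

Set Implicit Arguments.
Unset Strict Implicit.
Unset Printing Implicit Defensive.

Import Order.TTheory GRing.Theory Num.Theory.
Import numFieldNormedType.Exports.

Local Open Scope classical_set_scope.
Local Open Scope ring_scope.
Local Open Scope complex_scope.

(** The obstacle is that the generator is unbounded on [Hb], while [Y] is rough in time. Summation
    by parts trades the random integrand for increments of [Y] paired with deterministic vectors k_u
    a. Since A is bounded from [Ht] to [Hb], u -> k_u a is Lipschitz in norm; hence the grid sums
    and the exponents of their characteristic functions, which are exact at each stage, both
    converge. The same sums on [0, t] exhibit <X_t, a> as a pointwise limit of affine combinations
    of values of [Y] up to t. This yields measurability of X and reduces the past of X to the past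
    of [Y], where independence is available. Vector-valued statements are tested against fixed
    vectors, and statements on events against characters of finitely many values of X. Continuous
    logarithms are compared only along rays c -> c a, so the intermediate value theorem settles
    their uniqueness. The times approximating a stopping time tau lie strictly above it, because it
    is {tau < c}, and not {tau <= c}, that is known to belong to the natural filtration at time
    c. *)

Lemma cvg_cauchy_filter (R : realType) (V : completeNormedModType R) (T : Type)
    (F : set_system T) {FF : ProperFilter F} (f : T -> V) :
  (forall e : R, 0 < e -> exists x, \forall t \near F, `|x - f t| < e) ->
  cvg (f @ F).
Proof.
move=> H; apply/cauchy_cvgP/cauchy_exP => e e0; have [x Hx] := H _ e0.
by exists x; rewrite -ball_normE.
Qed.

(** * Hilbert spaces and bounded operators *)

Section Hilbert.
Context {R : realType} (K : hilbertType R).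
Implicit Types x y z a : K.

Lemma innerDr x y z : inner x (y + z) = inner x y + inner x z.
Proof. by rewrite innerC innerDl !(innerC _ x). Qed.

Lemma innerZr (c : R) x y : inner x (c *: y) = c * inner x y.
Proof. by rewrite innerC innerZl innerC. Qed.

Lemma inner0l y : inner 0 y = 0.
Proof. by rewrite -(scale0r 0) innerZl mul0r. Qed.

Lemma inner0r x : inner x 0 = 0.
Proof. by rewrite innerC inner0l. Qed.

Lemma innerNl x y : inner (- x) y = - inner x y.
Proof. by rewrite -scaleN1r innerZl mulN1r. Qed.

Lemma innerNr x y : inner x (- y) = - inner x y.
Proof. by rewrite innerC innerNl innerC. Qed.

Lemma innerBl x y z : inner (x - y) z = inner x z - inner y z.
Proof. by rewrite innerDl innerNl. Qed.

Lemma innerBr x y z : inner x (y - z) = inner x y - inner x z.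
Proof. by rewrite innerDr innerNr. Qed.

Lemma inner_suml I (r : seq I) (P : pred I) (F : I -> K) y :
  inner (\sum_(i <- r | P i) F i) y = \sum_(i <- r | P i) inner (F i) y.
Proof.
by apply: (big_morph (inner^~ y)) => [u v|]; rewrite ?innerDl ?inner0l.
Qed.

Lemma sqr_normD x y : `|x + y| ^+ 2 = `|x| ^+ 2 + 2 * inner x y + `|y| ^+ 2.
Proof.
rewrite -!inner_norm innerDl !innerDr (innerC y x); ring.
Qed.

Lemma inner_le_norm x y : `|inner x y| <= `|x| * `|y|.
Proof.
have [->|y0] := eqVneq y 0; first by rewrite inner0r !normr0 mulr0.
have y2 : 0 < `|y| ^+ 2 by rewrite exprn_gt0 ?normr_gt0.
rewrite -(@ler_pXn2r _ 2) ?nnegrE ?mulr_ge0// exprMn real_normK ?num_real//.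
set c := inner x y.
have : 0 <= `|(`|y| ^+ 2) *: x + (- c) *: y| ^+ 2 by rewrite exprn_ge0.
rewrite sqr_normD !normrZ !exprMn innerZl innerZr -/c !real_normK ?num_real//.
have -> : (`|y| ^+ 2) ^+ 2 * `|x| ^+ 2 + 2 * (`|y| ^+ 2 * (- c * c)) +
  (- c) ^+ 2 * `|y| ^+ 2 = (`|y| ^+ 2) * (`|x| ^+ 2 * `|y| ^+ 2 - c ^+ 2) by ring.
by rewrite pmulr_rge0// subr_ge0.
Qed.

Lemma inner_ext x y : (forall a, inner x a = inner y a) -> x = y.
Proof.
move=> xy; apply/eqP; rewrite -subr_eq0 -normr_eq0 -sqrf_eq0 -inner_norm.
by rewrite innerBl xy subrr.
Qed.

(** Test with a = x. Vectors known only through their inner products, such as Bochner integrals, are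
    estimated this way. *)
Lemma norm_le_inner x (c : R) : 0 <= c ->
  (forall a, inner x a <= c * `|a|) -> `|x| <= c.
Proof.
move=> c0 /(_ x); rewrite inner_norm expr2.
have [->//|x0] := eqVneq `|x| 0.
by rewrite ler_pM2r// lt0r x0/=.
Qed.

Lemma cvg_inner (T : Type) (F : set_system T) {FF : Filter F} (f g : T -> K) x y :
  f @ F --> x -> g @ F --> y -> inner (f t) (g t) @[t --> F] --> inner x y.
Proof.
move=> fx gy.
have E (u v : K) : inner u v = (`|u + v| ^+ 2 - `|u| ^+ 2 - `|v| ^+ 2) / 2.
  by rewrite sqr_normD; lra.
have sq (h : T -> K) z : h @ F --> z -> `|h t| ^+ 2 @[t --> F] --> `|z| ^+ 2.
  by move=> hz; rewrite expr2; under eq_fun do rewrite expr2; apply: cvgM; apply: cvg_norm.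
rewrite E; under eq_fun do rewrite E.
by apply: cvgMl; apply: cvgB; [apply: cvgB|]; apply: sq => //; apply: cvgD.
Qed.

Lemma continuous_innerl a : continuous (fun x : K => inner x a).
Proof. by move=> x; apply: cvg_inner; [exact: cvg_id|exact: cvg_cst]. Qed.

Lemma riesz (f : K -> R) (C : R) :
  linear f -> (forall x, `|f x| <= C * `|x|) -> exists a, forall x, f x = inner x a.
Proof.
move=> flin fC.
have fD x y : f (x + y) = f x + f y by have := flin 1 x y; rewrite !scale1r.
have f0 : f 0 = 0 by have := fD 0 0; rewrite addr0; lra.
have fZ c x : f (c *: x) = c * f x by have := flin c x 0; rewrite f0 !addr0.
have fN x : f (- x) = - f x by rewrite -scaleN1r fZ mulN1r.
(* The representing vector minimises [J]. *)
pose J x := `|x| ^+ 2 - 2 * f x.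
have JC x : - C ^+ 2 <= J x.
  rewrite /J; have := fC x; have := ler_norm (f x); have := normr_ge0 x.
  have := sqr_ge0 (`|x| - C); nra.
have Jlb : has_inf (range J).
  by split; [exists (J 0), 0|exists (- C ^+ 2) => _ [x _ <-]].
pose m := inf (range J).
have mJ x : m <= J x by apply: ge_inf; [case: Jlb|exists x].
(* [J] at the midpoint is at least [m]; by the parallelogram law almost minimal points are therefore
   close, so a minimising sequence is Cauchy. *)
have par x y : `|x - y| ^+ 2 <= 2 * (J x - m) + 2 * (J y - m).
  have := mJ (2^-1 *: (x + y)); rewrite /J normrZ exprMn fZ fD.
  have -> : `|2^-1| ^+ 2 = 4^-1 :> R by rewrite ger0_norm ?invr_ge0//; field.
  by rewrite !sqr_normD innerNr normrN; lra.
have /choice[u uP] (n : nat) : exists x, J x < m + n.+1%:R^-1.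
  have n0 : 0 < n.+1%:R^-1 :> R by rewrite invr_gt0.
  have [_ [x _ <-] xm] := inf_adherent n0 Jlb.
  by exists x.
have uC n k N : (N <= n)%N -> (N <= k)%N -> `|u n - u k| ^+ 2 <= 4 * N.+1%:R^-1.
  move=> Nn Nk; have H j : (N <= j)%N -> J (u j) - m <= N.+1%:R^-1.
    move=> Nj; rewrite lerBlDl ltW// (lt_le_trans (uP _))// lerD2l.
    by rewrite lef_pV2 ?posrE// ler_nat.
  by have := H _ Nn; have := H _ Nk; have := par (u n) (u k); set q := _^-1; lra.
have uc : cvg (u @ \oo).
  apply: cvg_cauchy_filter => e e0.
  have e4 : 0 < e ^+ 2 / 4 by rewrite divr_gt0// exprn_gt0.
  have [N _ NP] := near_infty_natSinv_lt (PosNum e4).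
  exists (u N); exists N => // n /= Nn.
  rewrite -(@ltr_pXn2r _ 2) ?nnegrE ?(ltW e0)//.
  have : N.+1%:R^-1 < e ^+ 2 / 4 := NP N (leqnn N); have := uC N n N (leqnn _) Nn.
  by set q := N.+1%:R^-1; lra.
set a := lim (u @ \oo) in uc.
have aP x : J a <= J x.
  have Jc : J (u n) @[n --> \oo] --> J a.
    apply: cvgB; first by rewrite -inner_norm; under eq_fun do rewrite -inner_norm; exact: cvg_inner.
    apply: cvgMr; apply/cvgrPdist_le => e e0.
    have C1 : 0 < `|C| + 1 by rewrite ltr_pwDr.
    move/cvgrPdist_le : uc => /(_ (e / (`|C| + 1)) (divr_gt0 e0 C1)).
    apply: filterS => n; rewrite ler_pdivlMr// => H.
    rewrite -fN -fD; apply: le_trans (fC _) _; apply: le_trans H; rewrite mulrC ler_wpM2l//.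
    by rewrite (le_trans (ler_norm _))// lerDl.
  suff Jm : J (u n) @[n --> \oo] --> m by rewrite (cvg_unique _ Jc Jm) ?mJ.
  apply/cvgrPdist_le => e e0.
  have [N _ NP] := near_infty_natSinv_lt (PosNum e0).
  exists N => // n /= Nn; rewrite ler0_norm ?subr_le0// opprB.
  have : n.+1%:R^-1 < e := NP n Nn; have := uP n; set q := n.+1%:R^-1.
  by lra.
exists a => h; rewrite innerC; apply/eqP; rewrite -subr_eq0 -oppr_eq0 opprB; apply/eqP.
(* First-order condition at the minimiser: [J (a + t *: h) - J a] is a nonnegative quadratic in t,
   so its linear coefficient [g] must vanish. The t inserted below is the vertex - g / |h|^2 with 1
   added to the denominator to keep it positive. *)
set g := _ - _; have gP (t : R) : 0 <= 2 * t * g + t ^+ 2 * `|h| ^+ 2.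
  have := aP (a + t *: h); rewrite /J sqr_normD normrZ exprMn real_normK ?num_real//.
  rewrite fD fZ innerZr /g; set i := inner a h; set F := f h; set q := `|h| ^+ 2.
  by set A := `|a| ^+ 2; set B := f a; nra.
have h0 : 0 < `|h| ^+ 2 + 1 by rewrite ltr_wpDl// exprn_ge0.
have := gP (- g / (`|h| ^+ 2 + 1)).
set q := `|h| ^+ 2 in h0 *; have q0 : 0 <= q by rewrite exprn_ge0.
have -> : 2 * (- g / (q + 1)) * g + (- g / (q + 1)) ^+ 2 * q =
  - (g ^+ 2 * ((q + 2) / (q + 1) ^+ 2)) by field; rewrite gt_eqF.
rewrite oppr_ge0 pmulr_lle0 ?divr_gt0 ?exprn_gt0//; last by lra.
by move=> g2; apply/eqP; rewrite -sqrf_eq0 eq_le g2 sqr_ge0.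
Qed.

End Hilbert.

Section BoundedOperators.
Context {R : realType}.

Lemma linear0f (V W : lmodType R) (f : V -> W) : linear f -> f 0 = 0.
Proof. by move=> /(_ (-1) 0 0); rewrite scaler0 addr0 scaleN1r addNr. Qed.

Lemma linearDf (V W : lmodType R) (f : V -> W) x y :
  linear f -> f (x + y) = f x + f y.
Proof. by move=> /(_ 1 x y); rewrite !scale1r. Qed.

Lemma linearZf (V W : lmodType R) (f : V -> W) (c : R) x :
  linear f -> f (c *: x) = c *: f x.
Proof. by move=> lf; have := lf c x 0; rewrite (linear0f lf) !addr0. Qed.

Lemma linearNf (V W : lmodType R) (f : V -> W) x : linear f -> f (- x) = - f x.
Proof. by move=> lf; rewrite -scaleN1r linearZf// scaleN1r. Qed.

Lemma linearBf (V W : lmodType R) (f : V -> W) x y :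
  linear f -> f (x - y) = f x - f y.
Proof. by move=> lf; rewrite linearDf// linearNf. Qed.

Lemma continuous_of_bound (V W : normedModType R) (f : V -> W) (C : R) :
  linear f -> (forall x, `|f x| <= C * `|x|) -> continuous f.
Proof.
move=> lf fC x; apply/cvgrPdist_le => e e0.
have C1 : 0 < `|C| + 1 by rewrite ltr_pwDr.
near=> y; rewrite -linearBf// (le_trans (fC _))//.
rewrite (@le_trans _ _ ((`|C| + 1) * `|x - y|))// ?ler_wpM2r//.
  by rewrite (le_trans (ler_norm _))// lerDl.
rewrite mulrC -ler_pdivlMr//; near: y.
by move/cvgrPdist_le : (@cvg_id _ (nbhs x)); apply; rewrite divr_gt0.
Unshelve. all: by end_near. Qed.

Lemma bound_of_bounded_operator (V W : normedModType R) (f : V -> W) :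
  bounded_operator f -> exists2 C, 0 <= C & forall x, `|f x| <= C * `|x|.
Proof.
move=> [lf cf].
have /cvgrPdist_lt/(_ 1 ltr01) := cf 0; rewrite linear0f//.
move=> /nbhs_norm0P[e /= e0 ef]; exists (2 / e); first by rewrite divr_ge0// ltW.
move=> x; have [->|x0] := eqVneq x 0; first by rewrite linear0f// !normr0 mulr0.
have nx : 0 < `|x| by rewrite normr_gt0.
have /ef : `|(e / 2 / `|x|) *: x| < e.
  rewrite normrZ ger0_norm ?divr_ge0 ?ltW//.
  by rewrite divfK ?gt_eqF// ltr_pdivrMr//; lra.
rewrite /= sub0r normrN linearZf// normrZ.
have -> : `|e / 2 / `|x| | = e / 2 / `|x| by rewrite ger0_norm// ?divr_ge0 ?ltW.
set F := `|f x|; set N := `|x| in nx *.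
have <- : F / (2 / e * N) = e / 2 / N * F by field; rewrite !gt_eqF.
have p0 : 0 < 2 / e * N by rewrite mulr_gt0// divr_gt0.
by rewrite ltr_pdivrMr// mul1r => /ltW.
Qed.

(** Used to move an operator across an inner product: this is how semigroup operators pass through
    scalar integrals and how [inner (S t (X s w)) a] is seen to be measurable. *)
Lemma adjoint_exists (V W : hilbertType R) (f : V -> W) :
  bounded_operator f -> exists g : W -> V, forall x y, inner (f x) y = inner x (g y).
Proof.
move=> bf; have [C C0 fC] := bound_of_bounded_operator bf.
have lf := bf.1.
suff : forall y, exists a, forall x, inner (f x) y = inner x a.
  by move=> /choice[g gP]; exists g => x y; rewrite gP.
move=> y; apply: (@riesz _ _ (fun x => inner (f x) y) (C * `|y|)).
  by move=> c u v /=; rewrite lf innerDl innerZl.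
move=> x; apply: le_trans (inner_le_norm _ _) _.
by rewrite mulrAC ler_wpM2r.
Qed.

Lemma dense_le (W : topologicalType) (D : set W) (f g : W -> R) :
  dense D -> continuous f -> continuous g ->
  (forall x, D x -> f x <= g x) -> forall x, f x <= g x.
Proof.
move=> dD cf cg fg x; rewrite leNgt; apply/negP => gfx.
have o : open [set y | 0 < f y - g y].
  apply: (@open_comp _ _ (fun y => f y - g y) [set r | 0 < r]); last exact: open_gt.
  by move=> y _; apply: cvgB; [exact: cf|exact: cg].
have /(dD _)/(_ o)[y [/= Hy Dy]] : [set y | 0 < f y - g y] !=set0.
  by exists x => /=; rewrite subr_gt0.
by have := fg _ Dy; rewrite leNgt -subr_gt0 Hy.
Qed.

Lemma dense_eq (W : topologicalType) (V : normedModType R) (D : set W) (f g : W -> V) :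
  dense D -> continuous f -> continuous g ->
  (forall x, D x -> f x = g x) -> f =1 g.
Proof.
move=> dD cf cg fg x; apply/eqP; rewrite -subr_eq0 -normr_le0.
apply: (@dense_le W D (fun x => `|f x - g x|) (cst 0)) => //.
- by move=> y; apply: cvg_norm; apply: cvgB; [exact: cf|exact: cg].
- by move=> y; exact: cvg_cst.
- by move=> y /fg ->; rewrite subrr normr0.
Qed.

End BoundedOperators.

(** * Dominated convergence for real integrals *)

Section RealIntegral.
Context d (T : measurableType d) {R : realType} (mu : {measure set T -> \bar R}).

Lemma bounded_integrable (D : set T) (f : T -> R) (M : R) :
  measurable D -> (mu D < +oo)%E -> measurable_fun D f ->
  (forall x, D x -> `|f x| <= M) -> mu.-integrable D (EFin \o f).
Proof.
move=> mD Doo mf fM; apply: measurable_bounded_integrable => //.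
exists M; split; first exact: num_real.
by move=> y My x Dx /=; have fx := fM _ Dx; rewrite (le_trans fx)// ltW.
Qed.

Lemma Rintegral_dominated (D : set T) (f_ : nat -> T -> R) (f g : T -> R) :
  measurable D -> (forall n, measurable_fun D (f_ n)) ->
  (forall x, D x -> f_ n x @[n --> \oo] --> f x) ->
  mu.-integrable D (EFin \o g) ->
  (forall n x, D x -> `|f_ n x| <= g x) ->
  [/\ mu.-integrable D (EFin \o f),
      \int[mu]_(x in D) f_ n x @[n --> \oo] --> \int[mu]_(x in D) f x &
      (\int[mu]_(x in D) `|f_ n x - f x|%:E)%E @[n --> \oo] --> 0%E].
Proof.
move=> mD mf_ cf ig fg.
have mf : measurable_fun D f by exact: measurable_fun_cvg cf.
have [|||||i0 i1 i2] := @dominated_convergence _ _ _ mu D mD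
  (fun n => EFin \o f_ n) (EFin \o f) (EFin \o g).
- by move=> n; exact/measurable_EFinP.
- exact/measurable_EFinP.
- by apply: aeW => x Dx; apply: cvg_EFin; [exact: nearW|exact: cf].
- exact: ig.
- by apply: aeW => x n Dx /=; rewrite lee_fin fg.
split => //.
apply: fine_cvg; rewrite fineK//; exact: integrable_fin_num.
Qed.

End RealIntegral.

(** * Borel sets of a separable Hilbert space *)

Section SeparableBorel.
Context {R : realType} (K : hilbertType R) (sepK : separable K).

Lemma separable_seq : exists u : nat -> K, dense (range u).
Proof.
have [D [/countable_injP[g ginj] dD]] := sepK.
have [x0 _] : exists x0 : K, True by exists 0.
exists (fun n => xget x0 [set x | D x /\ g x = n]) => U U0 oU.
have [x [Ux Dx]] := dD U U0 oU; exists x; split => //; exists (g x) => //.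
case: xgetP => [y _ [Dy gyx]|/(_ x)]; last by case.
by apply: ginj => //; rewrite inE.
Qed.

(** By separability a closed ball is a countable intersection of closed half-spaces, and an open set
    is a countable union of closed balls centred at a dense sequence. *)
Lemma sigma_algebra_open (S : set (set K)) : sigma_algebra setT S ->
  (forall a c, S [set x | c < inner x a]) -> @open K `<=` S.
Proof.
move=> [S0 SC SU] Sh U oU; have [u du] := separable_seq.
have {}SC A : S A -> S (~` A) by move=> /SC; rewrite setTD.
have Sball y r : 0 <= r -> S [set x : K | `|x - y| <= r].
  move=> r0.
  rewrite (_ : mkset _ = ~` \bigcup_n [set x | r * `|u n| + inner y (u n) < inner x (u n)]).
    by apply: (SC); apply: (SU) => n; exact: (Sh).
  apply/seteqP; split => [x /= xy [n _ /=]|x xu /=].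
    apply/negP; rewrite -leNgt -lerBlDr -innerBl.
    by rewrite (le_trans (ler_norm _))// (le_trans (inner_le_norm _ _))// ler_wpM2r.
  apply: norm_le_inner => //.
  apply: (dense_le du).
  - by move=> z; apply: cvg_inner; [exact: cvg_cst|exact: cvg_id].
  - by move=> z; apply: cvgMr; apply: cvg_norm; exact: cvg_id.
  - move=> _ [n _ <-]; rewrite innerBl lerBlDr leNgt; apply/negP => H.
    by apply: xu; exists n.
rewrite (_ : U = \bigcup_n \bigcup_k
  [set x | [set y : K | `|y - u n| <= k.+1%:R^-1] `<=` U /\ `|x - u n| <= k.+1%:R^-1]).
  apply: (SU) => n; apply: (SU) => k.
  have [sU|sU] := pselect ([set y : K | `|y - u n| <= k.+1%:R^-1] `<=` U).
    rewrite (_ : mkset _ = [set y : K | `|y - u n| <= k.+1%:R^-1]); first exact: (Sball).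
    by apply/seteqP; split => x /=; [case|].
  by rewrite (_ : mkset _ = set0)//; apply/seteqP; split => x //= [].
apply/seteqP; split => [x Ux|x [n _ [k _ [/(_ x) sU xn]]]]; last exact: sU.
have := open_nbhs_nbhs (conj oU Ux); move=> /nbhs_normP[e /= e0 eU].
(* A ball of radius below e / 2 that contains x stays inside the e-ball around x. *)
have e2 : 0 < e / 2 by rewrite divr_gt0.
have [N _ NP] := near_infty_natSinv_lt (PosNum e2).
have NP' : N.+1%:R^-1 < e / 2 := NP N (leqnn N).
have N0 : 0 < N.+1%:R^-1 :> R by rewrite invr_gt0.
have [||y [/= yx [n _ uny]]] := du [set y | `|x - y| < N.+1%:R^-1].
- by exists x => /=; rewrite subrr normr0.
- rewrite (_ : mkset _ = ball x N.+1%:R^-1); first exact: ball_open.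
  by rewrite -ball_normE.
exists n => //; exists N => //=; rewrite uny; split; last exact: ltW.
move=> z /= zy; apply: eU => /=.
have := ler_normD (x - y) (y - z); rewrite subrKA (distrC y).
by move: NP' yx zy; set q := N.+1%:R^-1; lra.
Qed.

Lemma sigma_algebra_borel (S : set (set K)) : sigma_algebra setT S ->
  (forall a c, S [set x | c < inner x a]) ->
  forall B : set (borel K), measurable B -> S B.
Proof. by move=> sS Sh B; apply: smallest_sub => //; exact: sigma_algebra_open. Qed.

Lemma measurable_of_continuous (f : K -> R) :
  continuous f -> measurable_fun setT (f : borel K -> R).
Proof.
move=> cf; apply: (measurability _ (RGenOInfty.measurableE R)).
move=> _ [_ [c ->] <-]; rewrite setTI; apply: sub_sigma_algebra.
apply: open_comp; first by move=> x _; exact: cf.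
exact: interval_open.
Qed.

Lemma measurable_inner a : measurable_fun setT (fun x : borel K => inner (x : K) a).
Proof. exact: measurable_of_continuous (@continuous_innerl _ _ a). Qed.

(** Half-spaces generate the Borel sets, so scalar tests suffice. Measurability of the
    Hilbert-valued maps built below is reduced to real functions through this lemma. *)
Lemma measurable_weak d (T : measurableType d) (D : set T) (f : T -> K) :
  (forall a, measurable_fun D (fun w => inner (f w) a)) ->
  measurable_fun D (f : T -> borel K).
Proof.
move=> mf mD B mB.
apply: (@sigma_algebra_borel [set B | measurable (D `&` f @^-1` B)]) => //.
- split.
  + by rewrite /= preimage_set0 setI0.
  + move=> A /= mA; rewrite setTD (_ : _ `&` _ = D `\` (D `&` f @^-1` A)).
      exact: measurableD.
    by apply/seteqP; split => x /=; [case=> Dx nA; split => // -[]|case=> Dx nA; split => // Ax; apply: nA].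
  + move=> A mA /=; rewrite preimage_bigcup setI_bigcupr.
    exact: bigcupT_measurable.
- move=> a c /=; rewrite (_ : _ `&` _ = D `&` (fun w => inner (f w) a) @^-1` `]c, +oo[).
    exact: mf.
  by apply/seteqP; split => x /=; rewrite in_itv/= andbT.
Qed.

End SeparableBorel.

(** * Functional monotone classes *)

Section BoundedClass.

(** The limits are bounded rather than monotone because the classes defined by integrals below pass
    to the limit by dominated convergence. *)
Definition monotone_class {R : realType} (T : Type) (V : set (T -> R)) : Prop :=
  (forall c f g, V f -> V g -> V (fun x => c * f x + g x)) /\
  (forall (f_ : nat -> T -> R) (f : T -> R) (M : R), (forall n, V (f_ n)) ->
     (forall n x, `|f_ n x| <= M) ->
     (forall x, f_ n x @[n --> \oo] --> f x) -> V f).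

Import HBNNSimple.
Context {R : realType}.

Lemma monotone_class_measurable d (T : measurableType d) (V : set (T -> R)) :
  monotone_class V -> (forall B, measurable B -> V \1_B) ->
  forall (f : T -> R) (M : R), measurable_fun setT f -> (forall x, `|f x| <= M) -> V f.
Proof.
move=> [Vl Vc] V1 f M mf fM.
have V0 : V (fun=> 0) by rewrite (_ : (fun=> 0) = \1_set0 :> (T -> R)) ; [exact: V1|rewrite indic0].
have VZ c g : V g -> V (fun x => c * g x).
  by move=> Vg; rewrite (_ : (fun x => _) = fun x => c * g x + 0); [exact: Vl|apply/funext => x; rewrite addr0].
have VD g h : V g -> V h -> V (fun x => g x + h x).
  by move=> Vg Vh; rewrite (_ : (fun x => _) = fun x => 1 * g x + h x); [exact: Vl|apply/funext => x; rewrite mul1r].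
(* Approximation by increasing simple functions requires a nonnegative function; the shift by [M] is
   undone with a multiple of the indicator of the whole space. *)
pose g x := f x + M.
have M0 (x : T) : 0 <= M by exact: le_trans (normr_ge0 _) (fM x).
have g0 x : 0 <= g x by have := fM x; rewrite ler_norml /g; move: (f x) => y; clear; lra.
have g2 x : g x <= 2 * M by have := fM x; rewrite ler_norml /g; move: (f x) => y; clear; lra.
have mg : measurable_fun setT (EFin \o g) by apply/measurable_EFinP; exact: measurable_funD.
suff Vg : V g.
  rewrite (_ : f = fun x => (- M) * \1_setT x + g x); first by apply: Vl => //; exact: V1.
  by apply/funext => x; rewrite indicT/= mulr1 /g addrC addrK.
pose h := nnsfun_approx measurableT mg.
have hg n x : h n x <= g x.
  by rewrite nnsfun_approxE -lee_fin; apply: (@le_approx _ _ _ setT (EFin \o g)) => // y _; rewrite lee_fin.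
apply: (Vc (fun n => h n : T -> R) _ (2 * M)).
- move=> n; rewrite (_ : (h n : T -> R) = fun x =>
     \sum_(y <- finmap.enum_fset (fset_set (range (h n)))) (y * \1_(h n @^-1` [set y]) x)); last first.
    by apply/funext => x; rewrite fimfunE fsbig_finite//.
  elim: (finmap.enum_fset _) => [|y s ih].
    by under eq_fun do rewrite big_nil.
  under eq_fun do rewrite big_cons; apply: VD => //; apply: VZ; apply: V1.
  exact: measurable_sfunP.
- by move=> n x; rewrite ger0_norm// (le_trans (hg _ _)).
- move=> x.
  have := @cvg_nnsfun_approx _ _ _ setT measurableT (EFin \o g) mg (fun x _ => g0 x) x I.
  by move/fine_cvg.
Qed.

End BoundedClass.

(** * Trigonometric functions determine bounded Borel functions *)

Section TrigClass.
Context {R : realType}.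

Lemma bernoulli_ineq (x : R) n : -1 <= x -> 1 + n%:R * x <= (1 + x) ^+ n.
Proof.
move=> x1; elim: n => [|n ih]; first by rewrite mul0r addr0 expr0.
have : (1 + x) * (1 + n%:R * x) <= (1 + x) * (1 + x) ^+ n by rewrite ler_wpM2l//; lra.
rewrite -exprS; apply: le_trans; rewrite -natr1.
have : 0 <= n%:R * x ^+ 2 by rewrite mulr_ge0// sqr_ge0.
by rewrite expr2; set k := n%:R; nra.
Qed.

(** Bernoulli's inequality on both sides of 1/2: below, the expression is at least 1 - (2v)^n;
    above, multiplying by (1 + v^n)^(2^n) >= (2v)^n gives at most 1, so it is at most 1 / (2v)^n.
    These are the polynomials of the elementary proof of the Stone-Weierstrass theorem. *)
Lemma cvg_threshold (v : R) : 0 <= v <= 1 -> v != 2^-1 ->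
  (1 - v ^+ n) ^+ (2 ^ n) @[n --> \oo] --> ((v < 2^-1)%R%:R : R).
Proof.
move=> /andP[v0 v1] v2.
have vn n : 0 <= v ^+ n <= 1 by rewrite exprn_ge0//= exprn_ile1.
have [vlt|vge] := ltP v 2^-1 => /=.
  apply: (@squeeze_cvgr _ _ _ _ (fun n => 1 - (2 * v) ^+ n) (fun=> 1)); last 2 first.
  - rewrite -[X in _ --> X]subr0; apply: cvgB; first exact: cvg_cst.
    by apply: cvg_expr; rewrite ger0_norm ?mulr_ge0//; lra.
  - exact: cvg_cst.
  apply: nearW => n; have /andP[a b] := vn n; apply/andP; split; last first.
    by rewrite exprn_ile1//; lra.
  have := @bernoulli_ineq (- v ^+ n) (2 ^ n)%N; rewrite lerN2 => /(_ b).
  by rewrite mulrN natrX exprMn.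
have v2n : 0 < 2 * v - 1 by move: v2 vge; rewrite le_eqVlt eq_sym => /negPf ->/=; lra.
apply: (@squeeze_cvgr _ _ _ _ (fun=> 0) (fun n => (2 * v - 1)^-1 * n.+1%:R^-1)); last 2 first.
- exact: cvg_cst.
- by rewrite -[X in _ --> X](mulr0 (2 * v - 1)^-1); apply: cvgMr; exact: cvg_harmonic.
near=> n; have /andP[a b] := vn n; rewrite exprn_ge0/= ?subr_ge0//.
have n0 : (0 < n)%N by near: n; exact: nbhs_infty_gt.
have H1 : (1 - v ^+ n) ^+ (2 ^ n) * (1 + v ^+ n) ^+ (2 ^ n) <= 1.
  rewrite -exprMn exprn_ile1//.
    by rewrite mulr_ge0//; lra.
  by have := sqr_ge0 (v ^+ n); set z := v ^+ n; lra.
have H2 : (2 * v) ^+ n <= (1 + v ^+ n) ^+ (2 ^ n).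
  have := @bernoulli_ineq (v ^+ n) (2 ^ n)%N; rewrite natrX -exprMn.
  by move=> H; apply: le_trans (H _); [lra|rewrite (le_trans _ a)//; lra].
have H3 : 1 + n%:R * (2 * v - 1) <= (2 * v) ^+ n.
  have -> : 2 * v = 1 + (2 * v - 1) by ring.
  by rewrite {1}addrAC subrr add0r; apply: bernoulli_ineq; lra.
(* Since w <= 1, w (n + 1) <= 1 + n w, which justifies the majorant 1 / (w (n + 1)). *)
set w := 2 * v - 1 in v2n H3 *.
have w1 : w <= 1 by rewrite /w; lra.
rewrite -invfM -[_^-1]mul1r ler_pdivlMr ?mulr_gt0//.
apply: le_trans H1; rewrite ler_wpM2l ?exprn_ge0 ?subr_ge0//.
apply: le_trans H2; apply: le_trans H3; rewrite -natr1 mulrDr mulr1 addrC mulrC.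
by rewrite lerD2r.
Unshelve. all: by end_near. Qed.

Context (K : hilbertType R).

(** The smallest monotone class containing the trigonometric functions, as an intersection.
    Minimality is what allows closure under products to be checked on generators. *)
Definition trig_hull : set (K -> R) := [set f | forall V : set (K -> R),
  monotone_class V ->
  (forall a, V (fun x => cos (inner x a)) /\ V (fun x => sin (inner x a))) -> V f].

Lemma trig_hull_monotone : monotone_class trig_hull.
Proof.
split=> [c f g hf hg V Vm Vt|f_ f M hf fM cf V Vm Vt].
  by apply: Vm.1; [exact: hf|exact: hg].
by apply: (Vm.2 f_ f M) => // n; exact: hf.
Qed.

Lemma trig_hull_cos a : trig_hull (fun x => cos (inner x a)).
Proof. by move=> V _ /(_ a)[]. Qed.

Lemma trig_hull_sin a : trig_hull (fun x => sin (inner x a)).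
Proof. by move=> V _ /(_ a)[]. Qed.

Lemma trig_hull_bounded f : trig_hull f -> exists M, forall x, `|f x| <= M.
Proof.
move=> /(_ [set f | exists M, forall x, `|f x| <= M]); apply.
  split=> [c g h /= [M gM] [N hN]|f_ g M _ fM cf /=].
    exists (`|c| * M + N) => x; rewrite (le_trans (ler_normD _ _))// normrM.
    by rewrite lerD// ler_wpM2l.
  exists M => x; rewrite -(cvg_lim (@Rhausdorff R) (cvg_norm (cf x))).
  apply: limr_le; first by apply/cvg_ex; eexists; exact: cvg_norm (cf x).
  exact: nearW.
by move=> a; split; exists 1 => x; [exact: cos_max|exact: sin_max].
Qed.

Lemma trig_hull_cst c : trig_hull (fun=> c).
Proof.
have [l _] := trig_hull_monotone.
have h := trig_hull_cos 0.
rewrite (_ : (fun=> c) = fun x : K => (c - 1) * cos (inner x 0) + cos (inner x 0)).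
  exact: l.
by apply/funext => x; rewrite inner0r cos0; ring.
Qed.

Lemma trig_hullZ c f : trig_hull f -> trig_hull (fun x => c * f x).
Proof.
move=> hf; have [l _] := trig_hull_monotone.
rewrite (_ : (fun _ => _) = fun x : K => c * f x + 0); first by apply: l => //; exact: trig_hull_cst.
by apply/funext => x; rewrite addr0.
Qed.

Lemma trig_hullD f g : trig_hull f -> trig_hull g -> trig_hull (fun x => f x + g x).
Proof.
move=> hf hg; have [l _] := trig_hull_monotone.
rewrite (_ : (fun _ => _) = fun x : K => 1 * f x + g x); first exact: l.
by apply/funext => x; rewrite mul1r.
Qed.

(** For fixed g, the f such that f g lies in the hull form a monotone class. *)
Lemma trig_hull_mul_closed g : trig_hull g ->
  (forall a, trig_hull (fun x => cos (inner x a) * g x) /\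
             trig_hull (fun x => sin (inner x a) * g x)) ->
  forall f, trig_hull f -> trig_hull (fun x => f x * g x).
Proof.
move=> hg tg f /(_ [set f | trig_hull (fun x => f x * g x)]); apply => //.
split=> [c f1 f2 /= h1 h2|f_ f1 M /= hf fM cf].
  rewrite (_ : (fun _ => _) = fun x => c * (f1 x * g x) + f2 x * g x).
    by apply: trig_hullD => //; exact: trig_hullZ.
  by apply/funext => x; ring.
have [N gN] := trig_hull_bounded hg.
apply: (trig_hull_monotone.2 (fun n x => f_ n x * g x) _ (M * N)) => //.
  by move=> n x; rewrite normrM ler_pM.
by move=> x; apply: cvgMl; exact: cf.
Qed.

(** Two passes: the product formulas handle two generators, the first pass replaces one generator by
    an arbitrary member of the hull, the second pass the other. *)
Lemma trig_hullM f g : trig_hull f -> trig_hull g -> trig_hull (fun x => f x * g x).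
Proof.
move=> hf hg; apply: trig_hull_mul_closed (hf) => // a.
split; under eq_fun do rewrite mulrC.
- apply: trig_hull_mul_closed (hg); first exact: trig_hull_cos.
  move=> e; split.
  + rewrite (_ : (fun _ => _) = fun x : K =>
      2^-1 * (cos (inner x (e + a)) + cos (inner x (e - a)))).
      by apply: trig_hullZ; apply: trig_hullD; exact: trig_hull_cos.
    by apply/funext => x; rewrite innerBr innerDr cosD cosB; lra.
  + rewrite (_ : (fun _ => _) = fun x : K =>
      2^-1 * (sin (inner x (e + a)) + sin (inner x (e - a)))).
      by apply: trig_hullZ; apply: trig_hullD; exact: trig_hull_sin.
    by apply/funext => x; rewrite innerBr innerDr sinD sinB; lra.
- apply: trig_hull_mul_closed (hg); first exact: trig_hull_sin.
  move=> e; split.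
  + rewrite (_ : (fun _ => _) = fun x : K =>
      2^-1 * (sin (inner x (e + a)) + (- 1) * sin (inner x (e - a)))).
      by apply: trig_hullZ; apply: trig_hullD; [|apply: trig_hullZ]; exact: trig_hull_sin.
    by apply/funext => x; rewrite innerBr innerDr sinD sinB; lra.
  + rewrite (_ : (fun _ => _) = fun x : K =>
      2^-1 * (cos (inner x (e - a)) + (- 1) * cos (inner x (e + a)))).
      by apply: trig_hullZ; apply: trig_hullD; [|apply: trig_hullZ]; exact: trig_hull_cos.
    by apply/funext => x; rewrite innerBr innerDr cosB cosD; lra.
Qed.

Lemma trig_hullX f n : trig_hull f -> trig_hull (fun x => f x ^+ n).
Proof.
move=> hf; elim: n => [|n ih].
  by under eq_fun do rewrite expr0; exact: trig_hull_cst.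
by under eq_fun do rewrite exprS; exact: trig_hullM.
Qed.

(* With v = (1 - f) / 2, the indicator of {f > 0} is the limit of (1 - v^n)^(2^n)
   on {f <> 0}. *)
Lemma trig_hull_pos f : trig_hull f -> (forall x, `|f x| <= 1) ->
  trig_hull (fun x => (0 < f x)%R%:R).
Proof.
move=> hf f1.
have f2 x : 0 <= f x ^+ 2 <= 1.
  by rewrite sqr_ge0/= -real_normK ?num_real// exprn_ile1.
(* Where f = 0 one has v = 1/2, and there the threshold sequence tends to 1/e instead of an
   indicator. That set is cut out by the factor 1 - lim (1 - f^2)^n. *)
have h0 : trig_hull (fun x => (f x != 0)%R%:R).
  rewrite (_ : (fun _ => _) = fun x => (- 1) * (f x == 0)%R%:R + 1); last first.
    by apply/funext => x; case: eqP => _ /=; lra.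
  apply: trig_hullD; last exact: trig_hull_cst.
  apply: trig_hullZ; apply: (trig_hull_monotone.2 (fun n x => (1 + (-1) * f x ^+ 2) ^+ n) _ 1).
  - move=> n; apply: trig_hullX; apply: trig_hullD; first exact: trig_hull_cst.
    by apply: trig_hullZ; exact: trig_hullX.
  - move=> n x; rewrite normrX exprn_ile1// ler_norml; have := f2 x.
    by set z := f x ^+ 2; clear; lra.
  - move=> x; case: eqP => [->|/eqP fx].
      rewrite expr0n/= mulr0 addr0; under eq_fun do rewrite expr1n; exact: cvg_cst.
    have := f2 x; have : 0 < f x ^+ 2 by rewrite exprn_even_gt0.
    move=> a b; apply: cvg_expr; rewrite ltr_norml; move: a b; set z := f x ^+ 2.
    by clear; lra.
pose v x := 2^-1 * (1 + (-1) * f x).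
have v01 x : 0 <= v x <= 1 by have := f1 x; rewrite ler_norml /v; move: (f x) => y; clear; lra.
have hv : trig_hull v.
  apply: trig_hullZ; apply: trig_hullD; first exact: trig_hull_cst.
  exact: trig_hullZ.
apply: (trig_hull_monotone.2
  (fun n x => (1 + (-1) * v x ^+ n) ^+ (2 ^ n) * (f x != 0)%R%:R) _ 1).
- move=> n; apply: trig_hullM h0; apply: trig_hullX.
  by apply: trig_hullD; [exact: trig_hull_cst|apply: trig_hullZ; exact: trig_hullX].
- move=> n x; have /andP[a b] := v01 x.
  have c1 : 0 <= v x ^+ n by rewrite exprn_ge0.
  have c2 : v x ^+ n <= 1 by rewrite exprn_ile1.
  rewrite normrM normrX mulr_ile1// ?exprn_ge0// ?exprn_ile1//.
    by rewrite ler_norml; move: c1 c2; set z := v x ^+ n; clear; lra.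
  by case: eqP; rewrite ?normr0 ?normr1.
- move=> x; case: eqP => [->|/eqP fx] /=.
    by rewrite ltxx; under eq_fun do rewrite mulr0; exact: cvg_cst.
  under eq_fun do rewrite mulr1 mulN1r.
  have -> : (0 < f x) = (v x < 2^-1) by apply/idP/idP; rewrite /v; move: (f x) => y; clear; lra.
  apply: cvg_threshold => //; apply: contra fx => /eqP; rewrite /v.
  by move: (f x) => y; clear => H; apply/eqP; lra.
Qed.

(* For large n, <x, a> - c has the sign of sin ((<x, a> - c) / n). *)
Lemma trig_hull_halfspace a c : trig_hull \1_[set x : K | c < inner x a].
Proof.
rewrite (_ : \1_ _ = fun x : K => (0 < inner x a - c)%R%:R :> R); last first.
  by apply/funext => x; rewrite indicE subr_gt0; congr (nat_of_bool _)%:R; apply/idP/idP; rewrite inE.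
pose f_ n (x : K) := sin (n.+1%:R^-1 * (inner x a - c)).
apply: (trig_hull_monotone.2 (fun n x => (0 < f_ n x)%R%:R) _ 1).
- move=> n; apply: trig_hull_pos; last by move=> x; exact: sin_max.
  rewrite (_ : f_ n = fun x => cos (n.+1%:R^-1 * c) * sin (inner x (n.+1%:R^-1 *: a)) +
    (- sin (n.+1%:R^-1 * c)) * cos (inner x (n.+1%:R^-1 *: a))).
    by apply: trig_hullD; apply: trig_hullZ; [exact: trig_hull_sin|exact: trig_hull_cos].
  by apply/funext => x; rewrite innerZr /f_ mulrBr sinB; ring.
- by move=> n x; case: ltP; rewrite ?normr0 ?normr1.
- move=> x; apply: cvg_near_cst; near=> n; rewrite /f_; set z := inner x a - c.
  have n1 : 0 < n.+1%:R^-1 :> R by rewrite invr_gt0.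
  have zn : `|n.+1%:R^-1 * z| <= 1.
    rewrite normrM gtr0_norm// ler_pdivrMl// mulr1.
    near: n; exists (Num.truncn `|z|) => //= m /= zm.
    by rewrite (le_trans (ltW (truncnS_gt _)))// ler_nat.
  have p1 : 1 < pi :> R by rewrite (lt_le_trans _ (pi_ge2 R))//; lra.
  congr (nat_of_bool _)%:R; have [z0|z0] := ltP 0 z.
    apply: sin_gt0_pi; rewrite mulr_gt0//=; move: zn; rewrite ler_norml => /andP[_ zn].
    exact: le_lt_trans zn p1.
  apply/negbTE; rewrite -leNgt -oppr_ge0 -sinN.
  apply: sin_ge0_pi; rewrite -mulrN mulr_ge0 ?oppr_ge0//= ?ltW//.
  rewrite mulrN; move: zn; rewrite -normrN ler_norml => /andP[_ zn].
  exact: le_lt_trans zn p1.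
Unshelve. all: by end_near. Qed.

(** The sets whose indicator lies in the hull form a sigma-algebra containing the half-spaces.
    Closure under products makes 1 - prod (1 - 1_(A i)) available for finite unions, and countable
    unions are limits of these. *)
Lemma trig_class (V : set (K -> R)) : separable K -> monotone_class V ->
  (forall a, V (fun x => cos (inner x a)) /\ V (fun x => sin (inner x a))) ->
  forall (f : K -> R) (M : R), measurable_fun setT (f : borel K -> R) ->
  (forall x, `|f x| <= M) -> V f.
Proof.
move=> sepK Vm Vt f M mf fM.
suff : trig_hull f by apply.
apply: (@monotone_class_measurable R _ (borel K) trig_hull) (mf) (fM); first exact: trig_hull_monotone.
apply: sigma_algebra_borel => //; last by move=> a c; exact: trig_hull_halfspace.
split=> /=.
- by rewrite indic0; exact: trig_hull_cst.
- move=> A hA; rewrite setTD indicC.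
  rewrite (_ : (fun _ => _) = fun x : K => (- 1) * \1_A x + 1).
    by apply: trig_hullD; [exact: trig_hullZ|exact: trig_hull_cst].
  apply/funext => x; rewrite indicE; case: (x \in A) => /=.
    by rewrite mulr1 addNr.
  by rewrite mulr0 add0r.
- move=> A hA; pose f_ n (x : K) : R := 1 - \prod_(i < n) (1 - \1_(A i) x).
  apply: (trig_hull_monotone.2 f_ _ 1).
  + move=> n; rewrite /f_ (_ : (fun _ => _) = fun x : K =>
      (- 1) * (\prod_(i < n) (1 + (- 1) * \1_(A i) x)) + 1); last first.
      apply/funext => x; rewrite mulN1r [RHS]addrC; congr (_ - _).
      by apply: eq_bigr => i _; rewrite mulN1r.
    apply: trig_hullD; last exact: trig_hull_cst.
    apply: trig_hullZ; elim: n => [|n ih].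
      by under eq_fun do rewrite big_ord0; exact: trig_hull_cst.
    under eq_fun do rewrite big_ord_recr/=; apply: trig_hullM => //.
    by apply: trig_hullD; [exact: trig_hull_cst|exact: trig_hullZ].
  + move=> n x; have : 0 <= \prod_(i < n) (1 - \1_(A i) x : R) <= 1.
      apply: (big_ind (fun p : R => 0 <= p <= 1)) => [|p q /andP[? ?] /andP[? ?]|i _].
      - by rewrite ler01 lexx.
      - by rewrite mulr_ge0//= mulr_ile1.
      - by rewrite indicE; case: (_ \in _); rewrite ?subrr ?subr0 lexx ler01.
    by rewrite /f_ ler_norml; set p := \prod_(i < n) _; clear; lra.
  + move=> x; apply: cvg_near_cst; rewrite indicE.
    have [|xA] := boolP (x \in _).
      rewrite inE => -[k _ Akx]; exists k.+1 => // n /= kn.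
      rewrite /f_ (bigD1 (Ordinal kn))//= indicE mem_set// subrr mul0r subr0//.
    apply: nearW => n; rewrite /f_ big1 ?subrr// => i _.
    rewrite indicE memNset ?subr0// => Aix; move/negP: xA; apply.
    by rewrite inE; exists i.
Qed.

End TrigClass.

(** * Bounded measurable functions on a probability space *)

Section BoundedMeasurable.
Context d (Omega : measurableType d) {R : realType}.
Implicit Types f g h : Omega -> R.

Definition bounded_measurable f :=
  measurable_fun setT f /\ exists M : R, forall w, `|f w| <= M.

Lemma bounded_measurable_cst (c : R) : bounded_measurable (fun=> c).
Proof. by split; [exact: measurable_cst|exists `|c|]. Qed.

Lemma bounded_measurableD f g : bounded_measurable f -> bounded_measurable g ->
  bounded_measurable (fun w => f w + g w).
Proof.
move=> [mf [M fM]] [mg [N gN]]; split; first exact: measurable_funD.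
by exists (M + N) => w; rewrite (le_trans (ler_normD _ _))// lerD.
Qed.

Lemma bounded_measurableM f g : bounded_measurable f -> bounded_measurable g ->
  bounded_measurable (fun w => f w * g w).
Proof.
move=> [mf [M fM]] [mg [N gN]]; split; first exact: measurable_funM.
by exists (M * N) => w; rewrite normrM ler_pM.
Qed.

Lemma bounded_measurableZ (c : R) f : bounded_measurable f ->
  bounded_measurable (fun w => c * f w).
Proof. by move=> bf; apply: bounded_measurableM => //; exact: bounded_measurable_cst. Qed.

Lemma bounded_measurableB f g : bounded_measurable f -> bounded_measurable g ->
  bounded_measurable (fun w => f w - g w).
Proof.
move=> bf bg; under eq_fun do rewrite -mulN1r.
by apply: bounded_measurableD => //; exact: bounded_measurableZ.
Qed.

Lemma bounded_measurable_indic A : measurable A ->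
  bounded_measurable (\1_A : Omega -> R).
Proof.
move=> mA; split; first exact: measurable_indic.
by exists 1 => w; rewrite indicE; case: (_ \in _); rewrite ?normr0 ?normr1.
Qed.

Lemma bounded_measurable_cos f : measurable_fun setT f ->
  bounded_measurable (fun w => cos (f w)).
Proof.
move=> mf; split; last by exists 1 => w; exact: cos_max.
apply: (measurableT_comp _ mf); apply: continuous_measurable_fun.
exact: continuous_cos.
Qed.

Lemma bounded_measurable_sin f : measurable_fun setT f ->
  bounded_measurable (fun w => sin (f w)).
Proof.
move=> mf; split; last by exists 1 => w; exact: sin_max.
apply: (measurableT_comp _ mf); apply: continuous_measurable_fun.
exact: continuous_sin.
Qed.

Lemma bounded_measurable_lim (f_ : nat -> Omega -> R) f (M : R) :
  (forall n, measurable_fun setT (f_ n)) -> (forall n w, `|f_ n w| <= M) ->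
  (forall w, f_ n w @[n --> \oo] --> f w) -> bounded_measurable f.
Proof.
move=> mf fM cf; split; first exact: (measurable_fun_cvg mf).
exists M => w; rewrite -(cvg_lim (@Rhausdorff R) (cvg_norm (cf w))).
apply: limr_le; first by apply/cvg_ex; eexists; exact: cvg_norm (cf w).
exact: nearW.
Qed.

Context (P : probability Omega R).

Lemma bounded_measurable_integrable f (D : set Omega) : measurable D ->
  bounded_measurable f -> P.-integrable D (EFin \o f).
Proof.
move=> mD [mf [M fM]]; apply: (bounded_integrable (M := M)) => //.
  by rewrite (le_lt_trans (probability_le1 P mD))// ltry.
exact: measurable_funTS.
Qed.

Lemma Rintegral_bounded_lim (D : set Omega) (f_ : nat -> Omega -> R) f (M : R) :
  measurable D ->
  (forall n, measurable_fun setT (f_ n)) -> (forall n w, `|f_ n w| <= M) ->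
  (forall w, f_ n w @[n --> \oo] --> f w) ->
  \int[P]_(w in D) f_ n w @[n --> \oo] --> \int[P]_(w in D) f w.
Proof.
move=> mD mf fM cf.
have [] := @Rintegral_dominated _ _ _ P D f_ f (fun=> M) mD.
- by move=> n; exact: measurable_funTS.
- by move=> w _; exact: cf.
- by apply: bounded_measurable_integrable => //; exact: bounded_measurable_cst.
- by [].
- by [].
Qed.

Lemma Rintegral_indicM (A : set Omega) f : measurable A ->
  \int[P]_w (\1_A w * f w) = \int[P]_(w in A) f w.
Proof.
move=> mA; rewrite [RHS]Rintegral_mkcond; apply: eq_Rintegral => w _.
by rewrite /patch indicE; case: ifPn; rewrite (mul1r, mul0r).
Qed.

(** Events are tested by multiplication, so an intersection of events corresponds to a composition
    of two stable operations. This yields a full sigma-algebra, with no pi-system argument. *)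
Lemma monotone_class_stable_events (S : set (Omega -> R)) :
  monotone_class S -> (forall g, S g -> exists M : R, forall w, `|g w| <= M) ->
  sigma_algebra setT [set A | forall g, S g -> S (fun w => \1_A w * g w)].
Proof.
move=> [Sl Sc] Sb.
have SC A : (forall g, S g -> S (fun w => \1_A w * g w)) ->
    forall g, S g -> S (fun w => \1_(~` A) w * g w).
  move=> SA g Sg; rewrite (_ : (fun _ => _) = fun w => -1 * (\1_A w * g w) + g w).
    by apply: Sl => //; exact: SA.
  by apply/funext => w; rewrite indicC indicE; case: (_ \in _) => /=; ring.
split=> /=.
- move=> g Sg; rewrite (_ : (fun _ => _) = fun w => -1 * g w + g w); first exact: Sl.
  by apply/funext => w; rewrite indic0 mulN1r mul0r addNr.
- by move=> A SA g Sg; rewrite setTD; exact: SC.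
- move=> A SA; rewrite -[\bigcup_k A k]setCK; apply: (SC) => g Sg.
  have [M gM] := Sb _ Sg.
  (* A countable union is treated through its complement, whose indicator is the limit of finite
     products of complementary indicators. *)
  pose p n (w : Omega) : R := \prod_(i < n) \1_(~` A i) w.
  have p01 n w : 0 <= p n w <= 1.
    apply: (big_ind (fun p : R => 0 <= p <= 1)) => [|u v /andP[? ?] /andP[? ?]|i _].
    - by rewrite ler01 lexx.
    - by rewrite mulr_ge0//= mulr_ile1.
    - by rewrite indicE; case: (_ \in _); rewrite lexx ler01.
  apply: (Sc (fun n w => p n w * g w) _ M).
  + move=> n; rewrite /p; elim: n g Sg {gM p p01} => [|n ih] g Sg.
      by under eq_fun do rewrite big_ord0 mul1r.
    rewrite (_ : (fun _ => _) = fun w => \prod_(i < n) \1_(~` A i) w * (\1_(~` A n) w * g w)).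
      by apply: ih; apply: (SC) Sg; exact: SA.
    by apply/funext => w; rewrite big_ord_recr/= mulrA.
  + move=> n w; have /andP[a b] := p01 n w.
    by rewrite normrM ger0_norm// -[leRHS]mul1r ler_pM.
  + move=> w; apply: cvgMl; apply: cvg_near_cst; rewrite setC_bigcup indicE.
    have [wA|wA] := boolP (w \in _).
      apply: nearW => n; rewrite /p big1// => i _.
      by rewrite indicE mem_set//; move: wA; rewrite inE => /(_ i Logic.I).
    have [k Akw] : exists k, A k w.
      apply: contrapT => H; move/negP: wA; apply; rewrite inE => i _ Aiw.
      by apply: H; exists i.
    exists k.+1 => // n /= kn; rewrite /p (bigD1 (Ordinal kn))//= indicE memNset ?mul0r//.
Qed.

End BoundedMeasurable.

(** * Complex expectations *)

Section ComplexExpectation.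
Context {R : realType}.

Definition cis (x : R) : R[i] := cexp (0 +i* x).

Lemma cisE x : cis x = cos x +i* sin x.
Proof. by rewrite /cis /cexp/= expR0 mul1r. Qed.

Lemma cexpD (z w : R[i]) : cexp (z + w) = cexp z * cexp w.
Proof.
case: z => a b; case: w => c e; rewrite /cexp /= expRD cosD sinD.
by apply/eqP; rewrite eq_complex /=; apply/andP; split; apply/eqP; ring.
Qed.

Lemma cexp0 : cexp (0 : R[i]) = 1.
Proof.
by rewrite /cexp/= expR0 cos0 sin0; apply/eqP; rewrite eq_complex/= !mulr0 !mul0r !mulr1 subr0 addr0 !eqxx.
Qed.

Lemma cisD x y : cis (x + y) = cis x * cis y.
Proof. by rewrite /cis -cexpD; congr cexp; apply/eqP; rewrite eq_complex/= addr0 !eqxx. Qed.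

Lemma cis0 : cis 0 = 1.
Proof. exact: cexp0. Qed.

Lemma cis_sum I (r : seq I) (F : I -> R) :
  cis (\sum_(i <- r) F i) = \prod_(i <- r) cis (F i).
Proof. by apply: (big_morph cis); [exact: cisD|exact: cis0]. Qed.

(** Componentwise, to match [cintegral], which integrates real and imaginary parts separately. *)
Definition ccvg (z_ : nat -> R[i]) (z : R[i]) : Prop :=
  (complex.Re (z_ n) @[n --> \oo] --> complex.Re z) /\
  (complex.Im (z_ n) @[n --> \oo] --> complex.Im z).

Lemma ccvg_cst z : ccvg (fun=> z) z.
Proof. by split; exact: cvg_cst. Qed.

Lemma ccvgD z_ w_ z w : ccvg z_ z -> ccvg w_ w -> ccvg (fun n => z_ n + w_ n) (z + w).
Proof.
move: z w => [a b] [c e] [z1 z2] [w1 w2]; split => /=.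
  rewrite (_ : (fun _ => _) = fun n => complex.Re (z_ n) + complex.Re (w_ n)); first exact: cvgD.
  by apply/funext => n; case: (z_ n) (w_ n) => ? ? [? ?].
rewrite (_ : (fun _ => _) = fun n => complex.Im (z_ n) + complex.Im (w_ n)); first exact: cvgD.
by apply/funext => n; case: (z_ n) (w_ n) => ? ? [? ?].
Qed.

Lemma ccvgM z_ w_ z w : ccvg z_ z -> ccvg w_ w -> ccvg (fun n => z_ n * w_ n) (z * w).
Proof.
move: z w => [a b] [c e] [z1 z2] [w1 w2]; split => /=.
  rewrite (_ : (fun _ => _) = fun n => complex.Re (z_ n) * complex.Re (w_ n) -
    complex.Im (z_ n) * complex.Im (w_ n)); first by apply: cvgB; exact: cvgM.
  by apply/funext => n; case: (z_ n) (w_ n) => ? ? [? ?].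
rewrite (_ : (fun _ => _) = fun n => complex.Re (z_ n) * complex.Im (w_ n) +
    complex.Im (z_ n) * complex.Re (w_ n)); first by apply: cvgD; exact: cvgM.
by apply/funext => n; case: (z_ n) (w_ n) => ? ? [? ?].
Qed.

Lemma ccvg_unique z_ z w : ccvg z_ z -> ccvg z_ w -> z = w.
Proof.
case: z w => [a b] [c e] [/= z1 z2] [/= w1 w2]; congr (_ +i* _).
  exact: (cvg_unique (@Rhausdorff R) z1 w1).
exact: (cvg_unique (@Rhausdorff R) z2 w2).
Qed.

Lemma ccvg_cexp z_ z : ccvg z_ z -> ccvg (fun n => cexp (z_ n)) (cexp z).
Proof.
move: z => [a b] [/= z1 z2]; rewrite /cexp; apply: ccvgM; split => /=.
- exact: (continuous_cvg _ (@continuous_expR R a) z1).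
- exact: cvg_cst.
- exact: (continuous_cvg _ (@continuous_cos R b) z2).
- exact: (continuous_cvg _ (@continuous_sin R b) z2).
Qed.

Lemma ccvg_cis x_ x : x_ n @[n --> \oo] --> x -> ccvg (fun n => cis (x_ n)) (cis x).
Proof. by move=> xx; apply: ccvg_cexp; split => //=; exact: cvg_cst. Qed.

Context d (Omega : measurableType d) (P : probability Omega R).
Implicit Types F G : Omega -> R[i].

Definition cbounded_measurable F :=
  bounded_measurable (fun w => complex.Re (F w)) /\
  bounded_measurable (fun w => complex.Im (F w)).

Lemma cbounded_measurable_cst c : cbounded_measurable (fun=> c).
Proof. by split; exact: bounded_measurable_cst. Qed.

Lemma cbounded_measurable_real (f : Omega -> R) : bounded_measurable f ->
  cbounded_measurable (fun w => (f w)%:C).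
Proof. by move=> bf; split=> //=; exact: bounded_measurable_cst. Qed.

Lemma cbounded_measurableD F G : cbounded_measurable F -> cbounded_measurable G ->
  cbounded_measurable (fun w => F w + G w).
Proof.
move=> [F1 F2] [G1 G2]; split.
  rewrite (_ : (fun _ => _) = fun w => complex.Re (F w) + complex.Re (G w)).
    exact: bounded_measurableD.
  by apply/funext => w; case: (F w) (G w) => ? ? [? ?].
rewrite (_ : (fun _ => _) = fun w => complex.Im (F w) + complex.Im (G w)).
  exact: bounded_measurableD.
by apply/funext => w; case: (F w) (G w) => ? ? [? ?].
Qed.

Lemma cbounded_measurableM F G : cbounded_measurable F -> cbounded_measurable G ->
  cbounded_measurable (fun w => F w * G w).
Proof.
move=> [F1 F2] [G1 G2]; split.
  rewrite (_ : (fun _ => _) = fun w => complex.Re (F w) * complex.Re (G w) -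
    complex.Im (F w) * complex.Im (G w)).
    by apply: bounded_measurableB; exact: bounded_measurableM.
  by apply/funext => w; case: (F w) (G w) => ? ? [? ?].
rewrite (_ : (fun _ => _) = fun w => complex.Re (F w) * complex.Im (G w) +
    complex.Im (F w) * complex.Re (G w)).
  by apply: bounded_measurableD; exact: bounded_measurableM.
by apply/funext => w; case: (F w) (G w) => ? ? [? ?].
Qed.

Lemma cbounded_measurable_cis (f : Omega -> R) : measurable_fun setT f ->
  cbounded_measurable (fun w => cis (f w)).
Proof.
move=> mf; under eq_fun do rewrite cisE.
by split; [exact: bounded_measurable_cos|exact: bounded_measurable_sin].
Qed.

Lemma cbounded_measurable_prod (I : Type) (r : seq I) (Q : pred I)
    (F : I -> Omega -> R[i]) :
  (forall i, cbounded_measurable (F i)) ->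
  cbounded_measurable (fun w => \prod_(i <- r | Q i) F i w).
Proof.
move=> bF; elim: r => [|i r ih].
  by under eq_fun do rewrite big_nil; exact: cbounded_measurable_cst.
case Qi : (Q i); under eq_fun do rewrite big_cons Qi; last exact: ih.
exact: cbounded_measurableM.
Qed.

Lemma eq_cintegral F G : (forall w, F w = G w) ->
  cintegral P setT F = cintegral P setT G.
Proof. by move=> FG; congr cintegral; apply/funext. Qed.

Lemma cintegralD F G : cbounded_measurable F -> cbounded_measurable G ->
  cintegral P setT (fun w => F w + G w) = cintegral P setT F + cintegral P setT G.
Proof.
move=> [F1 F2] [G1 G2]; rewrite /cintegral.
have E (f g : Omega -> R) : bounded_measurable f -> bounded_measurable g ->
    \int[P]_w f w + \int[P]_w g w = \int[P]_w (f w + g w).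
  by move=> bf bg; rewrite RintegralD//; exact: bounded_measurable_integrable.
apply/eqP; rewrite eq_complex/= !E//.
by apply/andP; split; apply/eqP; apply: eq_Rintegral => w _; case: (F w) (G w) => ? ? [? ?].
Qed.

Lemma cintegralZ c F : cbounded_measurable F ->
  cintegral P setT (fun w => c * F w) = c * cintegral P setT F.
Proof.
move=> [F1 F2]; rewrite /cintegral; case: c => a b.
have E (f g : Omega -> R) u v : bounded_measurable f -> bounded_measurable g ->
    u * \int[P]_w f w + v * \int[P]_w g w = \int[P]_w (u * f w + v * g w).
  move=> bf bg; rewrite RintegralD//; last 2 first.
  - by apply: bounded_measurable_integrable => //; exact: bounded_measurableZ.
  - by apply: bounded_measurable_integrable => //; exact: bounded_measurableZ.
  by rewrite !RintegralZl//; exact: bounded_measurable_integrable.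
apply/eqP; rewrite eq_complex/= -mulNr !E//.
apply/andP; split; apply/eqP; apply: eq_Rintegral => w _; case: (F w) => ? ? //=.
by rewrite mulNr.
Qed.

Lemma cintegral_lim (F_ : nat -> Omega -> R[i]) F (M : R) :
  (forall n, cbounded_measurable (F_ n)) ->
  (forall n w, `|complex.Re (F_ n w)| <= M /\ `|complex.Im (F_ n w)| <= M) ->
  (forall w, ccvg (F_ ^~ w) (F w)) ->
  ccvg (fun n => cintegral P setT (F_ n)) (cintegral P setT F).
Proof.
move=> mF FM cF; split => /=; apply: (Rintegral_bounded_lim (M := M)) => //.
- by move=> n; have [[]] := mF n.
- by move=> n w; have [] := FM n w.
- by move=> w; have [] := cF w.
- by move=> n; have [_ []] := mF n.
- by move=> n w; have [] := FM n w.
- by move=> w; have [] := cF w.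
Qed.

Lemma cintegral_cst c : cintegral P setT (fun=> c) = c.
Proof.
case: c => a b; rewrite /cintegral/= !Rintegral_cst//.
by rewrite /= probability_setT/= !mulr1.
Qed.

End ComplexExpectation.

(** * Events of a process tested by characters *)

Section TrigEvents.
Context {R : realType} (K : hilbertType R) (sepK : separable K).
Context d (Omega : measurableType d) (P : probability Omega R).

(** The exponent of a character of the finite-dimensional distributions. Times may repeat and come
    in any order, so that adding exponents is concatenation of lists. *)
Definition trig_comb (X : R -> Omega -> K) (l : seq (R * K)) (w : Omega) : R :=
  \sum_(p <- l) inner (X p.1 w) p.2.

Lemma measurable_inner_comp (U : Omega -> K) (a : K) :
  measurable_fun setT (U : Omega -> borel K) ->
  measurable_fun setT (fun w => inner (U w) a).
Proof. by move=> mU; apply: (measurableT_comp (@measurable_inner _ K a) mU). Qed.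

Lemma measurable_trig_comb (X : R -> Omega -> K) (I : set R) l :
  (forall i, I i -> measurable_fun setT (X i : Omega -> borel K)) ->
  {in l, forall p, I p.1} -> measurable_fun setT (trig_comb X l).
Proof.
move=> mX; rewrite /trig_comb; elim: l => [|p l ih] lI.
  by under eq_fun do rewrite big_nil; exact: measurable_cst.
under eq_fun do rewrite big_cons; apply: measurable_funD.
  by apply: measurable_inner_comp; apply: mX; apply: lI; rewrite mem_head.
by apply: ih => q ql; apply: lI; rewrite inE ql orbT.
Qed.

Lemma trig_comb_cat X l1 l2 w : trig_comb X (l1 ++ l2) w = trig_comb X l1 w + trig_comb X l2 w.
Proof. by rewrite /trig_comb big_cat. Qed.

Lemma trig_comb_opp X l w :
  trig_comb X [seq (p.1, - p.2) | p <- l] w = - trig_comb X l w.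
Proof. by rewrite /trig_comb big_map -sumrN; apply: eq_bigr => p _; rewrite innerNr. Qed.

Lemma Rintegral_lin (a b : R) (f g : Omega -> R) :
  bounded_measurable f -> bounded_measurable g ->
  \int[P]_w (a * f w + b * g w) = a * \int[P]_w f w + b * \int[P]_w g w.
Proof.
move=> bf bg; rewrite RintegralD// ?RintegralZl//;
  apply: bounded_measurable_integrable => //; exact: bounded_measurableZ.
Qed.

Section RealTrigEvents.
Variables (X : R -> Omega -> K) (I : set R).
Hypothesis mX : forall i, I i -> measurable_fun setT (X i : Omega -> borel K).

(** The orthogonal complement of the characters of [X] at times in [I]. It is shown to be stable
    under multiplication by functions of a single [X i]. *)
Let orth : set (Omega -> R) := [set g | bounded_measurable g /\
  forall l, {in l, forall p, I p.1} ->
    \int[P]_w (cos (trig_comb X l w) * g w) = 0 /\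
    \int[P]_w (sin (trig_comb X l w) * g w) = 0].

Let orth_monotone : monotone_class orth.
Proof.
split=> [c f g [bf of_] [bg og]|f_ f M Hf fM cf].
  split; first by apply: bounded_measurableD => //; exact: bounded_measurableZ.
  move=> l lI; have mL := measurable_trig_comb mX lI.
  have E (t : R -> R) : bounded_measurable (fun w => t (trig_comb X l w)) ->
      \int[P]_w (t (trig_comb X l w) * f w) = 0 ->
      \int[P]_w (t (trig_comb X l w) * g w) = 0 ->
      \int[P]_w (t (trig_comb X l w) * (c * f w + g w)) = 0.
    move=> bt t1 t2.
    transitivity (\int[P]_w (c * (t (trig_comb X l w) * f w) + 1 * (t (trig_comb X l w) * g w))).
      by apply: eq_Rintegral => w _; ring.
    by rewrite Rintegral_lin ?t1 ?t2 ?mulr0 ?addr0//; exact: bounded_measurableM.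
  have [f1 f2] := of_ _ lI; have [g1 g2] := og _ lI.
  by split; apply: E => //; [exact: bounded_measurable_cos|exact: bounded_measurable_sin].
have bf : bounded_measurable f.
  by apply: (bounded_measurable_lim (f_ := f_) (M := M)) => // n; have [[]] := Hf n.
split=> // l lI; have mL := measurable_trig_comb mX lI.
have E (t : R -> R) : measurable_fun setT (fun w => t (trig_comb X l w)) ->
    (forall x, `|t x| <= 1) ->
    (forall n, \int[P]_w (t (trig_comb X l w) * f_ n w) = 0) ->
    \int[P]_w (t (trig_comb X l w) * f w) = 0.
  move=> mt t1 tn.
  have H : \int[P]_w (t (trig_comb X l w) * f_ n w) @[n --> \oo] -->
           \int[P]_w (t (trig_comb X l w) * f w).
    apply: (Rintegral_bounded_lim (M := M)) => //.
    - by move=> n; apply: measurable_funM => //; have [[]] := Hf n.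
    - by move=> n w; rewrite normrM -[leRHS]mul1r ler_pM.
    - by move=> w; apply: cvgMr; exact: cf.
  move: H; rewrite (_ : (fun n => _) = fun=> 0); last by apply/funext.
  by move=> H; apply: (cvg_unique (@Rhausdorff R) H); exact: cvg_cst.
split; apply: E.
- by have [] := bounded_measurable_cos mL.
- by move=> x; exact: cos_max.
- by move=> n; have [_ /(_ _ lI)[]] := Hf n.
- by have [] := bounded_measurable_sin mL.
- by move=> x; exact: sin_max.
- by move=> n; have [_ /(_ _ lI)[]] := Hf n.
Qed.

(** A product of cos or sin of <X_i, a> with a character of [l] is, by the product formulas, a
    combination of characters of [(i, a) :: l] and [(i, - a) :: l], which are again tests.
    [trig_class] then passes to bounded Borel functions of [X i]. *)
Let orth_comp i (f : K -> R) (M : R) g : I i -> measurable_fun setT (f : borel K -> R) ->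
  (forall x, `|f x| <= M) -> orth g -> orth (fun w => f (X i w) * g w).
Proof.
move=> Ii mf fM og.
pose V : set (K -> R) := [set f | [/\ measurable_fun setT (f : borel K -> R),
  exists M : R, forall x, `|f x| <= M & orth (fun w => f (X i w) * g w)]].
suff : V f by case.
have bg : bounded_measurable g by case: og.
have [mg [N gN]] := bg.
apply: (trig_class sepK) mf fM.
- split=> [c f1 f2 [m1 [M1 b1] o1] [m2 [M2 b2] o2]|f_ f1 M1 Hf fM1 cf].
    split.
    + by apply: measurable_funD => //; apply: measurable_funM => //; exact: measurable_cst.
    + exists (`|c| * M1 + M2) => x; rewrite (le_trans (ler_normD _ _))// normrM.
      by rewrite lerD// ler_wpM2l.
    + rewrite (_ : (fun _ => _) = fun w => c * (f1 (X i w) * g w) + f2 (X i w) * g w).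
        exact: orth_monotone.1.
      by apply/funext => w; ring.
  have [m1 [M2 b2]] : bounded_measurable (f1 : borel K -> R).
    apply: (@bounded_measurable_lim _ (borel K) R f_ f1 M1) => // n.
    by have [] := Hf n.
  split; [exact: m1|by exists M2|].
  apply: (orth_monotone.2 (fun n w => f_ n (X i w) * g w) _ (M1 * N)).
  + by move=> n; have [] := Hf n.
  + by move=> n w; rewrite normrM ler_pM.
  + by move=> w; apply: cvgMl; exact: cf.
- move=> a; pose L w := inner (X i w) a.
  have mL : measurable_fun setT L by apply: measurable_inner_comp; exact: mX.
  have lI' (l : seq (R * K)) (b : K) : {in l, forall p, I p.1} -> {in (i, b) :: l, forall p, I p.1}.
    by move=> lI p; rewrite inE => /orP[/eqP->//|/lI].
  have Ep l w : trig_comb X ((i, a) :: l) w = L w + trig_comb X l w.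
    by rewrite /trig_comb big_cons.
  have Em l w : trig_comb X ((i, - a) :: l) w = - L w + trig_comb X l w.
    by rewrite /trig_comb big_cons/= innerNr.
  have [_ og'] := og.
  have bL (t : R -> R) (l : seq (R * K)) (b : K) : {in l, forall p, I p.1} ->
     (forall h, measurable_fun setT h -> bounded_measurable (fun w : Omega => t (h w))) ->
     bounded_measurable (fun w => t (trig_comb X ((i, b) :: l) w) * g w).
    move=> lI bt; apply: bounded_measurableM => //; apply: bt.
    exact/(measurable_trig_comb mX)/lI'.
  have bc := @bounded_measurable_cos _ Omega R.
  have bs := @bounded_measurable_sin _ Omega R.
  have og1 l b (lI : {in l, forall p, I p.1}) := og' _ (lI' l b lI).
  split; split.
  + apply: measurable_of_continuous => x.
    exact: continuous_comp (@continuous_innerl _ _ a x) (@continuous_cos R _).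
  + by exists 1 => x; exact: cos_max.
  + split; first by apply: bounded_measurableM => //; exact: bc.
    move=> l lI; have [p1 p2] := og1 l a lI; have [m1 m2] := og1 l (- a) lI.
    split.
    * transitivity (\int[P]_w (2^-1 * (cos (trig_comb X ((i, a) :: l) w) * g w) +
          2^-1 * (cos (trig_comb X ((i, - a) :: l) w) * g w))).
        apply: eq_Rintegral => w _; rewrite Ep Em !cosD cosN sinN /L.
        by field.
      by rewrite Rintegral_lin ?p1 ?m1 ?mulr0 ?addr0//; apply: bL.
    * transitivity (\int[P]_w (2^-1 * (sin (trig_comb X ((i, a) :: l) w) * g w) +
          2^-1 * (sin (trig_comb X ((i, - a) :: l) w) * g w))).
        apply: eq_Rintegral => w _; rewrite Ep Em !sinD cosN sinN /L.
        by field.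
      by rewrite Rintegral_lin ?p2 ?m2 ?mulr0 ?addr0//; apply: bL.
  + apply: measurable_of_continuous => x.
    exact: continuous_comp (@continuous_innerl _ _ a x) (@continuous_sin R _).
  + by exists 1 => x; exact: sin_max.
  + split; first by apply: bounded_measurableM => //; exact: bs.
    move=> l lI; have [p1 p2] := og1 l a lI; have [m1 m2] := og1 l (- a) lI.
    split.
    * transitivity (\int[P]_w (2^-1 * (sin (trig_comb X ((i, a) :: l) w) * g w) +
          (- 2^-1) * (sin (trig_comb X ((i, - a) :: l) w) * g w))).
        apply: eq_Rintegral => w _; rewrite Ep Em !sinD cosN sinN /L.
        by field.
      by rewrite Rintegral_lin ?p2 ?m2 ?mulr0 ?addr0//; apply: bL.
    * transitivity (\int[P]_w ((- 2^-1) * (cos (trig_comb X ((i, a) :: l) w) * g w) +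
          2^-1 * (cos (trig_comb X ((i, - a) :: l) w) * g w))).
        apply: eq_Rintegral => w _; rewrite Ep Em !cosD cosN sinN /L.
        by field.
      by rewrite Rintegral_lin ?p1 ?m1 ?mulr0 ?addr0//; apply: bL.
Qed.

(** This takes the place of the uniqueness theorem for characteristic functions of finite families.
    The events that preserve [orth] under multiplication form a sigma-algebra containing the
    generators; the empty list, whose cosine is 1, then evaluates the integral over A. *)
Lemma real_trig_events (g : Omega -> R) : bounded_measurable g ->
  (forall l, {in l, forall p, I p.1} ->
    \int[P]_w (cos (trig_comb X l w) * g w) = 0 /\
    \int[P]_w (sin (trig_comb X l w) * g w) = 0) ->
  forall A, <<s [set A | exists i (B : set (borel K)),
    [/\ I i, measurable B & A = X i @^-1` B] ]>> A ->
  \int[P]_(w in A) g w = 0.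
Proof.
move=> bg og A sA.
have mA : measurable A.
  apply: smallest_sub sA; first exact: sigma_algebra_measurable.
  by move=> _ [i [B [Ii mB ->]]]; rewrite -[_ @^-1` _]setTI; exact: mX.
have : orth (fun w => \1_A w * g w).
  suff : [set A | forall g, orth g -> orth (fun w => \1_A w * g w)] A by apply.
  apply: smallest_sub sA.
    by apply: (monotone_class_stable_events orth_monotone) => h [[]].
  move=> _ [i [B [Ii mB ->]]] h oh.
  apply: (@orth_comp i (\1_B : K -> R) 1) => //.
  by move=> x; rewrite indicE; case: (_ \in _); rewrite ?normr0 ?normr1.
move=> [_ /(_ [::])[//|+ _]].
under eq_Rintegral do rewrite /trig_comb big_nil cos0 mul1r.
by rewrite Rintegral_indicM.
Qed.

End RealTrigEvents.

(** The hypothesis for [l] and for its negative isolates cosine and sine, which are real; the real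
    and imaginary parts of [G] can then be separated. *)
Lemma trig_events (X : R -> Omega -> K) (I : set R) (G : Omega -> R[i]) :
  (forall i, I i -> measurable_fun setT (X i : Omega -> borel K)) ->
  cbounded_measurable G ->
  (forall l, {in l, forall p, I p.1} ->
     cintegral P setT (fun w => cis (trig_comb X l w) * G w) = 0) ->
  forall A, <<s [set A | exists i (B : set (borel K)),
    [/\ I i, measurable B & A = X i @^-1` B] ]>> A ->
  \int[P]_(w in A) complex.Re (G w) = 0 /\ \int[P]_(w in A) complex.Im (G w) = 0.
Proof.
move=> mX bG oG A sA.
have cc l : {in l, forall p, I p.1} ->
   cintegral P setT (fun w => (cos (trig_comb X l w))%:C * G w) = 0 /\
   cintegral P setT (fun w => (sin (trig_comb X l w))%:C * G w) = 0.
  move=> lI; have lI' : {in [seq (p.1, - p.2) | p <- l], forall p, I p.1}.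
    by move=> _ /mapP[p pl ->] /=; exact: lI.
  have mL := measurable_trig_comb mX lI.
  have H1 := oG _ lI; have := oG _ lI'.
  under eq_cintegral do rewrite trig_comb_opp.
  move=> H2.
  have b1 : cbounded_measurable (fun w => cis (trig_comb X l w) * G w).
    by apply: cbounded_measurableM => //; exact: cbounded_measurable_cis.
  have b2 : cbounded_measurable (fun w => cis (- trig_comb X l w) * G w).
    by apply: cbounded_measurableM => //; apply: cbounded_measurable_cis; exact: measurable_funN.
  have bZ (c : R[i]) F : cbounded_measurable F -> cbounded_measurable (fun w : Omega => c * F w).
    by move=> bF; apply: cbounded_measurableM => //; exact: cbounded_measurable_cst.
  split.
    transitivity (cintegral P setT (fun w => (2^-1)%:C * (cis (trig_comb X l w) * G w) +
      (2^-1)%:C * (cis (- trig_comb X l w) * G w))).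
      apply: eq_cintegral => w; rewrite !cisE cosN sinN; case: (G w) => a b.
      by apply/eqP; rewrite eq_complex/=; apply/andP; split; apply/eqP; field.
    by rewrite cintegralD ?cintegralZ ?H1 ?H2 ?mulr0 ?addr0//; exact: bZ.
  transitivity (cintegral P setT (fun w => (0 +i* (- 2^-1)) * (cis (trig_comb X l w) * G w) +
      (0 +i* 2^-1) * (cis (- trig_comb X l w) * G w))).
    apply: eq_cintegral => w; rewrite !cisE cosN sinN; case: (G w) => a b.
    by apply/eqP; rewrite eq_complex/=; apply/andP; split; apply/eqP; field.
  by rewrite cintegralD ?cintegralZ ?H1 ?H2 ?mulr0 ?addr0//; exact: bZ.
have [b1 b2] := bG.
have reim (u : R) z : complex.Re (u%:C * z) = u * complex.Re z /\
                      complex.Im (u%:C * z) = u * complex.Im z.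
  by case: z => x y /=; rewrite !mul0r subr0 addr0.
split; apply: (real_trig_events (X := X) (I := I)) => // l lI;
  have [[h1 h2] [h3 h4]] := cc _ lI.
- split; [rewrite -h1|rewrite -h3]; apply: eq_Rintegral => w _; first by rewrite (reim _ _).1.
  by rewrite (reim _ _).1.
- split; [rewrite -h2|rewrite -h4]; apply: eq_Rintegral => w _; first by rewrite (reim _ _).2.
  by rewrite (reim _ _).2.
Qed.

End TrigEvents.

(** * Products of independent variables *)

Section Independence.
Context {R : realType} d (Omega : measurableType d) (P : probability Omega R).

Lemma cintegral_indic (A : set Omega) : measurable A ->
  cintegral P setT (fun w => (\1_A w)%:C) = (fine (P A))%:C.
Proof.
move=> mA; rewrite /cintegral/= Rintegral_cst// mul0r; congr (_ +i* _).
by rewrite /Rintegral integral_indic// setIT.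
Qed.

Context d' (T : measurableType d').

Lemma cbounded_measurable_comp (U : Omega -> T) (phi : T -> R[i]) :
  measurable_fun setT U -> cbounded_measurable phi ->
  cbounded_measurable (fun w => phi (U w)).
Proof.
move=> mU [[m1 [M1 b1]] [m2 [M2 b2]]]; split; split.
- exact: (measurableT_comp m1 mU).
- by exists M1 => w; exact: b1.
- exact: (measurableT_comp m2 mU).
- by exists M2 => w; exact: b2.
Qed.

(** One factor is generalised from indicators to bounded functions while the others stay frozen in
    [W] and in the constant [c]. *)
Lemma cintegral_factor (W : Omega -> R[i]) (U : Omega -> T) (c : R[i]) :
  cbounded_measurable W -> measurable_fun setT U ->
  (forall B, measurable B ->
     cintegral P setT (fun w => W w * (\1_B (U w))%:C) =
     c * cintegral P setT (fun w => (\1_B (U w))%:C)) ->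
  forall phi : T -> R[i], cbounded_measurable phi ->
    cintegral P setT (fun w => W w * phi (U w)) =
    c * cintegral P setT (fun w => phi (U w)).
Proof.
move=> bW mU H phi [b1 b2].
pose V : set (T -> R) := [set f | bounded_measurable f /\
  cintegral P setT (fun w => W w * (f (U w))%:C) =
  c * cintegral P setT (fun w => (f (U w))%:C)].
have bU (f : T -> R) : bounded_measurable f -> cbounded_measurable (fun w => (f (U w))%:C).
  by move=> bf; apply: (cbounded_measurable_comp (phi := fun x => (f x)%:C)) => //; exact: cbounded_measurable_real.
have bWU (f : T -> R) : bounded_measurable f -> cbounded_measurable (fun w => W w * (f (U w))%:C).
  by move=> bf; apply: cbounded_measurableM => //; exact: bU.
have bZ (e : R[i]) (F : Omega -> R[i]) : cbounded_measurable F -> cbounded_measurable (fun w => e * F w).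
  by move=> bF; apply: cbounded_measurableM => //; exact: cbounded_measurable_cst.
have Vm : monotone_class V.
  split=> [e f g [bf Hf] [bg Hg]|f_ f M Hf fM cf].
    split; first by apply: bounded_measurableD => //; exact: bounded_measurableZ.
    have c1 := bU _ bf; have c2 := bU _ bg; have c3 := bWU _ bf; have c4 := bWU _ bg.
    have c5 := bZ e%:C _ c1; have c6 := bZ e%:C _ c3.
    transitivity (cintegral P setT (fun w => e%:C * (W w * (f (U w))%:C) + W w * (g (U w))%:C)).
      by apply: eq_cintegral => w; rewrite rmorphD rmorphM/=; ring.
    rewrite cintegralD ?cintegralZ// Hf Hg.
    transitivity (c * cintegral P setT (fun w => e%:C * (f (U w))%:C + (g (U w))%:C)).
      by rewrite cintegralD ?cintegralZ//; ring.
    by congr (c * _); apply: eq_cintegral => w; rewrite rmorphD rmorphM.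
  have bf : bounded_measurable f.
    by apply: (bounded_measurable_lim (f_ := f_) (M := M)) => // n; have [[]] := Hf n.
  split=> //.
  have cC (w : Omega) : ccvg (fun n => (f_ n (U w))%:C) (f (U w))%:C.
    by split=> /=; [exact: cf|exact: cvg_cst].
  have bn n := (Hf n).1.
  have [[_ [M1 W1]] [_ [M2 W2]]] := bW.
  have E1 : ccvg (fun n => cintegral P setT (fun w => W w * (f_ n (U w))%:C))
                 (cintegral P setT (fun w => W w * (f (U w))%:C)).
    apply: (@cintegral_lim _ _ _ P _ _ ((M1 + M2) * M)).
    - by move=> n; exact: bWU.
    - move=> n w; have M10 := le_trans (normr_ge0 _) (W1 w); have M20 := le_trans (normr_ge0 _) (W2 w).
      have [/= r1 r2] : complex.Re (W w * (f_ n (U w))%:C) = complex.Re (W w) * f_ n (U w) /\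
         complex.Im (W w * (f_ n (U w))%:C) = complex.Im (W w) * f_ n (U w).
        by case: (W w) => x y /=; rewrite !mulr0 subr0 add0r.
      by rewrite r1 r2 !normrM; split; apply: ler_pM => //;
        [apply: le_trans (W1 w) _|apply: le_trans (W2 w) _]; rewrite ?lerDl ?lerDr.
    - by move=> w; apply: ccvgM; [exact: ccvg_cst|exact: cC].
  have E2 : ccvg (fun n => cintegral P setT (fun w => (f_ n (U w))%:C))
                 (cintegral P setT (fun w => (f (U w))%:C)).
    apply: (@cintegral_lim _ _ _ P _ _ M) => //.
    - by move=> n; exact: bU.
    - by move=> n w /=; rewrite normr0; split => //; exact: le_trans (fM n (U w)).
  apply: ccvg_unique E1 _; rewrite (_ : (fun n => _) =
    fun n => c * cintegral P setT (fun w => (f_ n (U w))%:C)); last first.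
    by apply/funext => n; rewrite (Hf n).2.
  by apply: ccvgM => //; exact: ccvg_cst.
have V1 B : measurable B -> V \1_B.
  by move=> mB; split; [exact: bounded_measurable_indic|exact: H].
have Vall f : bounded_measurable f -> V f.
  by move=> [mf [M fM]]; exact: (monotone_class_measurable Vm V1) mf fM.
have [_ v1] := Vall _ b1; have [_ v2] := Vall _ b2.
have phiE x : phi x = (complex.Re (phi x))%:C + (0 +i* 1) * (complex.Im (phi x))%:C.
  by case: (phi x) => x1 x2; apply/eqP; rewrite eq_complex/=; apply/andP; split; apply/eqP; ring.
transitivity (cintegral P setT (fun w => W w * (complex.Re (phi (U w)))%:C +
  (0 +i* 1) * (W w * (complex.Im (phi (U w)))%:C))).
  by apply: eq_cintegral => w; rewrite {1}phiE; ring.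
transitivity (c * cintegral P setT (fun w => (complex.Re (phi (U w)))%:C +
  (0 +i* 1) * (complex.Im (phi (U w)))%:C)); last first.
  by congr (c * _); apply: eq_cintegral => w; rewrite -phiE.
have c1 := bU _ b1; have c2 := bU _ b2; have c3 := bWU _ b1; have c4 := bWU _ b2.
have c5 := bZ (0 +i* 1) _ c2; have c6 := bZ (0 +i* 1) _ c4.
rewrite !cintegralD// !cintegralZ//.
by rewrite v1 v2; ring.
Qed.

Lemma independent_prod (n : nat) (U : nat -> Omega -> T) :
  (forall i, measurable_fun setT (U i)) ->
  (forall B : nat -> set T, (forall i, measurable (B i)) ->
    P (\bigcap_(i < n) [set w | B i (U i w)]) =
    (\prod_(i < n) P [set w | B i (U i w)])%E) ->
  forall phi : nat -> T -> R[i], (forall i, cbounded_measurable (phi i)) ->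
  cintegral P setT (fun w => \prod_(i < n) phi i (U i w)) =
  \prod_(i < n) cintegral P setT (fun w => phi i (U i w)).
Proof.
move=> mU indep.
have mUB i B : measurable B -> measurable (U i @^-1` B).
  by move=> mB; rewrite -[_ @^-1` _]setTI; exact: mU.
pose ind (phi : T -> R[i]) := exists2 B, measurable B & phi = fun x => (\1_B x)%:C.
(* Factors with index below k are arbitrary, those from k on are indicators. For k = 0 this is
   independence of events, and each induction step frees factor k. *)
suff H k : (k <= n)%N -> forall phi : nat -> T -> R[i],
    (forall i, cbounded_measurable (phi i)) ->
    (forall i, (k <= i < n)%N -> ind (phi i)) ->
  cintegral P setT (fun w => \prod_(i < n) phi i (U i w)) =
  \prod_(i < n) cintegral P setT (fun w => phi i (U i w)).
  move=> phi bphi; apply: (H n) => // i.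
  by rewrite ltnNge; case: (n <= i)%N.
elim: k => [_ phi bphi iphi|k ih kn phi bphi iphi].
  (* Independence is stated for infinite sequences of sets, so indices from n on receive the whole
     space. *)
  have /choice[B HB] : forall i, exists B, measurable B /\
      ((i < n)%N -> phi i = fun x => (\1_B x)%:C).
    move=> i; have [ni|ni] := ltnP i n; last by exists setT.
    by have [//|B mB ->] := iphi i; exists B.
  transitivity (cintegral P setT (fun w => (\1_(\bigcap_(i < n) [set w | B i (U i w)]) w : R)%:C)).
    apply: eq_cintegral => w; rewrite (eq_bigr (fun i : 'I_n => (\1_(B i) (U i w))%:C)); last first.
      by move=> i _; rewrite (HB i).2.
    rewrite -rmorph_prod/= indicE; congr (_%:C).
    have [|wB] := boolP (w \in _).
      rewrite inE => wB; rewrite big1// => i _; rewrite indicE mem_set//.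
      exact: (wB i (ltn_ord i)).
    have [i Hi] : exists i : 'I_n, ~ B i (U i w).
      apply: contrapT => HH; move/negP: wB; apply; rewrite inE => i /= ni.
      by apply: contrapT => nB; apply: HH; exists (Ordinal ni).
    by rewrite (bigD1 i)//= indicE memNset// mul0r.
  have mBU i : measurable [set w | B i (U i w)] by apply: mUB; exact: (HB i).1.
  rewrite cintegral_indic; last by apply: fin_bigcap_measurable => // i _; exact: mBU.
  rewrite indep; last by move=> i; exact: (HB i).1.
  transitivity (\prod_(i < n) (fine (P [set w | B i (U i w)]))%:C : R[i]).
    rewrite -rmorph_prod/=; congr (_%:C).
    rewrite (eq_bigr (fun i : 'I_n => (fine (P [set w | B i (U i w)]))%:E)).
      by rewrite prodEFin.
    by move=> i _; rewrite fineK// fin_num_measure.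
  apply: eq_bigr => i _; rewrite -cintegral_indic//.
  by apply: eq_cintegral => w; rewrite (HB i).2.
pose W w := \prod_(i < n | i != Ordinal kn) phi i (U i w).
pose c := \prod_(i < n | i != Ordinal kn) cintegral P setT (fun w => phi i (U i w)).
have E w : \prod_(i < n) phi i (U i w) = W w * phi k (U k w).
  by rewrite (bigD1 (Ordinal kn))//= mulrC.
under eq_cintegral do rewrite E.
rewrite (bigD1 (Ordinal kn))//= mulrC -/c; apply: cintegral_factor => //.
  by apply: cbounded_measurable_prod => i; exact: cbounded_measurable_comp.
move=> B mB.
pose phi' i := if i == k then fun x => (\1_B x)%:C else phi i.
have phi'E (i : 'I_n) : i != Ordinal kn -> phi' i = phi i.
  by rewrite -val_eqE /= => ik; rewrite /phi' (negPf ik).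
have phi'k : phi' k = fun x => (\1_B x)%:C by rewrite /phi' eqxx.
have b' i : cbounded_measurable (phi' i).
  rewrite /phi'; case: ifP => // _.
  by apply: cbounded_measurable_real; exact: bounded_measurable_indic.
have i' i : (k <= i < n)%N -> ind (phi' i).
  move=> /andP[ki ni]; rewrite /phi'; case: eqP => [_|/eqP ik]; first by exists B.
  by apply: iphi; rewrite ni ltn_neqAle eq_sym ik ki.
have := ih (ltnW kn) phi' b' i'; rewrite [RHS](bigD1 (Ordinal kn))//= phi'k mulrC.
rewrite (eq_bigr (fun i : 'I_n => cintegral P setT (fun w => phi i (U i w)))); last first.
  by move=> i /phi'E ->.
rewrite -/c => <-; apply: eq_cintegral => w.
rewrite (bigD1 (Ordinal kn))//= phi'k mulrC; congr (_ * _).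
by apply: eq_bigr => i /phi'E ->.
Qed.

End Independence.

(** * Bochner integrals *)

Section RealIntegrable.
Context d (T : measurableType d) {R : realType} (mu : {measure set T -> \bar R}).
Variables (D : set T) (mD : measurable D).
Implicit Types f g : T -> R.

Lemma integrable_realZ (c : R) f : mu.-integrable D (EFin \o f) ->
  mu.-integrable D (EFin \o (fun x => c * f x)).
Proof.
by move=> /(integrableZl mD c); apply: eq_integrable.
Qed.

Lemma integrable_realD f g : mu.-integrable D (EFin \o f) ->
  mu.-integrable D (EFin \o g) ->
  mu.-integrable D (EFin \o (fun x => f x + g x)).
Proof. by move=> fi gi; have := integrableD mD fi gi; apply: eq_integrable. Qed.

Lemma integrable_realB f g : mu.-integrable D (EFin \o f) ->
  mu.-integrable D (EFin \o g) ->
  mu.-integrable D (EFin \o (fun x => f x - g x)).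
Proof. by move=> fi gi; have := integrableB mD fi gi; apply: eq_integrable. Qed.

Lemma integrable_real0 : mu.-integrable D (EFin \o (fun=> 0 : R)).
Proof. by have := integrable0 mu D; apply: eq_integrable. Qed.

Lemma integrable_real_le f g : measurable_fun D f ->
  (forall x, D x -> `|f x| <= g x) -> mu.-integrable D (EFin \o g) ->
  mu.-integrable D (EFin \o f).
Proof.
move=> mf fg; apply: le_integrable => //; first exact/measurable_EFinP.
by move=> x Dx /=; rewrite lee_fin (le_trans (fg _ Dx))// ler_norm.
Qed.

Lemma integrable_real_lty f : measurable_fun D f -> (forall x, D x -> 0 <= f x) ->
  (\int[mu]_(x in D) (f x)%:E < +oo)%E -> mu.-integrable D (EFin \o f).
Proof.
move=> mf f0 fin; apply/integrableP; split; first exact/measurable_EFinP.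
rewrite (_ : (\int[mu]_(x in D) _)%E = \int[mu]_(x in D) (f x)%:E)%E//.
by apply: eq_integral => x /set_mem Dx /=; rewrite ger0_norm// f0.
Qed.

Lemma Rintegral_sum (I : Type) (r : seq I) (F : I -> T -> R) :
  (forall i, mu.-integrable D (EFin \o F i)) ->
  \int[mu]_(x in D) \sum_(i <- r) F i x = \sum_(i <- r) \int[mu]_(x in D) F i x.
Proof.
move=> iF; suff [] : mu.-integrable D (EFin \o (fun x => \sum_(i <- r) F i x)) /\
  \int[mu]_(x in D) \sum_(i <- r) F i x = \sum_(i <- r) \int[mu]_(x in D) F i x by [].
elim: r => [|i r [ih1 ih2]].
  rewrite big_nil; under eq_Rintegral do rewrite big_nil.
  rewrite Rintegral_cst// mul0r; split=> //.
  by have := integrable_real0; apply: eq_integrable => // x _ /=; rewrite big_nil.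
split.
  have := integrable_realD (iF i) ih1; apply: eq_integrable => // x _ /=.
  by rewrite big_cons.
by under eq_Rintegral do rewrite big_cons; rewrite RintegralD// big_cons ih2.
Qed.

End RealIntegrable.

Section Bochner.
Context {R : realType} (K : hilbertType R) (sepK : separable K).
Context d (T : measurableType d) (mu : {measure set T -> \bar R}).
Variables (D : set T) (mD : measurable D).
Implicit Types (s : seq (set T * K)) (a : K) (f : T -> K) (h : T -> R).

Lemma simple_on_cons p s : simple_on mu D (p :: s) ->
  [/\ measurable p.1, p.1 `<=` D & (mu p.1 < +oo)%E] /\ simple_on mu D s.
Proof. by move=> sD; split; [exact: (sD 0%N)|move=> i si; exact: (sD i.+1)]. Qed.

Lemma simple_fun_cons p s x :
  simple_fun (p :: s) x = \1_(p.1) x *: p.2 + simple_fun s x.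
Proof. by rewrite /simple_fun big_cons. Qed.

Lemma simple_weak s a : simple_on mu D s ->
  mu.-integrable D (fun x => (inner (simple_fun s x) a)%:E) /\
  inner (simple_integral mu s) a = \int[mu]_(x in D) inner (simple_fun s x) a.
Proof.
elim: s => [_|p s ih /simple_on_cons[[mp pD fp] /ih[is_ Es]]].
  split.
    apply: (eq_integrable mD _ _ _ (integrable_real0 mu mD)) => x _ /=.
    by rewrite /simple_fun big_nil inner0l.
  rewrite /simple_integral big_nil inner0l.
  under eq_Rintegral do rewrite /simple_fun big_nil inner0l.
  by rewrite Rintegral_cst// mul0r.
have ip' : mu.-integrable D (EFin \o (\1_(p.1) : T -> R)).
  apply: integrable_real_lty => //.
  by rewrite integral_indic// setIidl.
have ip := integrable_realZ mD (inner p.2 a) ip'.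
have E x : inner (simple_fun (p :: s) x) a = inner p.2 a * \1_(p.1) x + inner (simple_fun s x) a.
  by rewrite simple_fun_cons innerDl innerZl mulrC.
split.
  by have := integrable_realD mD ip is_; apply: eq_integrable => // x _ /=; rewrite E.
under eq_Rintegral do rewrite E.
rewrite RintegralD// -Es /simple_integral big_cons innerDl innerZl; congr (_ + _).
by rewrite RintegralZl// mulrC /Rintegral integral_indic// setIidl.
Qed.

Lemma measurable_normB f g :
  (forall a, measurable_fun D (fun x => inner (f x) a)) ->
  (forall a, measurable_fun D (fun x => inner (g x) a)) ->
  measurable_fun D (fun x => `|f x - g x|).
Proof.
move=> mf mg; have mfg : measurable_fun D ((fun x => f x - g x) : T -> borel K).
  apply: measurable_weak => // a; under eq_fun do rewrite innerBl.
  exact: measurable_funB.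
have mn : measurable_fun setT ((fun x => `|x|) : borel K -> R).
  by apply: measurable_of_continuous => x; exact: cvg_norm cvg_id.
exact: (measurableT_comp mn mfg).
Qed.

Lemma simple_weak_measurable s a : simple_on mu D s ->
  measurable_fun D (fun x => inner (simple_fun s x) a).
Proof.
move=> /(simple_weak a)[+ _] => /integrableP[+ _].
by move/measurable_EFinP.
Qed.

Lemma weak_limit_measurable (g : nat -> seq (set T * K)) f :
  (forall n, simple_on mu D (g n)) ->
  (forall x, D x -> simple_fun (g n) x @[n --> \oo] --> f x) ->
  forall a, measurable_fun D (fun x => inner (f x) a).
Proof.
move=> sg gf a.
apply: (measurable_fun_cvg (h := fun n x => inner (simple_fun (g n) x) a)).
  by move=> n; exact: simple_weak_measurable.
by move=> x Dx; apply: cvg_inner; [exact: gf|exact: cvg_cst].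
Qed.

(** Immediate for simple functions, and the error made with the n-th approximation is at most |a|
    times its L1 distance to f. Bochner integrals are manipulated below through this weak form. *)
Lemma bochner_weak f v : is_bochner_integral mu D f v ->
  forall a, mu.-integrable D (EFin \o (fun x => inner (f x) a)) /\
    inner v a = \int[mu]_(x in D) inner (f x) a.
Proof.
move=> [g [sg gf fg gv]] a.
have mf := weak_limit_measurable sg gf.
have mn n : measurable_fun D (fun x => `|f x - simple_fun (g n) x|).
  by apply: measurable_normB => // c; exact: simple_weak_measurable.
have idiff n : (\int[mu]_(x in D) `|f x - simple_fun (g n) x|%:E < +oo)%E ->
   mu.-integrable D (EFin \o (fun x => inner (f x) a - inner (simple_fun (g n) x) a)).
  move=> fin; apply: (integrable_real_le mD (g := fun x => `|a| * `|f x - simple_fun (g n) x|)).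
  - by apply: measurable_funB; [exact: mf|exact: simple_weak_measurable].
  - by move=> x Dx; rewrite -innerBl mulrC inner_le_norm.
  - by apply: integrable_realZ => //; exact: integrable_real_lty.
(* The L1 distances converge to 0 as extended reals, so they are finite only from some rank [N] on;
   integrability is read off at that rank. *)
have /fine_cvgP[[N _ NP] cr] := fg.
have fi n : (N <= n)%N -> (\int[mu]_(x in D) `|f x - simple_fun (g n) x|%:E < +oo)%E.
  by move=> Nn; rewrite ltey_eq NP.
have ia : mu.-integrable D (EFin \o (fun x => inner (f x) a)).
  have := integrable_realD mD (idiff N (fi N (leqnn N))) (simple_weak a (sg N)).1.
  by apply: eq_integrable => // x _ /=; rewrite subrK.
split=> //.
have c1 : inner (simple_integral mu (g n)) a @[n --> \oo] --> inner v a.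
  by apply: cvg_inner => //; exact: cvg_cst.
apply: (cvg_unique (@Rhausdorff R) c1).
have c2 : `|a| * \int[mu]_(x in D) `|f x - simple_fun (g n) x| @[n --> \oo] --> 0.
  by rewrite -(mulr0 `|a|); apply: cvgMr; exact: cr.
apply/cvgrPdist_le => e e0; near=> n.
have Nn : (N <= n)%N by near: n; exists N.
have [in_ ->] := simple_weak a (sg n).
rewrite -RintegralB//.
have ina : mu.-integrable D (EFin \o (fun x => `|f x - simple_fun (g n) x|)).
  by apply: integrable_real_lty => //; exact: fi.
apply: le_trans (le_normr_Rintegral mD (idiff n (fi n Nn))) _.
apply: (@le_trans _ _ (\int[mu]_(x in D) (`|a| * `|f x - simple_fun (g n) x|))).
  apply: le_Rintegral => //.
  - exact: (integrable_norm (idiff n (fi n Nn))).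
  - exact: integrable_realZ.
  - by move=> x Dx; rewrite -innerBl mulrC inner_le_norm.
rewrite RintegralZl//; near: n; move/cvgrPdist_le : c2 => /(_ e e0).
apply: filterS => n; rewrite sub0r normrN ger0_norm// mulr_ge0//.
exact: Rintegral_ge0.
Unshelve. all: by end_near. Qed.

Lemma bochner_norm_le f v h : is_bochner_integral mu D f v ->
  mu.-integrable D (EFin \o h) -> (forall x, D x -> `|f x| <= h x) ->
  `|v| <= \int[mu]_(x in D) h x.
Proof.
move=> fv ih fh; apply: norm_le_inner.
  by apply: Rintegral_ge0 => x Dx; rewrite (le_trans _ (fh _ Dx)).
move=> a; have [ia ->] := bochner_weak fv a.
rewrite -RintegralZr//; apply: le_Rintegral => //.
  by have := integrable_realZ mD `|a| ih; apply: eq_integrable => // x _ /=; rewrite mulrC.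
move=> x Dx; apply: le_trans (ler_norm _) _; apply: le_trans (inner_le_norm _ _) _.
by rewrite ler_wpM2r// fh.
Qed.

Lemma bochner_integralP f : bochner_integrable mu D f ->
  is_bochner_integral mu D f (bochner_integral mu D f).
Proof. by move=> [v fv]; apply: xgetPex; exists v. Qed.

(** Dominated convergence makes the simple functions converge in L1; their integrals are then
    Cauchy, and completeness supplies the value. *)
Lemma bochner_dominated (g : nat -> seq (set T * K)) f h :
  (forall n, simple_on mu D (g n)) ->
  (forall x, D x -> simple_fun (g n) x @[n --> \oo] --> f x) ->
  mu.-integrable D (EFin \o h) ->
  (forall n x, D x -> `|simple_fun (g n) x| <= h x) ->
  bochner_integrable mu D f.
Proof.
move=> sg gf ih gh.
have mf := weak_limit_measurable sg gf.
have mn n : measurable_fun D (fun x => `|f x - simple_fun (g n) x|).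
  by apply: measurable_normB => // c; exact: simple_weak_measurable.
have fh x : D x -> `|f x| <= h x.
  move=> Dx; rewrite -(cvg_lim (@Rhausdorff R) (cvg_norm (gf _ Dx))).
  apply: limr_le; first by apply/cvg_ex; eexists; exact: cvg_norm (gf _ Dx).
  by apply: nearW => n; exact: gh.
have h2 n x : D x -> `|f x - simple_fun (g n) x| <= 2 * h x.
  move=> Dx; rewrite (le_trans (ler_normB _ _))//.
  by have := gh n _ Dx; have := fh _ Dx; clear; set u := `|_|; set v := `|_|; set w := h x; lra.
have i2 := integrable_realZ mD 2 ih.
have in_ n : mu.-integrable D (EFin \o (fun x => `|f x - simple_fun (g n) x|)).
  by apply: integrable_real_le i2 => // x Dx; rewrite normr_id h2.
have [|||_ r0 r1] := @Rintegral_dominated _ _ _ mu D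
    (fun n x => `|f x - simple_fun (g n) x|) (fun=> 0) (fun x => 2 * h x) mD mn.
- move=> x Dx; rewrite -(normr0 K) -(subrr (f x)); apply: cvg_norm.
  by apply: cvgB; [exact: cvg_cst|exact: gf].
- exact: i2.
- by move=> n x Dx; rewrite normr_id h2.
pose r n := \int[mu]_(x in D) `|f x - simple_fun (g n) x|.
have {}r0 : r n @[n --> \oo] --> 0 by move: r0; rewrite Rintegral_cst// mul0r.
have wr n m : `|simple_integral mu (g n) - simple_integral mu (g m)| <= r n + r m.
  apply: norm_le_inner; first by rewrite addr_ge0// Rintegral_ge0.
  move=> a; rewrite innerBl.
  have [j1 ->] := simple_weak a (sg n); have [j2 ->] := simple_weak a (sg m).
  rewrite -RintegralB// -RintegralD// -RintegralZr//; last exact: integrable_realD.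
  apply: le_Rintegral => //.
  - exact: integrable_realB.
  - have := integrable_realZ mD `|a| (integrable_realD mD (in_ n) (in_ m)).
    by apply: eq_integrable => // x _ /=; rewrite mulrC.
  - move=> x Dx; rewrite -innerBl (le_trans (ler_norm _))// (le_trans (inner_le_norm _ _))//.
    rewrite ler_wpM2r// (distrC (f x)) -(subrKA (f x)).
    exact: ler_normD.
have wc : cvg (simple_integral mu (g n) @[n --> \oo]).
  apply: cvg_cauchy_filter => e e0.
  have e2 : 0 < e / 2 by rewrite divr_gt0.
  move/cvgrPdist_lt : r0 => /(_ _ e2)[N _ NP].
  have rN n : (N <= n)%N -> r n < e / 2.
    by move=> /NP /=; rewrite sub0r normrN; exact: le_lt_trans (ler_norm _).
  exists (simple_integral mu (g N)); exists N => // n /= Nn.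
  apply: le_lt_trans (wr _ _) _.
  by have := rN _ (leqnn N); have := rN _ Nn; clear; move: (r N) (r n) => x y; lra.
exists (lim (simple_integral mu (g n) @[n --> \oo])); exists g; split => //.
by move: r1; under eq_fun do under eq_integral do rewrite subr0 normr_id.
Qed.

End Bochner.

(** * Step functions and Riemann sums *)

Section Grid.
Context {R : realType}.

Definition gridpt (s delta : R) (k : nat) : R := s + delta * k%:R.

(** Left-open cells are sampled at their right endpoint, so sample points approach x from the right,
    where càdlàg paths are continuous. *)
Definition cell (s delta : R) (k : nat) : set R :=
  `]gridpt s delta k, gridpt s delta k.+1]%classic.

Lemma gridpt0 s delta : gridpt s delta 0 = s.
Proof. by rewrite /gridpt mulr0 addr0. Qed.

Lemma gridptS s delta k : gridpt s delta k.+1 = gridpt s delta k + delta.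
Proof. by rewrite /gridpt -natr1 mulrDr mulr1 addrA. Qed.

Lemma gridpt_le s delta j k : 0 <= delta -> (j <= k)%N ->
  gridpt s delta j <= gridpt s delta k.
Proof. by move=> d0 jk; rewrite lerD2l ler_wpM2l// ler_nat. Qed.

Lemma gridpt_end s t n : gridpt s ((t - s) / n.+1%:R) n.+1 = t.
Proof. by rewrite /gridpt divfK ?pnatr_eq0// addrC subrK. Qed.

Lemma gridpt_ge s delta k : 0 <= delta -> s <= gridpt s delta k.
Proof. by move=> d0; rewrite lerDl mulr_ge0. Qed.

Lemma cell_gt s delta k x : 0 <= delta -> cell s delta k x -> s < x.
Proof.
by move=> d0; rewrite /cell/= in_itv/= => /andP[+ _]; exact/le_lt_trans/gridpt_ge.
Qed.

Lemma cell_exists s delta n x : s < x -> x <= gridpt s delta n ->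
  exists2 k, (k < n)%N & cell s delta k x.
Proof.
elim: n => [|n ih] sx xn; first by move: sx; rewrite ltNge -(gridpt0 s delta) xn.
have [/(ih sx)[k kn kx]|xn'] := leP x (gridpt s delta n).
  by exists k => //; exact: ltnW.
by exists n => //; rewrite /cell/= in_itv/= xn' xn.
Qed.

Lemma cell_sum (V : lmodType R) s delta (F : nat -> V) n k x : 0 <= delta ->
  (k < n)%N -> cell s delta k x ->
  \sum_(i < n) (\1_(cell s delta i) x : R) *: F i = F k.
Proof.
move=> d0 kn; rewrite /cell/= in_itv/= => /andP[kx xk].
rewrite (bigD1 (Ordinal kn))//= indicE mem_set ?scale1r/=; last by rewrite in_itv/= kx xk.
rewrite big1 ?addr0// => i; rewrite -val_eqE/= neq_ltn => ik.
rewrite indicE memNset ?scale0r//= in_itv/= => /andP[ix xi].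
case/orP: ik => ik.
  by have := lt_le_trans kx xi; rewrite ltNge gridpt_le.
by have := lt_le_trans ix xk; rewrite ltNge gridpt_le.
Qed.

Lemma cell_bounds s delta k x : cell s delta k x ->
  x <= gridpt s delta k.+1 /\ gridpt s delta k.+1 <= x + delta.
Proof.
rewrite /cell/= in_itv/= => /andP[kx xk]; split=> //.
by rewrite gridptS lerD2r ltW.
Qed.

Lemma cell_norm_le (V : normedModType R) s delta (F : nat -> V) n x (M : R) : 0 <= delta ->
  0 <= M -> (forall k, (k < n)%N -> cell s delta k x -> `|F k| <= M) ->
  `|\sum_(i < n) (\1_(cell s delta i) x : R) *: F i| <= M.
Proof.
move=> d0 M0 FM.
have [[k kn kx]|nk] := pselect (exists2 k, (k < n)%N & cell s delta k x).
  by rewrite (cell_sum _ d0 kn kx); exact: FM.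
rewrite big1 ?normr0// => i _; rewrite indicE memNset ?scale0r// => ix.
by apply: nk; exists i.
Qed.

(* Stated with sequences staying in [D], so that nothing is required of the values
   outside [D]. *)
Definition right_continuous_on (V : topologicalType) (D : set R) (f : R -> V) : Prop :=
  forall x, D x -> forall y : nat -> R, (forall n, x <= y n /\ D (y n)) ->
    y n @[n --> \oo] --> x -> f (y n) @[n --> \oo] --> f x.

(** The sample point of the cell of x is at distance at most [delta n] to the right of x. [G] has
    two arguments since only one of them is sampled: in the application the time of the semigroup is
    kept exact and the path is sampled. *)
Lemma cell_cvg (V : normedModType R) (s : R) (delta : nat -> R) (N : nat -> nat)
    (D : set R) (G : R -> R -> V) x :
  (forall n, 0 <= delta n) -> delta n @[n --> \oo] --> 0 ->
  (forall n k, (k < N n)%N -> D (gridpt s (delta n) k.+1)) ->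
  (\forall n \near \oo, x <= gridpt s (delta n) (N n)) ->
  s < x -> D x -> right_continuous_on D (G x) ->
  \sum_(k < N n) (\1_(cell s (delta n) k) x : R) *: G x (gridpt s (delta n) k.+1)
    @[n --> \oo] --> G x x.
Proof.
move=> d0 dc gD xN sx Dx rG.
(* For those n whose grid does not reach x, the default y = x keeps the sequence in [D] and to the
   right of x. *)
have /choice[y yP] : forall n, exists y, [/\ x <= y, D y, y <= x + delta n &
    x <= gridpt s (delta n) (N n) ->
    \sum_(k < N n) (\1_(cell s (delta n) k) x : R) *: G x (gridpt s (delta n) k.+1) = G x y].
  move=> n; have [xn|xn] := leP x (gridpt s (delta n) (N n)).
    have [k kN kx] := cell_exists sx xn; have [y1 y2] := cell_bounds kx.
    exists (gridpt s (delta n) k.+1); split => //; first exact: gD.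
    by move=> _; rewrite (cell_sum (fun k => G x (gridpt s (delta n) k.+1)) (d0 n) kN kx).
  by exists x; split => //; rewrite lerDl.
have yx : y n @[n --> \oo] --> x.
  apply: (@squeeze_cvgr _ _ _ _ (fun=> x) (fun n => x + delta n)).
  - by apply: nearW => n; have [-> _ -> _] := yP n.
  - exact: cvg_cst.
  - by rewrite -[X in _ --> X]addr0; apply: cvgD; [exact: cvg_cst|].
have c := rG x Dx y (fun n => let: And4 a b _ _ := yP n in conj a b) yx.
apply: cvg_trans c; apply: near_eq_cvg; near=> n.
by have [_ _ _ ->] := yP n => //; near: n.
Unshelve. all: by end_near. Qed.

End Grid.

Section RightContinuous.
Context {R : realType}.
Notation mu := (@lebesgue_measure R).

Lemma measurable_cell (s delta : R) k : measurable (cell s delta k).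
Proof. exact: measurable_itv. Qed.

Lemma lebesgue_itv_lty (b c : bool) (x y : R) :
  (mu [set` Interval (BSide b x) (BSide c y)] < +oo)%E.
Proof. by rewrite lebesgue_measure_itv; case: ifP => _ //; rewrite -EFinB ltry. Qed.

(** Covers at once the segment, for the integral that defines X, and the half-line, for the
    resolvent. *)
Definition exhausting_grid (D : set R) (delta : nat -> R) (N : nat -> nat) : Prop :=
  [/\ forall n, 0 <= delta n, delta n @[n --> \oo] --> 0,
     forall n k, (k < N n)%N -> D (gridpt 0 (delta n) k.+1) &
     forall x, D x -> \forall n \near \oo, x <= gridpt 0 (delta n) (N n)].

Variables (D : set R) (mD : measurable D).
Hypothesis D0 : forall x, D x -> 0 <= x.
Hypothesis Dd : forall x y, D x -> 0 <= y <= x -> D y.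
Variables (delta : nat -> R) (N : nat -> nat).
Hypothesis grid : exhausting_grid D delta N.

Let delta0 : forall n, 0 <= delta n. Proof. by case: grid. Qed.
Let deltac : delta n @[n --> \oo] --> 0. Proof. by case: grid. Qed.
Let gD : forall n k, (k < N n)%N -> D (gridpt 0 (delta n) k.+1).
Proof. by case: grid. Qed.
Let gcov : forall x, D x -> \forall n \near \oo, x <= gridpt 0 (delta n) (N n).
Proof. by case: grid. Qed.

(** The point 0 belongs to no left-open cell and gets a term of its own. *)
Let step (V : lmodType R) (f : R -> V) n (x : R) : V := (\1_[set 0] x : R) *: f 0 +
  \sum_(k < N n) (\1_(cell 0 (delta n) k) x : R) *: f (gridpt 0 (delta n) k.+1).

Let step_cvg (V : normedModType R) (f : R -> V) x : right_continuous_on D f -> D x ->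
  step f n x @[n --> \oo] --> f x.
Proof.
move=> rf Dx; have := D0 Dx; rewrite le_eqVlt => /predU1P[<-|x0].
  apply: cvg_near_cst; apply: nearW => n; rewrite /step indicE mem_set// scale1r.
  rewrite big1 ?addr0// => k _; rewrite indicE memNset ?scale0r//.
  by move=> /(cell_gt (delta0 n)); rewrite ltxx.
rewrite -[f x]add0r; apply: cvgD.
  apply: cvg_near_cst; apply: nearW => n; rewrite indicE memNset ?scale0r//= => xE.
  by rewrite xE ltxx in x0.
by apply: (cell_cvg (D := D) (G := fun _ => f)) => //; exact: gcov.
Qed.

Let step_le (V : normedModType R) (f : R -> V) n x (M : R) : D x ->
  (forall y, D y -> x <= y -> `|f y| <= M) -> `|step f n x| <= M.
Proof.
move=> Dx fM; have M0 : 0 <= M by rewrite (le_trans _ (fM x Dx (lexx x))).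
have := D0 Dx; rewrite le_eqVlt => /predU1P[x0|x0].
  rewrite /step -x0 indicE mem_set// scale1r big1 ?addr0; first by apply: fM; rewrite -?x0// x0.
  move=> k _; rewrite indicE memNset ?scale0r//.
  by move=> /(cell_gt (delta0 n)); rewrite ltxx.
rewrite /step indicE memNset ?scale0r ?add0r//=; last by move=> xE; rewrite xE ltxx in x0.
apply: (cell_norm_le (F := fun k => f (gridpt 0 (delta n) k.+1))) => // k kN kx; apply: fM; first exact: gD.
by have [] := cell_bounds kx.
Qed.

(** The step functions take at x a value of f at some later point, which is why [h x] has to
    dominate f at all later points of [D]. *)
Lemma right_continuous_on_bochner (K : hilbertType R) (f : R -> K) (h : R -> R) :
  separable K -> right_continuous_on D f -> mu.-integrable D (EFin \o h) ->
  (forall x y, D x -> D y -> x <= y -> `|f y| <= h x) ->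
  bochner_integrable mu D f.
Proof.
move=> sepK rf ih fh.
pose g n : seq (set R * K) := ([set 0] `&` D, f 0) ::
  [seq (cell 0 (delta n) k, f (gridpt 0 (delta n) k.+1)) | k <- iota 0 (N n)].
have gE n x : D x -> simple_fun (g n) x = step f n x.
  move=> Dx; rewrite /simple_fun /g big_cons big_map /step /=; congr (_ + _).
    rewrite !indicE; congr ((nat_of_bool _)%:R *: _).
    by rewrite in_setI (mem_set Dx) andbT.
  by rewrite -[N n in LHS]subn0 -/(index_iota _ _) big_mkord.
apply: (@bochner_dominated R K sepK _ _ mu D mD g f h).
- move=> n [|i] /= ;rewrite ?size_map ?size_iota ?ltnS.
    move=> _; split; [exact: measurableI|exact: subIsetr|].
    apply: (@le_lt_trans _ _ (mu [set 0])); last by rewrite lebesgue_measure_set1.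
    by apply: le_measure; rewrite ?inE//; exact: measurableI.
  move=> iN; rewrite (nth_map 0%N) ?size_iota// nth_iota// add0n/=; split.
  + exact: measurable_cell.
  + move=> x cx; have [xg _] := cell_bounds cx.
    by apply: (Dd (gD iN)); rewrite xg ltW// (cell_gt (delta0 n) cx).
  + exact: lebesgue_itv_lty.
- move=> x Dx; have := step_cvg rf Dx; apply: cvg_trans; apply: near_eq_cvg.
  by apply: nearW => n; exact/esym/gE.
- exact: ih.
- move=> n x Dx; rewrite [X in `|X|](gE n x Dx).
  by apply: step_le => // y Dy xy; exact: fh.
Qed.

End RightContinuous.

Section IntervalGrids.
Context {R : realType}.
Notation mu := (@lebesgue_measure R).

Lemma cvg_div_natS (c : R) : c / n.+1%:R @[n --> \oo] --> (0 : R).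
Proof. by rewrite -(mulr0 c); apply: cvgMr; exact: cvg_harmonic. Qed.

Lemma segment_grid (t : R) : 0 <= t ->
  exhausting_grid `[0, t]%classic (fun n => t / n.+1%:R) succn.
Proof.
move=> t0; have d0 n : 0 <= t / n.+1%:R by rewrite divr_ge0.
have ge n : gridpt 0 (t / n.+1%:R) n.+1 = t by have := gridpt_end 0 t n; rewrite subr0.
split=> //.
- exact: cvg_div_natS.
- move=> n k kn; rewrite /= in_itv/= gridpt_ge//= -[leRHS](ge n); exact: gridpt_le.
- by move=> x /=; rewrite in_itv/= => /andP[_ xt]; apply: nearW => n; rewrite ge.
Qed.

(** With (n + 1)^2 cells of width 1 / (n + 1) the grid reaches n + 1. *)
Lemma halfline_grid :
  exhausting_grid `[0 : R, +oo[%classic (fun n => n.+1%:R^-1) (fun n => (n.+1 * n.+1)%N).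
Proof.
split=> //.
- exact: cvg_harmonic.
- by move=> n k _; rewrite /= in_itv/= gridpt_ge.
- move=> x _; near=> n; rewrite /gridpt add0r natrM mulKf ?pnatr_eq0//.
  near: n; exists (Num.truncn `|x|) => //= n xn.
  rewrite (le_trans (ler_norm _))// (le_trans (ltW (truncnS_gt _)))// ler_nat.
  by rewrite ltnS.
Unshelve. all: by end_near. Qed.

Lemma bochner_right_continuous_segment (K : hilbertType R) (t : R) (f : R -> K) (M : R) :
  separable K -> 0 <= t -> right_continuous_on `[0, t]%classic f ->
  (forall x, `[0, t]%classic x -> `|f x| <= M) ->
  bochner_integrable mu `[0, t]%classic f.
Proof.
move=> sepK t0 rf fM; have sD : measurable (`[0, t]%classic : set R) by exact: measurable_itv.
apply: (@right_continuous_on_bochner _ _ sD _ _ _ _ (segment_grid t0) _ _ (fun=> M)) => //.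
- by move=> x /=; rewrite in_itv/= => /andP[].
- move=> x y /=; rewrite !in_itv/= => /andP[_ xt] /andP[-> yx]; exact: le_trans xt.
- apply: (bounded_integrable (M := `|M|)) => //; exact: lebesgue_itv_lty.
- by move=> x y _ Dy _; exact: fM.
Qed.

Lemma bochner_right_continuous_halfline (K : hilbertType R) (f : R -> K) (h : R -> R) :
  separable K -> right_continuous_on `[0 : R, +oo[%classic f ->
  mu.-integrable `[0 : R, +oo[%classic (EFin \o h) ->
  (forall x y, 0 <= x -> x <= y -> `|f y| <= h x) ->
  bochner_integrable mu `[0 : R, +oo[%classic f.
Proof.
move=> sepK rf ih fh; have sD : measurable (`[0, +oo[%classic : set R) by exact: measurable_itv.
apply: (@right_continuous_on_bochner _ _ sD _ _ _ _ halfline_grid _ _ h) => //.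
- by move=> x /=; rewrite in_itv/= andbT.
- by move=> x y /=; rewrite !in_itv/= !andbT => _ /andP[].
- by move=> x y /=; rewrite in_itv/= andbT => x0 _; exact: fh.
Qed.

(** On each cell the first variable is integrated exactly and only the second is sampled. This is
    the form in which summation by parts delivers its remainder: the semigroup integrated, the path
    frozen. *)
Lemma riemann_cvg (s t : R) (g : R -> R -> R) (M : R) : s <= t ->
  (forall y, `]s, t]%classic y -> measurable_fun `]s, t]%classic (g ^~ y)) ->
  (forall v y, `]s, t]%classic v -> `]s, t]%classic y -> `|g v y| <= M) ->
  (forall v, `]s, t]%classic v -> right_continuous_on `]s, t]%classic (g v)) ->
  mu.-integrable `]s, t]%classic (EFin \o (fun v => g v v)) /\
  \sum_(k < n.+1) \int[mu]_(v in cell s ((t - s) / n.+1%:R) k)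
    g v (gridpt s ((t - s) / n.+1%:R) k.+1) @[n --> \oo] -->
  \int[mu]_(v in `]s, t]) g v v.
Proof.
move=> st mg gM rg; pose delta n : R := (t - s) / n.+1%:R.
have d0 n : 0 <= delta n by rewrite divr_ge0// subr_ge0.
have gE n : gridpt s (delta n) n.+1 = t by rewrite gridpt_end.
pose D : set R := `]s, t]%classic.
have [|st'] := leP t s.
  move=> ts; have tsE : t = s by apply/eqP; rewrite eq_le ts st.
  have -> : `]s, t]%classic = set0 :> set R by rewrite tsE set_itv_ge// bnd_simp ltxx.
  split; first exact: integrable_set0.
  rewrite Rintegral_set0; apply: cvg_near_cst; apply: nearW => n; rewrite big1// => k _.
  rewrite (_ : cell _ _ _ = set0) ?Rintegral_set0//.
  by rewrite tsE subrr mul0r /cell /gridpt !mul0r set_itv_ge// bnd_simp ltxx.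
have gD n k : (k < n.+1)%N -> D (gridpt s (delta n) k.+1).
  move=> kn; rewrite /D/= in_itv/=; apply/andP; split; last by rewrite -[leRHS](gE n) gridpt_le.
  by rewrite /gridpt ltrDl mulr_gt0// divr_gt0// subr_gt0.
have cD n k : (k < n.+1)%N -> cell s (delta n) k `<=` D.
  move=> kn x cx; rewrite /D/= in_itv/= (cell_gt (d0 n) cx)/=.
  have [xg _] := cell_bounds cx; apply: le_trans xg _.
  by rewrite -[leRHS](gE n) gridpt_le.
have Dlty : (mu D < +oo)%E by exact: lebesgue_itv_lty.
pose F n v := \sum_(k < n.+1) (\1_(cell s (delta n) k) v : R) *: g v (gridpt s (delta n) k.+1).
have mF1 n k : (k < n.+1)%N -> measurable_fun D
    (fun v => (\1_(cell s (delta n) k) v : R) *: g v (gridpt s (delta n) k.+1)).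
  move=> kn; apply: measurable_funM; last by apply: mg; exact: gD.
  by apply: measurable_indic; exact: measurable_cell.
have [|||||i0 i1 _] := @Rintegral_dominated _ _ _ mu D F (fun v => g v v) (fun=> `|M|).
- exact: measurable_itv.
- by move=> n; apply: measurable_sum => k; exact: mF1.
- move=> v Dv; apply: (cell_cvg (D := D) (delta := delta) (N := succn)) => //.
  + exact: cvg_div_natS.
  + by move: Dv; rewrite /D/= in_itv/= => /andP[_ vt]; apply: nearW => n; rewrite gE.
  + by move: Dv; rewrite /D/= in_itv/= => /andP[].
  + exact: rg.
- apply: (bounded_integrable (M := `|M|)) => //; first exact: measurable_itv.
  by move=> v _; rewrite normr_id.
- move=> n v Dv; apply: (cell_norm_le (F := fun k => g v (gridpt s (delta n) k.+1))) => // k kn _.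
  by rewrite (le_trans _ (ler_norm _))// gM//; exact: gD.
split=> //; apply: cvg_trans i1; apply: near_eq_cvg; apply: nearW => n.
have iF (k : 'I_n.+1) : mu.-integrable D (EFin \o (fun v =>
    (\1_(cell s (delta n) k) v : R) *: g v (gridpt s (delta n) k.+1))).
  apply: (bounded_integrable (M := `|M|)) => //; first exact: measurable_itv.
    exact: mF1.
  move=> v Dv; rewrite normrM -[leRHS]mul1r ler_pM//.
    by rewrite indicE; case: (_ \in _); rewrite ?normr0 ?normr1.
  by rewrite (le_trans _ (ler_norm _))// gM//; exact: gD.
have mD : measurable D by exact: measurable_itv.
rewrite /F Rintegral_sum//; apply: eq_bigr => k _.
rewrite -[X in _ = Rintegral _ X _](setIidr (cD n k (ltn_ord k))) Rintegral_mkcondr; apply: eq_Rintegral => v _.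
by rewrite /patch indicE; case: ifP => _; rewrite /= ?scale1r ?scale0r.
Qed.

End IntervalGrids.

(** * Semigroups and resolvents *)

Section SequentialLimits.
Context {R : realType}.

Lemma norm_cvg_sub0 (V : normedModType R) (T : Type) (F : set_system T) {FF : Filter F}
    (f : T -> V) (l : V) : `|f t - l| @[t --> F] --> 0 -> f @ F --> l.
Proof. by move=> /norm_cvg0P/cvg_sub0; apply; exact: cvg_cst. Qed.

Lemma cvg_sub_norm (V : normedModType R) (T : Type) (F : set_system T) {FF : Filter F}
    (f : T -> V) (l : V) : f @ F --> l -> `|f t - l| @[t --> F] --> 0.
Proof.
move=> fl; rewrite -(normr0 V) -(subrr l); apply: cvg_norm.
by apply: cvgB => //; exact: cvg_cst.
Qed.

Lemma cvg_at_right_of_seq (V : normedModType R) (f : R -> V) (p : R) (l : V) :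
  (forall u : nat -> R, (forall n, p < u n) -> u n @[n --> \oo] --> p ->
    f (u n) @[n --> \oo] --> l) -> f x @[x --> p^'+] --> l.
Proof.
move=> H; apply: norm_cvg_sub0; apply/cvg_at_rightP => u [pu up].
by apply: (cvg_sub_norm (f := f \o u)); exact: H.
Qed.

Lemma cvg_at_left_of_seq (V : normedModType R) (f : R -> V) (p : R) (l : V) :
  (forall u : nat -> R, (forall n, u n < p) -> u n @[n --> \oo] --> p ->
    f (u n) @[n --> \oo] --> l) -> f x @[x --> p^'-] --> l.
Proof.
move=> H; apply: norm_cvg_sub0; apply/cvg_at_leftP => u [pu up].
by apply: (cvg_sub_norm (f := f \o u)); exact: H.
Qed.

Lemma cvg_seq_right (V : normedModType R) (f : R -> V) (p : R) (u : nat -> R) :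
  f x @[x --> p^'+] --> f p -> (forall n, p <= u n) -> u n @[n --> \oo] --> p ->
  f (u n) @[n --> \oo] --> f p.
Proof.
move=> fp pu up; apply/cvgrPdist_lt => e e0.
move/cvgrPdist_lt : fp => /(_ e e0)[r /= r0 Hr].
move/cvgrPdist_lt : up => /(_ r r0); apply: filterS => n un.
have := pu n; rewrite le_eqVlt => /predU1P[<-|pun]; first by rewrite subrr normr0.
exact: Hr.
Qed.

Lemma squeeze_norm (V : normedModType R) (f : nat -> V) (l : V) (g : nat -> R) :
  (forall n, `|f n - l| <= g n) -> g n @[n --> \oo] --> 0 -> f n @[n --> \oo] --> l.
Proof.
move=> fg g0; apply: norm_cvg_sub0.
apply: (@squeeze_cvgr _ _ _ _ (fun=> 0) g) => //; last exact: cvg_cst.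
by apply: nearW => n; rewrite normr_ge0 fg.
Qed.

End SequentialLimits.

Section Semigroup.
Context {R : realType} (K : hilbertType R) (S : R -> K -> K).
Hypothesis S_semigroup : strongly_continuous_semigroup S.
Variables (c0 b0 : R) (c0_ge0 : 0 <= c0) (b0_ge0 : 0 <= b0).
Hypothesis S_bound : forall t x, 0 <= t -> `|S t x| <= c0 * expR (b0 * t) * `|x|.

Lemma semigroup_linear t : 0 <= t -> linear (S t).
Proof. by case: S_semigroup => + _ _ _ t0 => /(_ t t0)[]. Qed.

Lemma semigroup_bound_le s t x : 0 <= s -> s <= t ->
  `|S s x| <= c0 * expR (b0 * t) * `|x|.
Proof.
move=> s0 st; apply: le_trans (S_bound _ s0) _.
by rewrite ler_wpM2r// ler_wpM2l// ler_expR ler_wpM2l.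
Qed.

(** Factor out the smaller of the two times; in both cases it is at most s. Strong continuity at 0
    thus becomes two-sided continuity at s. *)
Lemma semigroup_dist s t x : 0 <= s -> 0 <= t ->
  `|S t x - S s x| <= c0 * expR (b0 * s) * `|S `|t - s| x - x|.
Proof.
move=> s0 t0; have [_ _ SD _] := S_semigroup.
have [st|ts] := leP s t.
  have ts0 : 0 <= t - s by rewrite subr_ge0.
  have {1}-> : S t x = S s (S (t - s) x) by rewrite -SD// addrC subrK.
  rewrite ger0_norm// -(linearBf _ _ (semigroup_linear s0)).
  exact: semigroup_bound_le.
have st0 : 0 <= s - t by rewrite subr_ge0 ltW.
have {1}-> : S s x = S t (S (s - t) x) by rewrite -SD// addrC subrK.
rewrite -(distrC s) ger0_norm// distrC -(linearBf _ _ (semigroup_linear t0)).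
by apply: semigroup_bound_le => //; exact: ltW.
Qed.

Lemma semigroup_cvg0 (x : K) (h : nat -> R) : (forall n, 0 <= h n) ->
  h n @[n --> \oo] --> 0 -> S (h n) x @[n --> \oo] --> x.
Proof.
have [_ S0 _ Sc] := S_semigroup => h0 hc; have {2}<- := S0 x.
by apply: (cvg_seq_right (f := S ^~ x)) => //; rewrite S0; exact: Sc.
Qed.

Lemma semigroup_continuous (x : K) (s : R) (t : nat -> R) : 0 <= s -> (forall n, 0 <= t n) ->
  t n @[n --> \oo] --> s -> S (t n) x @[n --> \oo] --> S s x.
Proof.
move=> s0 t0 ts; apply: (squeeze_norm (fun n => semigroup_dist x s0 (t0 n))).
rewrite -(mulr0 (c0 * expR (b0 * s))); apply: cvgMr.
apply: (cvg_sub_norm (f := fun n => S `|t n - s| x)).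
by apply: semigroup_cvg0 => //; exact: cvg_sub_norm.
Qed.

Lemma semigroup_continuous2 (s : R) (t : nat -> R) (x : K) (y : nat -> K) : 0 <= s ->
  (forall n, 0 <= t n) -> t n @[n --> \oo] --> s -> y n @[n --> \oo] --> x ->
  S (t n) (y n) @[n --> \oo] --> S s x.
Proof.
move=> s0 t0 ts yx; have c1 : S (t n) x @[n --> \oo] --> S s x by exact: semigroup_continuous.
have tb : \forall n \near \oo, t n <= s + 1.
  move/cvgrPdist_le : ts => /(_ 1 ltr01); apply: filterS => n.
  by rewrite ler_distl => /andP[+ _]; lra.
apply: norm_cvg_sub0; apply: (@squeeze_cvgr _ _ _ _ (fun=> 0)
  (fun n => c0 * expR (b0 * (s + 1)) * `|y n - x| + `|S (t n) x - S s x|)).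
- near=> n; rewrite normr_ge0/= -(subrKA (S (t n) x)) (le_trans (ler_normD _ _))// lerD2r.
  rewrite -(linearBf _ _ (semigroup_linear (t0 n))).
  by apply: semigroup_bound_le => //; near: n.
- exact: cvg_cst.
- rewrite -[X in _ --> X]addr0; apply: cvgD; last exact: cvg_sub_norm.
  by rewrite -(mulr0 (c0 * expR (b0 * (s + 1)))); apply: cvgMr; exact: cvg_sub_norm.
Unshelve. all: by end_near. Qed.

End Semigroup.

(** * Translation and exponential integrals on the half-line *)

Section LebesgueShift.
Context {R : realType}.
Notation mu := (@lebesgue_measure R).

Section Shift.
Variable h : R.
Let phi : measurableTypeR R -> measurableTypeR R := fun x => x + h.
Let mphi : measurable_fun setT phi.
Proof. by apply: measurable_funD; [exact: measurable_id|exact: measurable_cst]. Qed.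
Let phi_mixin := isMeasurableFun.Build _ _ _ _ phi mphi.
Let phi_pack : {mfun _ >-> _} := HB.pack phi phi_mixin.

Let lebesgue_measure_shift (A : set R) : measurable A ->
  pushforward mu phi_pack A = mu A.
Proof.
move=> mA; apply/esym/lebesgue_measure_unique => //= _ [[a b]] _ <-.
rewrite /pushforward (_ : _ @^-1` _ = `]a - h, b - h]%classic).
  rewrite !lebesgue_measure_itv/= !lte_fin ltrD2r; case: ifP => // _.
  by rewrite -!EFinD; congr EFin; ring.
by apply/seteqP; split => x /=; rewrite !in_itv/= ltrBlDr lerBrDr.
Qed.

Lemma Rintegral_shift (f : R -> R) :
  measurable_fun `[h, +oo[%classic f ->
  mu.-integrable `[0 : R, +oo[%classic (EFin \o (fun x => f (x + h))) ->
  \int[mu]_(x in `[0 : R, +oo[) f (x + h) = \int[mu]_(x in `[h, +oo[) f x.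
Proof.
move=> mf iff; pose F := f \_ `[h, +oo[%classic.
have mD : measurable (`[h, +oo[%classic : set R) by exact: measurable_itv.
have mF : measurable_fun setT F.
  by apply/(measurable_restrictT _ mD).
have pD : phi @^-1` `[h, +oo[%classic = `[0, +oo[%classic.
  by apply/seteqP; split => x /=; rewrite !in_itv/= !andbT /phi lerDr.
have FE x : `[0 : R, +oo[%classic x -> F (x + h) = f (x + h).
  move=> /=; rewrite in_itv/= andbT => x0.
  by rewrite /F patchE mem_set//= in_itv/= andbT lerDr.
rewrite /Rintegral; congr fine.
have := @integral_pushforward _ _ _ _ R phi mphi mu `[h, +oo[%classic (EFin \o F).
rewrite pD => H.
transitivity (\int[mu]_(x in `[0%R, +oo[) ((EFin \o F) \o phi) x)%E.
  by apply: eq_integral => x /set_mem x0; rewrite /= /phi FE.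
rewrite -H//; last 2 first.
- exact/measurable_EFinP.
- by apply: eq_integrable iff => // x /set_mem x0 /=; rewrite /phi FE.
transitivity (\int[mu]_(x in `[h, +oo[) (EFin \o F) x)%E.
  apply: eq_measure_integral => A mA _; exact: lebesgue_measure_shift.
by apply: eq_integral => x xh; rewrite /= /F patchE xh.
Qed.

End Shift.

Lemma integrable_expR_halfline (k : R) : 0 < k ->
  mu.-integrable `[0 : R, +oo[%classic (EFin \o (fun x => expR (- (k * x)))).
Proof.
move=> k0.
have : mu.-integrable `[0 : R, +oo[%classic (EFin \o exponential_pdf k).
  by apply: integrableS (integrable_exponential_pdf k0) => //; exact: measurable_itv.
have mD : measurable (`[0, +oo[%classic : set (measurableTypeR R)) by exact: measurable_itv.
move=> H; have := @integrable_realZ _ (measurableTypeR R) R mu _ mD k^-1 _ H; apply: eq_integrable => // x x0 /=.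
congr EFin; rewrite /exponential_pdf /patch x0 mulKf ?gt_eqF// mulNr//.
Qed.

End LebesgueShift.

(** * The resolvent and its difference quotients *)

Section Resolvent.
Context {R : realType} (K : hilbertType R) (sepK : separable K) (S : R -> K -> K).
Hypothesis S_semigroup : strongly_continuous_semigroup S.
Variables (c0 b0 : R) (c0_ge0 : 0 <= c0) (b0_ge0 : 0 <= b0).
Hypothesis S_bound : forall t x, 0 <= t -> `|S t x| <= c0 * expR (b0 * t) * `|x|.
Variables (alpha : R) (alpha_gt : b0 < alpha).
Notation mu := (@lebesgue_measure R).
Notation U := (resolvent S alpha).
Notation halfline := (`[0 : R, +oo[%classic).

Let mH : measurable (halfline : set (measurableTypeR R)). Proof. exact: measurable_itv. Qed.

Let kappa0 : 0 < alpha - b0. Proof. by rewrite subr_gt0. Qed.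

Let dom (x : K) (s : R) : R := c0 * `|x| * expR (- ((alpha - b0) * s)).

Let dom_integrable x : mu.-integrable halfline (EFin \o dom x).
Proof. by apply: integrable_realZ => //; exact: integrable_expR_halfline. Qed.

Let dom_bound x s y : 0 <= s -> s <= y ->
  `|expR (- (alpha * y)) *: S y x| <= dom x s.
Proof.
move=> s0 sy; have y0 := le_trans s0 sy.
rewrite normrZ ger0_norm ?expR_ge0// /dom.
apply: (@le_trans _ _ (expR (- (alpha * y)) * (c0 * expR (b0 * y) * `|x|))).
  by rewrite ler_wpM2l ?expR_ge0// S_bound.
rewrite (_ : _ * _ = c0 * `|x| * (expR (- (alpha * y)) * expR (b0 * y))); last by ring.
rewrite ler_wpM2l ?mulr_ge0// -expRD ler_expR.
rewrite (_ : _ + _ = - ((alpha - b0) * y)); last by ring.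
by rewrite lerN2 ler_wpM2l// ltW.
Qed.

Let path_right_continuous x :
  right_continuous_on halfline (fun s => expR (- (alpha * s)) *: S s x).
Proof.
move=> s; rewrite /= in_itv/= andbT => s0 y Hy ys; apply: cvgZ.
  apply: (continuous_cvg _ (@continuous_expR R _)); apply: cvgN.
  by apply: cvgMr.
apply: (semigroup_continuous S_semigroup c0_ge0 b0_ge0 S_bound) => // n.
by have [_] := Hy n; rewrite /= in_itv/= andbT.
Qed.

Lemma resolventP x : is_bochner_integral mu halfline
  (fun s => expR (- (alpha * s)) *: S s x) (U x).
Proof.
apply: bochner_integralP; apply: (bochner_right_continuous_halfline (h := dom x)) => //.
by move=> s y s0 sy; exact: dom_bound.
Qed.

Lemma resolvent_weak x a :
  mu.-integrable halfline (EFin \o (fun s => expR (- (alpha * s)) * inner (S s x) a)) /\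
  inner (U x) a = \int[mu]_(s in halfline) (expR (- (alpha * s)) * inner (S s x) a).
Proof.
have [i E] := bochner_weak sepK mH (resolventP x) a; split.
  by apply: eq_integrable i => // s _ /=; rewrite innerZl.
by rewrite E; apply: eq_Rintegral => s _; rewrite innerZl.
Qed.

Lemma resolvent_bound : exists2 C, 0 <= C & forall x, `|U x| <= C * `|x|.
Proof.
exists (c0 * \int[mu]_(s in halfline) expR (- ((alpha - b0) * s))).
  by rewrite mulr_ge0// Rintegral_ge0// => s _; exact: expR_ge0.
move=> x; apply: le_trans (bochner_norm_le sepK mH (resolventP x) (dom_integrable x) _) _.
  by move=> s /=; rewrite in_itv/= andbT => s0; exact: dom_bound.
have i := integrable_expR_halfline kappa0.
by rewrite /dom (RintegralZl _ mH i) mulrAC.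
Qed.

Lemma resolvent_linear : linear U.
Proof.
move=> c x y; apply: inner_ext => a; rewrite innerDl innerZl.
have [i1 ->] := resolvent_weak x a; have [i2 ->] := resolvent_weak y a.
have [_ ->] := resolvent_weak (c *: x + y) a.
have i3 := integrable_realZ mH c i1.
rewrite -RintegralZl// -RintegralD//; apply: eq_Rintegral => s; rewrite inE/= in_itv/= andbT => s0.
by rewrite (semigroup_linear S_semigroup s0) innerDl innerZl; ring.
Qed.

(** Tested against a, [S t] crosses the inner product as its adjoint, passes through the scalar
    integral and is moved back. *)
Lemma resolvent_commute t x : 0 <= t -> S t (U x) = U (S t x).
Proof.
move=> t0; have [Sb _ SD _] := S_semigroup.
have [g gP] := adjoint_exists (Sb t t0).
apply: inner_ext => a; rewrite gP (resolvent_weak x (g a)).2 (resolvent_weak _ a).2.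
apply: eq_Rintegral => s; rewrite inE/= in_itv/= andbT => s0.
by rewrite -gP -!SD// addrC.
Qed.

(* Equal to the integral of e^(alpha (h - r)) S_r x over [0, h]. *)
Let remainder h x := (expR (alpha * h) - 1) *: U x - (S h (U x) - U x).

(** A change of variable gives S_h U x = e^(alpha h) times the integral of e^(- alpha s) S_s x over
    [h, oo). Subtracting this from e^(alpha h) U x leaves the part over [0, h]. *)
Let remainder_weak h x a : 0 <= h ->
  let f r := expR (alpha * (h - r)) * inner (S r x) a in
  mu.-integrable `[0, h]%classic (EFin \o f) /\
  inner (remainder h x) a = \int[mu]_(r in `[0, h]) f r.
Proof.
move=> h0 f; have [i1 E1] := resolvent_weak x a.
have [i2 E2] := resolvent_weak (S h x) a.
pose phi s := expR (- (alpha * s)) * inner (S s x) a.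
have sub1 : `[0, h]%classic `<=` (halfline : set R).
  by move=> s /=; rewrite !in_itv/= andbT => /andP[].
have i3 : mu.-integrable `[0, h]%classic (EFin \o phi).
  by apply: integrableS i1 => //; exact: measurable_itv.
have m1 : measurable (`[0, h]%classic : set (measurableTypeR R)) by exact: measurable_itv.
have fE r : f r = expR (alpha * h) * phi r.
  by rewrite /f /phi mulrA -expRD; congr (expR _ * _); ring.
split.
  have := integrable_realZ m1 (expR (alpha * h)) i3.
  by apply: eq_integrable => // r _ /=; rewrite fE.
have [_ _ SD _] := S_semigroup.
have E3 : inner (S h (U x)) a = expR (alpha * h) * \int[mu]_(s in `[h, +oo[) phi s.
  have ish : mu.-integrable halfline (EFin \o (fun s => phi (s + h))).
    have := integrable_realZ mH (expR (- (alpha * h))) i2.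
    apply: eq_integrable => // s; rewrite inE/= in_itv/= andbT => s0.
    by rewrite /phi mulrA -expRD SD//; congr (expR _ * _)%:E; ring.
  have <- : \int[mu]_(s in halfline) phi (s + h) = \int[mu]_(s in `[h, +oo[) phi s.
    apply: Rintegral_shift ish.
    have /integrableP[/measurable_EFinP mphi _] := i1.
    apply: measurable_funS mphi => //.
    by move=> s /=; rewrite !in_itv/= !andbT; exact: le_trans.
  rewrite resolvent_commute// E2 -(RintegralZl _ mH ish).
  apply: eq_Rintegral => s; rewrite inE/= in_itv/= andbT => s0.
  by rewrite /phi mulrA -expRD SD//; congr (expR _ * _); ring.
have E4 : \int[mu]_(s in halfline) phi s =
    \int[mu]_(s in `[0, h]) phi s + \int[mu]_(s in `[h, +oo[) phi s.
  have := @Rintegral_itvB R phi (BLeft 0) +oo%O h i1.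
  rewrite !bnd_simp => /(_ h0 isT) H.
  have <- : \int[mu]_(s in `]h, +oo[) phi s = \int[mu]_(s in `[h, +oo[) phi s.
    apply: Rintegral_itv_obnd_cbnd; apply: integrableS i1 => //.
    by move=> s /=; rewrite !in_itv/= !andbT => hs; exact: le_trans (ltW hs).
  by rewrite -H addrC subrK.
have -> : \int[mu]_(r in `[0, h]) f r = expR (alpha * h) * \int[mu]_(r in `[0, h]) phi r.
  by rewrite -(RintegralZl _ m1 i3); apply: eq_Rintegral => r _; exact: fE.
rewrite /remainder !innerBl innerZl E3 E1 E4; ring.
Qed.

Let alpha0 : 0 <= alpha. Proof. by rewrite (le_trans b0_ge0)// ltW. Qed.

Let remainder_dist h x (e : R) : 0 <= h -> 0 <= e ->
  (forall r, 0 <= r <= h -> `|expR (alpha * (h - r)) *: S r x - x| <= e) ->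
  `|remainder h x - h *: x| <= h * e.
Proof.
move=> h0 e0 He; apply: norm_le_inner; first exact: mulr_ge0.
move=> a; rewrite innerBl innerZl; have [i1 ->] := remainder_weak x a h0.
have m1 : measurable (`[0, h]%classic : set (measurableTypeR R)) by exact: measurable_itv.
have ic (c : R) : mu.-integrable `[0, h]%classic (EFin \o (fun=> c)).
  by apply: (bounded_integrable (M := `|c|)) => //; exact: lebesgue_itv_lty.
have hm (c : R) : \int[mu]_(r in `[0, h]) c = h * c.
  have lh : fine (mu `[0, h]%classic) = h.
    rewrite lebesgue_measure_itv/= lte_fin.
    by move: h0; rewrite le_eqVlt => /predU1P[<-|->]; rewrite ?ltxx//= oppr0 addr0.
  by transitivity (c * fine (mu `[0, h]%classic)); [exact: (Rintegral_cst mu m1)|rewrite lh mulrC].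
rewrite -(hm (inner x a)) -(RintegralB m1 i1 (ic _)) -(mulrA h) -(hm (e * `|a|)); apply: le_Rintegral => //.
  exact: (integrable_realB m1 i1 (ic _)).
move=> r /=; rewrite in_itv/= => r0; rewrite -innerZl -innerBl.
by rewrite (le_trans (ler_norm _))// (le_trans (inner_le_norm _ _))// ler_wpM2r// He.
Qed.

(** Splits the distance to alpha U x - x, the value of the generator at U x, into the error of the
    scalar difference quotient of e^(alpha h) and that of the mean [h^-1 *: remainder h x]. *)
Let diffE h x : 0 < h ->
  h^-1 *: (S h (U x) - U x) - (alpha *: U x - x) =
  (h^-1 * (expR (alpha * h) - 1) - alpha) *: U x - h^-1 *: (remainder h x - h *: x).
Proof.
move=> h0; apply: inner_ext => a; rewrite /remainder !(innerBl, innerZl).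
by field; rewrite gt_eqF.
Qed.

Lemma expR_sub1 (y : R) : 0 <= y -> y <= expR y - 1 <= y * expR y.
Proof.
move=> y0; rewrite lerBrDl expR_ge1Dx/=.
have := expR_ge1Dx (- y); rewrite expRN -(ler_pM2r (expR_gt0 y)) mulVf ?gt_eqF ?expR_gt0//.
by rewrite mulrDl mul1r mulNr; lra.
Qed.

Let expR_quot h : 0 < h -> 0 <= h^-1 * (expR (alpha * h) - 1) - alpha <= alpha * (expR (alpha * h) - 1).
Proof.
move=> h0; have /andP[l u] := expR_sub1 (mulr_ge0 alpha0 (ltW h0)).
have -> : h^-1 * (expR (alpha * h) - 1) - alpha = h^-1 * (expR (alpha * h) - 1 - alpha * h).
  by field; rewrite gt_eqF.
apply/andP; split; first by rewrite mulr_ge0 ?invr_ge0 ?subr_ge0// ltW.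
by rewrite mulrC ler_pdivrMr//; move: u; lra.
Qed.

(** A bound uniform in h and linear in |x|: applied to the values of a path, it provides the
    majorant for dominated convergence in the entrance space. *)
Lemma resolvent_quotient_bound : exists2 C, 0 <= C & forall h x, 0 < h -> h <= 1 ->
  `|h^-1 *: (S h (U x) - U x)| <= C * `|x|.
Proof.
have [CU CU0 HU] := resolvent_bound.
(* [B * |x|] bounds the distance of e^(alpha (h - r)) S_r x to x for 0 <= r <= h <= 1. *)
pose B := expR alpha * (c0 * expR b0) + 1.
have B0 : 0 <= B by rewrite addr_ge0 ?mulr_ge0 ?expR_ge0.
exists (alpha * expR alpha * CU + B + alpha * CU + 1).
  by rewrite !addr_ge0 ?mulr_ge0 ?expR_ge0.
move=> h x h0 h1.
have /andP[q0 q1] := expR_quot h0.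
have eh : expR (alpha * h) <= expR alpha by rewrite ler_expR ler_piMr.
have R1 : `|remainder h x - h *: x| <= h * (B * `|x|).
  apply: remainder_dist => //; first exact: ltW; first exact: mulr_ge0.
  move=> r /andP[r0 rh]; rewrite (le_trans (ler_normB _ _))// mulrDl mul1r lerD2r.
  rewrite normrZ ger0_norm ?expR_ge0// -mulrA ler_pM ?expR_ge0//.
    rewrite ler_expR ler_piMr//; lra.
  have r1 : r <= 1 by exact: le_trans h1.
  have := semigroup_bound_le c0_ge0 b0_ge0 S_bound x r0 r1.
  by rewrite mulr1.
have H1 : h^-1 * `|remainder h x - h *: x| <= B * `|x| by rewrite ler_pdivrMl.
have H2 : (h^-1 * (expR (alpha * h) - 1) - alpha) * `|U x| <= alpha * expR alpha * (CU * `|x|).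
  apply: ler_pM => //; apply: le_trans q1 _; rewrite ler_wpM2l//.
  by rewrite (le_trans _ eh)// lerBlDr lerDl.
have H3 : alpha * `|U x| <= alpha * (CU * `|x|) by rewrite ler_wpM2l.
rewrite (_ : h^-1 *: _ = ((h^-1 * (expR (alpha * h) - 1) - alpha) *: U x -
  h^-1 *: (remainder h x - h *: x)) + (alpha *: U x - x)); last by rewrite -diffE// subrK.
have hi : 0 <= h^-1 by rewrite invr_ge0 ltW.
have N1 := le_trans (ler_normB ((h^-1 * (expR (alpha * h) - 1) - alpha) *: U x)
  (h^-1 *: (remainder h x - h *: x))) (lerD _ _).
rewrite !normrZ (ger0_norm q0) (ger0_norm hi) in N1.
have N2 := le_trans (ler_normB (alpha *: U x) x) (lerD _ (lexx _)).
rewrite normrZ (ger0_norm alpha0) in N2.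
apply: le_trans (ler_normD _ _) _; apply: le_trans (lerD (N1 _ _ H2 H1) (N2 _ H3)) _.
by rewrite le_eqVlt; apply/orP; left; apply/eqP; ring.
Qed.

Lemma resolvent_quotient_cvg (x : K) (h : nat -> R) : (forall n, 0 < h n) ->
  h n @[n --> \oo] --> 0 ->
  (h n)^-1 *: (S (h n) (U x) - U x) @[n --> \oo] --> alpha *: U x - x.
Proof.
move=> h0 hc; have [_ S0 _ Sc] := S_semigroup.
have ec : expR (alpha * h n) - 1 @[n --> \oo] --> 0.
  rewrite -(subrr (1 : R)) -[in X in _ --> X - _](expR0 R) -(mulr0 alpha).
  apply: cvgB; last exact: cvg_cst.
  by apply: (continuous_cvg _ (@continuous_expR R _)); exact: cvgMr.
apply/cvgrPdist_le => e e0; pose B := c0 * expR b0 * `|x|.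
have B0 : 0 <= B by rewrite !mulr_ge0 ?expR_ge0.
(* One third each for the exponential factor in the integrand of [remainder], for strong continuity
   of S at 0, and for the scalar difference quotient. *)
have e3 : 0 < e / 3 by rewrite divr_gt0.
have /cvgrPdist_le/(_ _ e3) n1 : (expR (alpha * h n) - 1) * (alpha * `|U x|) @[n --> \oo] --> 0.
  by rewrite -(mul0r (alpha * `|U x|)); exact: cvgMl.
have /cvgrPdist_le/(_ _ e3) n2 : (expR (alpha * h n) - 1) * B @[n --> \oo] --> 0.
  by rewrite -(mul0r B); exact: cvgMl.
have /cvgrPdist_le/(_ _ e3)[d /= d0 Hd] := Sc x.
have /cvgrPdist_lt/(_ _ d0) n3 := hc.
have /cvgrPdist_lt/(_ _ ltr01) n4 := hc.
near=> n.
have hn1 : h n <= 1.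
  have : `|0 - h n| < 1 by near: n.
  by rewrite sub0r normrN gtr0_norm// => /ltW.
have hnd : h n < d.
  have : `|0 - h n| < d by near: n.
  by rewrite sub0r normrN gtr0_norm.
have /andP[q0 q1] := expR_quot (h0 n).
have E1 : (expR (alpha * h n) - 1) * (alpha * `|U x|) <= e / 3.
  have : `|0 - (expR (alpha * h n) - 1) * (alpha * `|U x|)| <= e / 3 by near: n.
  by rewrite sub0r normrN; apply: le_trans; exact: ler_norm.
have E2 : (expR (alpha * h n) - 1) * B <= e / 3.
  have : `|0 - (expR (alpha * h n) - 1) * B| <= e / 3 by near: n.
  by rewrite sub0r normrN; apply: le_trans; exact: ler_norm.
have ge0 y : 0 <= y -> 0 <= expR (alpha * y) - 1.
  by move=> y0; have /andP[+ _] := expR_sub1 (mulr_ge0 alpha0 y0); apply/le_trans/mulr_ge0.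
have R1 : `|remainder (h n) x - h n *: x| <= h n * (e / 3 + e / 3).
  apply: remainder_dist; [exact: ltW|by rewrite addr_ge0 ?ltW|].
  move=> r /andP[r0 rh].
  rewrite (_ : _ - x = (expR (alpha * (h n - r)) - 1) *: S r x + (S r x - x)); last first.
    by rewrite scalerBl scale1r addrA subrK.
  apply: le_trans (ler_normD _ _) _; apply: lerD.
    rewrite normrZ ger0_norm ?ge0 ?subr_ge0//; apply: le_trans E2; apply: ler_pM => //.
    + by rewrite ge0 ?subr_ge0.
    + by rewrite lerD2r ler_expR ler_wpM2l// lerBlDr lerDl.
    + have r1 : r <= 1 by exact: le_trans hn1.
      have := semigroup_bound_le c0_ge0 b0_ge0 S_bound x r0 r1.
      by rewrite mulr1.
  move: r0; rewrite le_eqVlt => /predU1P[<-|r0].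
    by rewrite S0 subrr normr0 ltW.
  rewrite distrC; apply: Hd => //=.
  by rewrite sub0r normrN gtr0_norm// (le_lt_trans rh).
have H1 : (h n)^-1 * `|remainder (h n) x - h n *: x| <= e / 3 + e / 3 by rewrite ler_pdivrMl.
have H2 : ((h n)^-1 * (expR (alpha * h n) - 1) - alpha) * `|U x| <= e / 3.
  apply: le_trans E1; rewrite mulrA (mulrC (expR _ - 1)) ler_wpM2r//.
have hi : 0 <= (h n)^-1 by rewrite invr_ge0 ltW.
have N1 := le_trans (ler_normB (((h n)^-1 * (expR (alpha * h n) - 1) - alpha) *: U x)
  ((h n)^-1 *: (remainder (h n) x - h n *: x))) (lerD _ _).
rewrite !normrZ (ger0_norm q0) (ger0_norm hi) in N1.
by rewrite distrC diffE//; apply: le_trans (N1 _ _ H2 H1) _; lra.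
Unshelve. all: by end_near. Qed.

End Resolvent.

(** * The entrance space and its completion *)

Section EntranceSpace.
Context {R : realType} (H : hilbertType R) (sepH : separable H) (T : R -> H -> H).
Hypothesis T_semigroup : strongly_continuous_semigroup T.
Variables (c0 b0 : R) (c0_ge0 : 0 <= c0) (b0_ge0 : 0 <= b0).
Hypothesis T_bound : forall t x, 0 <= t -> `|T t x| <= c0 * expR (b0 * t) * `|x|.
Variables (b : R) (b_gt : b0 < b).
Variables (Ht : hilbertType R) (ev : Ht -> R -> H).
Hypothesis Ht_entrance : is_entrance_space T b ev.
Notation mu := (@lebesgue_measure R).
Notation D := (`]0 : R, +oo[%classic).

Let mD : measurable (D : set (measurableTypeR R)). Proof. exact: measurable_itv. Qed.

Let DE s : D s = (0 < s) :> Prop.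
Proof. by rewrite /= in_itv/= andbT. Qed.

Lemma entrance_evD (c : R) x y s : 0 < s -> ev (c *: x + y) s = c *: ev x s + ev y s.
Proof. by case: Ht_entrance => _ _ + _; exact. Qed.

Lemma entrance_evB x y s : 0 < s -> ev (x - y) s = ev x s - ev y s.
Proof.
by move=> s0; rewrite addrC -scaleN1r entrance_evD// scaleN1r addrC.
Qed.

Lemma entrance_evZ (c : R) x s : 0 < s -> ev (c *: x) s = c *: ev x s.
Proof.
move=> s0; have e0 : ev 0 s = 0 by rewrite -(subrr x) entrance_evB// subrr.
by rewrite -[c *: x]addr0 entrance_evD// e0 addr0.
Qed.

Lemma entrance_path_ev x r t : 0 < r -> 0 < t -> ev x (r + t) = T t (ev x r).
Proof. by case: Ht_entrance => /(_ x)[+ _] _ _ _; exact. Qed.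

(** Nothing is known of a path at 0; near s it is the orbit of its value at s / 2. *)
Lemma entrance_path_continuous (p : R -> H) (s : R) (u : nat -> R) : entrance_path T p ->
  0 < s -> (forall n, 0 < u n) -> u n @[n --> \oo] --> s -> p (u n) @[n --> \oo] --> p s.
Proof.
move=> pe s0 u0 us; have s2 : 0 < s / 2 by rewrite divr_gt0.
have un : \forall n \near \oo, s / 2 < u n.
  move/cvgrPdist_lt : us => /(_ _ s2); apply: filterS => n.
  by rewrite ltr_distl => /andP[_]; lra.
have E t : s / 2 < t -> p t = T (t - s / 2) (p (s / 2)).
  by move=> st; rewrite -pe ?subr_gt0// addrC subrK.
rewrite E; last by lra.
have : T `|u n - s / 2| (p (s / 2)) @[n --> \oo] --> T (s - s / 2) (p (s / 2)).
  apply: (semigroup_continuous T_semigroup c0_ge0 b0_ge0 T_bound) => //; first by lra.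
  have -> : s - s / 2 = `|s - s / 2| by rewrite ger0_norm//; lra.
  by apply: cvg_norm; apply: cvgB => //; exact: cvg_cst.
apply: cvg_trans; apply: near_eq_cvg; near=> n.
have un' : s / 2 < u n by near: n.
by rewrite (E _ un') gtr0_norm// subr_gt0.
Unshelve. all: by end_near. Qed.

Lemma entrance_path_inner_measurable (p q : R -> H) :
  entrance_path T p -> entrance_path T q -> measurable_fun D (fun s => inner (p s) (q s)).
Proof.
move=> pe qe; apply: open_continuous_measurable_fun; first exact: interval_open.
move=> s; rewrite inE DE => s0; apply/(@cvg_nbhsP _ R^o) => u us.
(* A sequence tending to s > 0 may begin with nonpositive terms, where the values of a path are
   meaningless; those terms are replaced by s. *)
pose v n := if 0 < u n then u n else s.
have v0 n : 0 < v n by rewrite /v; case: ifP.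
have vu : \forall n \near \oo, u n = v n.
  move/cvgrPdist_lt : us => /(_ _ s0); apply: filterS => n.
  by rewrite ltr_norml => /andP[_ H0]; rewrite /v ifT//; lra.
have vs : v n @[n --> \oo] --> s by apply: cvg_trans us; exact: near_eq_cvg.
have : inner (p (v n)) (q (v n)) @[n --> \oo] --> inner (p s) (q s).
  by apply: cvg_inner; exact: entrance_path_continuous.
apply: cvg_trans; apply: near_eq_cvg; apply: filterS vu => n /= ->.
by [].
Qed.

Let evp x : entrance_path T (ev x). Proof. by case: Ht_entrance => /(_ x)[]. Qed.

Let weight (s : R) : R := expR (- (2 * b * s)).

(** Near 0 this is local square integrability. Beyond [l] the path is an orbit, whose square grows
    at most like e^(2 b0 s), and the weight wins because b > b0. The integrals in
    [is_entrance_space] are real-valued, with a default when infinite, so they carry information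
    only once this is known. *)
Lemma entrance_norm_integrable x :
  mu.-integrable D (EFin \o (fun s => weight s * `|ev x s| ^+ 2)).
Proof.
have mx : measurable_fun D (fun s => `|ev x s| ^+ 2).
  rewrite (_ : (fun _ => _) = fun s => inner (ev x s) (ev x s)).
    exact: entrance_path_inner_measurable.
  by apply/funext => s; rewrite inner_norm.
have mw : measurable_fun D weight.
  apply: measurable_funTS; apply: (measurableT_comp (@measurable_expR R)).
  by apply: measurable_funN; apply: measurable_funM => //; exact: measurable_cst.
have mwx : measurable_fun D (fun s => weight s * `|ev x s| ^+ 2) by exact: measurable_funM.
have [_ [l [l0 lfin]]] : entrance_path T (ev x) /\ locally_square_integrable (ev x).
  by case: Ht_entrance.
have k0 : 0 < 2 * (b - b0) by rewrite mulr_gt0// subr_gt0.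
pose M := c0 ^+ 2 * `|ev x l| ^+ 2.
pose h1 : R -> R := (fun s => `|ev x s| ^+ 2) \_ `]0, l]%classic.
pose h2 s := M * expR (- (2 * (b - b0) * s)).
have sub : `]0, l]%classic `<=` (D : set R).
  by move=> s; rewrite DE /= in_itv/= => /andP[].
have mI : measurable (`]0, l]%classic : set (measurableTypeR R)) by exact: measurable_itv.
have i1 : mu.-integrable D (EFin \o h1).
  have : mu.-integrable `]0, l]%classic (EFin \o (fun s => `|ev x s| ^+ 2)).
    by apply: integrable_real_lty => //; exact: measurable_funS mx.
  move=> H1; have := (@integrable_mkcond _ (measurableTypeR R) R mu _ (EFin \o (fun s => `|ev x s| ^+ 2)) mI).1 H1.
  move=> H2; have := integrableS measurableT mD (@subsetT _ _) H2.
  apply: eq_integrable => // s _ /=; rewrite /h1 !patchE; by case: ifP.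
have i2 : mu.-integrable D (EFin \o h2).
  apply: (integrable_realZ mD); apply: integrableS (integrable_expR_halfline k0) => //.
  by move=> s; rewrite DE /= in_itv/= andbT => /ltW.
apply: (integrable_real_le mD mwx _ (integrable_realD mD i1 i2)) => s; rewrite DE => s0.
rewrite ger0_norm ?mulr_ge0 ?expR_ge0//.
have h10 : 0 <= h1 s by rewrite /h1 patchE; case: ifP.
have M0 : 0 <= M by rewrite /M mulr_ge0 ?exprn_ge0.
have [sl|ls] := leP s l.
  have -> : h1 s = `|ev x s| ^+ 2 by rewrite /h1 patchE mem_set//= in_itv/= s0 sl.
  rewrite ler_wpDr ?mulr_ge0 ?expR_ge0// ler_piMl// /weight expR_le1 oppr_le0.
  by rewrite !mulr_ge0 ?ltW// (le_lt_trans b0_ge0).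
rewrite ler_wpDl// /h2 /M.
have -> : ev x s = T (s - l) (ev x l) by rewrite -entrance_path_ev ?subr_gt0// addrC subrK.
have sl0 : 0 <= s - l by rewrite subr_ge0 ltW.
have B := T_bound (ev x l) sl0.
have {}B : `|T (s - l) (ev x l)| ^+ 2 <= c0 ^+ 2 * `|ev x l| ^+ 2 * expR (2 * b0 * s).
  apply: (@le_trans _ _ ((c0 * expR (b0 * (s - l)) * `|ev x l|) ^+ 2)).
    by rewrite ler_pXn2r// nnegrE// !mulr_ge0 ?expR_ge0.
  rewrite !exprMn mulrAC ler_wpM2l ?mulr_ge0//.
  rewrite -expRM_natl ler_expR.
  have : 0 <= b0 * l by rewrite mulr_ge0// ltW.
  by lra.
apply: le_trans (ler_wpM2l (expR_ge0 _) B) _.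
rewrite mulrCA ler_wpM2l// -expRD ler_expR; lra.
Qed.

Lemma entrance_norm x :
  `|x| ^+ 2 = \int[mu]_(s in D) (weight s * `|ev x s| ^+ 2).
Proof.
case: Ht_entrance => _ _ _ E; rewrite -inner_norm E.
by apply: eq_Rintegral => s _; rewrite inner_norm.
Qed.

Lemma entrance_norm_le x z (C : R) : 0 <= C ->
  (forall s, 0 < s -> `|ev z s| <= C * `|ev x s|) -> `|z| <= C * `|x|.
Proof.
move=> C0 zx; rewrite -(@ler_pXn2r _ 2)// ?nnegrE ?mulr_ge0// exprMn !entrance_norm.
have ix := entrance_norm_integrable x; have iz := entrance_norm_integrable z.
rewrite -(RintegralZl _ mD ix); apply: le_Rintegral => //.
  exact: (integrable_realZ mD (C ^+ 2) ix).
move=> s; rewrite DE => s0; rewrite [leRHS]mulrCA -exprMn ler_wpM2l ?expR_ge0//.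
by rewrite ler_pXn2r// ?nnegrE ?mulr_ge0// zx.
Qed.

(** The comparison of norms with constant 0. *)
Lemma entrance_ext x y : (forall s, 0 < s -> ev x s = ev y s) -> x = y.
Proof.
move=> xy; apply/eqP; rewrite -subr_eq0 -normr_le0.
rewrite (le_trans (@entrance_norm_le x (x - y) 0 (lexx _) _)) ?mul0r// => s s0.
by rewrite entrance_evB// xy// subrr normr0 mul0r.
Qed.

(** Dominated convergence under the norm integral, with C^2 times the integrand of |x|^2 as
    majorant. *)
Lemma entrance_cvg0 (z : nat -> Ht) x (C : R) : 0 <= C ->
  (forall n s, 0 < s -> `|ev (z n) s| <= C * `|ev x s|) ->
  (forall s, 0 < s -> ev (z n) s @[n --> \oo] --> (0 : H)) ->
  z n @[n --> \oo] --> (0 : Ht).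
Proof.
move=> C0 zx zc; have ix := entrance_norm_integrable x.
have [||||_ + _] := @Rintegral_dominated _ _ _ mu D
  (fun n s => weight s * `|ev (z n) s| ^+ 2) (fun=> 0)
  (fun s => C ^+ 2 * (weight s * `|ev x s| ^+ 2)) mD.
- move=> n; have /integrableP[/measurable_EFinP] := entrance_norm_integrable (z n).
  by [].
- move=> s; rewrite DE => s0; rewrite -(mulr0 (weight s)); apply: cvgMr.
  rewrite -(mulr0 (0 : R)) -{1}(normr0 H) -{1}(normr0 H); under eq_fun do rewrite expr2.
  by apply: cvgM; apply: cvg_norm; exact: zc.
- exact: (integrable_realZ mD).
- move=> n s; rewrite DE => s0; rewrite ger0_norm ?mulr_ge0 ?expR_ge0//.
  rewrite [leRHS]mulrCA -exprMn ler_wpM2l ?expR_ge0//.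
  by rewrite ler_pXn2r// ?nnegrE ?mulr_ge0// zx.
under eq_fun do rewrite -entrance_norm.
rewrite (Rintegral_cst mu mD) mul0r => z2.
apply/cvgrPdist_le => e e0; move/cvgrPdist_le : z2 => /(_ (e ^+ 2)).
rewrite exprn_gt0// => /(_ isT); apply: filterS => n.
rewrite !sub0r !normrN normrX normr_id ler_pXn2r// nnegrE//; exact: ltW.
Qed.

(** Commutation with T makes the image of a path an entrance path, and boundedness keeps it locally
    square integrable. The resolvent is the operator of interest. *)
Lemma entrance_map_exists (B : H -> H) : bounded_operator B ->
  (forall t x, 0 <= t -> T t (B x) = B (T t x)) ->
  exists V : Ht -> Ht, forall x s, 0 < s -> ev (V x) s = B (ev x s).
Proof.
move=> bB BT; have [C C0 HC] := bound_of_bounded_operator bB.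
suff : forall x, exists z, forall s, 0 < s -> ev z s = B (ev x s).
  by move=> /choice[V HV]; exists V.
move=> x; case: (Ht_entrance) => _ + _ _; apply.
  by move=> r t r0 t0; rewrite entrance_path_ev// BT// ltW.
have pB : entrance_path T (fun s => B (ev x s)).
  by move=> r t r0 t0; rewrite entrance_path_ev// BT// ltW.
have [_ [l [l0 lfin]]] : entrance_path T (ev x) /\ locally_square_integrable (ev x).
  by case: Ht_entrance.
exists l; split=> //.
have sub : `]0, l]%classic `<=` (D : set R).
  by move=> s; rewrite DE /= in_itv/= => /andP[].
have mI : measurable (`]0, l]%classic : set (measurableTypeR R)) by exact: measurable_itv.
have sq (p : R -> H) : entrance_path T p -> measurable_fun `]0, l]%classic (fun s => `|p s| ^+ 2).
  move=> pp; apply: (measurable_funS _ sub) => //.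
  rewrite (_ : (fun _ => _) = fun s => inner (p s) (p s)).
    exact: entrance_path_inner_measurable.
  by apply/funext => s; rewrite inner_norm.
have i1 : mu.-integrable `]0, l]%classic (EFin \o (fun s => `|ev x s| ^+ 2)).
  by apply: integrable_real_lty => //; exact: sq.
have i2 : mu.-integrable `]0, l]%classic (EFin \o (fun s => `|B (ev x s)| ^+ 2)).
  apply: (integrable_real_le mI (sq _ pB) _ (integrable_realZ mI (C ^+ 2) i1)) => s _.
  by rewrite ger0_norm ?exprn_ge0// -exprMn ler_pXn2r// ?nnegrE ?mulr_ge0.
have /integrableP[_] := i2; apply: le_lt_trans; rewrite le_eqVlt; apply/orP; left; apply/eqP.
by apply: eq_integral => s _ /=; rewrite ger0_norm ?exprn_ge0.
Qed.

Variables (Tt : R -> Ht -> Ht).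
Hypothesis Tt_def : forall t x s, 0 <= t -> 0 < s -> ev (Tt t x) s = ev x (t + s).

Lemma entrance_shift_ev t x s : 0 <= t -> 0 < s -> ev (Tt t x) s = T t (ev x s).
Proof.
move=> t0 s0; rewrite Tt_def//; move: t0; rewrite le_eqVlt => /predU1P[<-|t0].
  by have [_ -> _ _] := T_semigroup; rewrite add0r.
by rewrite addrC entrance_path_ev.
Qed.

Lemma entrance_shift_bound t x : 0 <= t -> `|Tt t x| <= c0 * expR (b0 * t) * `|x|.
Proof.
move=> t0; apply: entrance_norm_le; first by rewrite mulr_ge0 ?expR_ge0.
by move=> s s0; rewrite entrance_shift_ev// T_bound.
Qed.

Lemma entrance_shift0 x : Tt 0 x = x.
Proof. by apply: entrance_ext => s s0; rewrite Tt_def// add0r. Qed.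

Lemma entrance_shiftD r t x : 0 <= r -> 0 <= t -> Tt (r + t) x = Tt r (Tt t x).
Proof.
move=> r0 t0; apply: entrance_ext => s s0; rewrite !Tt_def ?addr_ge0//.
  by rewrite addrA (addrC t).
by rewrite ltr_wpDl.
Qed.

Variables (J : H -> Ht).
Hypothesis J_def : forall x s, 0 < s -> ev (J x) s = T s x.

(** After a positive time the shift lands in the image of [H]. This links functionals of a whole
    path with functionals of its single value [ev x t]. *)
Lemma entrance_shift_embed t x : 0 < t -> Tt t x = J (ev x t).
Proof.
move=> t0; apply: entrance_ext => s s0; rewrite Tt_def// ?ltW// J_def//.
by rewrite entrance_path_ev.
Qed.

Lemma entrance_embed_linear : linear J.
Proof.
move=> c x y; apply: entrance_ext => s s0; rewrite entrance_evD// !J_def//.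
exact: (semigroup_linear T_semigroup (ltW s0)).
Qed.

Lemma entrance_embed_bounded : bounded_operator J.
Proof.
have k0 : 0 < 2 * (b - b0) by rewrite mulr_gt0// subr_gt0.
have i0 : mu.-integrable D (EFin \o (fun s => expR (- (2 * (b - b0) * s)))).
  apply: integrableS (integrable_expR_halfline k0) => //.
  by move=> s; rewrite DE /= in_itv/= andbT => /ltW.
pose C := \int[mu]_(s in D) expR (- (2 * (b - b0) * s)).
have C0 : 0 <= C by apply: Rintegral_ge0 => s _; exact: expR_ge0.
split; first exact: entrance_embed_linear.
apply: (@continuous_of_bound _ _ _ _ (c0 * Num.sqrt C)); first exact: entrance_embed_linear.
move=> x; rewrite -(@ler_pXn2r _ 2)// ?nnegrE ?mulr_ge0// ?sqrtr_ge0//.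
rewrite !exprMn sqr_sqrtr// entrance_norm mulrAC /C -(RintegralZl _ mD i0).
apply: le_Rintegral => //.
- exact: entrance_norm_integrable.
- exact: (integrable_realZ mD).
move=> s; rewrite DE => s0; rewrite J_def//.
have B := T_bound x (ltW s0).
have {}B : `|T s x| ^+ 2 <= c0 ^+ 2 * `|x| ^+ 2 * expR (2 * b0 * s).
  apply: (@le_trans _ _ ((c0 * expR (b0 * s) * `|x|) ^+ 2)).
    by rewrite ler_pXn2r// nnegrE// !mulr_ge0 ?expR_ge0.
  by rewrite !exprMn mulrAC ler_wpM2l ?mulr_ge0// -expRM_natl ler_expR mulrA.
apply: le_trans (ler_wpM2l (expR_ge0 _) B) _.
by rewrite mulrCA ler_wpM2l ?mulr_ge0// -expRD ler_expR; lra.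
Qed.

End EntranceSpace.

Lemma cvg_seq_at_right {R : realType} (V : normedModType R) (f : R -> V) (p : R) (l : V)
    (u : nat -> R) : (forall n, p < u n) -> f x @[x --> p^'+] --> l ->
  u n @[n --> \oo] --> p -> f (u n) @[n --> \oo] --> l.
Proof.
move=> pu fl up; apply: cvg_comp fl => A pA.
by have := up _ pA; apply: (@filterS _ \oo) => n; apply; exact: pu.
Qed.

(** * Differentiation of orbits *)

Section SemigroupCalculus.
Context {R : realType} (K : hilbertType R) (S : R -> K -> K).
Hypothesis S_semigroup : strongly_continuous_semigroup S.
Variables (c0 b0 : R) (c0_ge0 : 0 <= c0) (b0_ge0 : 0 <= b0).
Hypothesis S_bound : forall t x, 0 <= t -> `|S t x| <= c0 * expR (b0 * t) * `|x|.
Notation mu := (@lebesgue_measure R).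

(** The absolute value avoids negative times, so the function is continuous on the whole line, as
    the fundamental theorem of calculus is applied to it. *)
Lemma semigroup_inner_continuous (t : R) (x a : K) : continuous (fun v => inner (S `|t - v| x) a).
Proof.
move=> v; apply/(@cvg_nbhsP _ R^o) => u uv; apply: cvg_inner; last exact: cvg_cst.
apply: (semigroup_continuous S_semigroup c0_ge0 b0_ge0 S_bound) => //.
by apply: cvg_norm; apply: cvgB => //; exact: cvg_cst.
Qed.

Variables (x z : K).
Hypothesis x_gen : h^-1 *: (S h x - x) @[h --> 0^'+] --> z.

(** Factoring out the smaller time treats both signs of h at once: the two-sided derivative follows
    from the one-sided limit at 0 and joint continuity. *)
Lemma semigroup_quotient (tau h : R) : `|h| < tau -> h != 0 ->
  h^-1 *: (S tau x - S (tau - h) x) = S (Num.min tau (tau - h)) (`|h|^-1 *: (S `|h| x - x)).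
Proof.
move=> htau h0; have tau0 : 0 < tau by apply: le_lt_trans htau.
have [_ _ SD _] := S_semigroup.
have SL s : 0 <= s -> linear (S s) by exact: (semigroup_linear S_semigroup).
move: htau; rewrite ltr_norml => /andP[h1 h2].
have [hp|hn] : 0 < h \/ h < 0.
- by have [?|?|/eqP] := ltgtP 0 h; [left|right|rewrite eq_sym (negbTE h0)].
- rewrite (_ : Num.min _ _ = tau - h); last by rewrite minElt; case: ifP => //; lra.
  rewrite gtr0_norm// (linearZf _ _ (SL _ _)); last by lra.
  rewrite (linearBf _ _ (SL _ _)) -?SD ?subrK//; lra.
rewrite (_ : Num.min _ _ = tau); last by rewrite minElt; case: ifP => //; lra.
rewrite ltr0_norm// (linearZf _ _ (SL _ _)); last by lra.
rewrite (linearBf _ _ (SL _ _)) -?SD//; [|lra..].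
by rewrite invrN scaleNr -scalerN opprB.
Qed.

(** The derivative of v -> - <S_(t-v) x, a> is <S_(t-v) z, a>. It is computed for v < t only;
    continuity at the endpoints of [r, u] admits u = t. *)
Lemma semigroup_ftc (r u t : R) (a : K) : r <= u -> u <= t ->
  inner (S (t - r) x) a - inner (S (t - u) x) a =
  \int[mu]_(v in `]r, u]) inner (S (t - v) z) a.
Proof.
rewrite le_eqVlt => /predU1P[<-|ru] ut; first by rewrite subrr set_itvoc0 Rintegral_set0.
pose F v := - inner (S `|t - v| x) a.
pose f v := inner (S `|t - v| z) a.
have Fc : continuous F by move=> v; apply: cvgN; exact: semigroup_inner_continuous.
have fc : continuous f by exact: semigroup_inner_continuous.
have dF v : v < t -> h^-1 *: (F (h *: 1 + v) - F v) @[h --> 0^'] --> f v.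
  move=> vt; have tau0 : 0 < t - v by rewrite subr_gt0.
  apply/cvgr_dnbhsP => h [hn0 h0].
  have nh0 : `|h n| @[n --> \oo] --> 0 by rewrite -(normr0 R); exact: cvg_norm.
  rewrite /f gtr0_norm//.
  have : inner (S `|Num.min (t - v) (t - v - h n)| (`|h n|^-1 *: (S `|h n| x - x))) a
      @[n --> \oo] --> inner (S (t - v) z) a.
    apply: cvg_inner; last exact: cvg_cst.
    apply: (semigroup_continuous2 S_semigroup c0_ge0 b0_ge0 S_bound) => //.
    - exact: ltW.
    - apply: (@squeeze_norm _ R^o _ _ (fun n => `|h n|)) nh0 => n.
      have := ler_dist_dist (Num.min (t - v) (t - v - h n)) (t - v).
      rewrite (gtr0_norm tau0) => /le_trans; apply.
      by rewrite minElt; case: ifP => _; [rewrite subrr normr0|rewrite addrAC subrr add0r normrN].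
    - apply: cvg_seq_at_right x_gen nh0 => n; by rewrite normr_gt0.
  apply: cvg_trans; apply: near_eq_cvg.
  have [N _ HN] : \forall n \near \oo, `|h n| < t - v.
    by move/cvgrPdist_lt : nh0 => /(_ _ tau0); apply: filterS => n; rewrite sub0r normrN normr_id.
  exists N => // n /HN hn.
  have m0 : 0 <= Num.min (t - v) (t - v - h n).
    rewrite le_min ltW//= subr_ge0 ltW// (le_lt_trans _ hn)//; exact: ler_norm.
  rewrite ger0_norm// -semigroup_quotient// /F innerZl innerBl.
  have -> : t - (h n *: 1 + v) = t - v - h n by rewrite scaler1 opprD addrA addrAC.
  rewrite (gtr0_norm tau0) ger0_norm; last first.
    by rewrite subr_ge0 ltW// (le_lt_trans _ hn)// ler_norm.
  by congr (_ * _); rewrite opprK addrC.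
have DF : derivable_oo_LRcontinuous F r u.
  split.
  - move=> v; rewrite in_itv/= => /andP[_ vu].
    by apply: cvgP; apply: dF; exact: lt_le_trans ut.
  - exact/cvg_at_right_filter/Fc.
  - exact/cvg_at_left_filter/Fc.
have DE : {in `]r, u[, (F : R^o -> R^o)^`()%classic =1 f}.
  move=> v; rewrite in_itv/= => /andP[_ vu]; rewrite derive1E.
  by apply: cvg_lim => //; apply: dF; exact: lt_le_trans ut.
have := continuous_FTC2 ru (continuous_subspaceT fc) DF DE.
have mf : measurable_fun `]r, u]%classic f.
  by apply: measurable_funTS; exact: continuous_measurable_fun.
move=> E; transitivity (\int[mu]_(v in `]r, u]) f v).
  rewrite /Rintegral integral_itv_obnd_cbnd; last exact/measurable_EFinP.
  rewrite E /= /F !ger0_norm ?subr_ge0 ?(le_trans (ltW ru))//.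
  by rewrite opprK addrC.
apply: eq_Rintegral => v; rewrite inE /= in_itv/= => /andP[_ vu].
by rewrite /f ger0_norm// subr_ge0 (le_trans vu).
Qed.

End SemigroupCalculus.

(** * The extended semigroup and its generator on the entrance space *)

Section Extension.
Context {R : realType} (H : hilbertType R) (sepH : separable H) (T : R -> H -> H).
Hypothesis T_semigroup : strongly_continuous_semigroup T.
Variables (c0 b0 : R) (c0_ge0 : 0 <= c0) (b0_ge0 : 0 <= b0).
Hypothesis T_bound : forall t x, 0 <= t -> `|T t x| <= c0 * expR (b0 * t) * `|x|.
Variables (b : R) (b_gt : b0 < b) (Ht : hilbertType R) (ev : Ht -> R -> H).
Hypothesis Ht_entrance : is_entrance_space T b ev.
Variables (Tt : R -> Ht -> Ht).
Hypothesis Tt_def : forall t x s, 0 <= t -> 0 < s -> ev (Tt t x) s = ev x (t + s).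
Variables (alpha : R) (alpha_gt : b0 < alpha) (Hb : hilbertType R) (iota : Ht -> Hb).
Hypothesis Hb_completion : is_minus_completion T b alpha ev iota.
Variables (Tb : R -> Hb -> Hb).
Hypothesis Tb_bounded : forall t, 0 <= t -> bounded_operator (Tb t).
Hypothesis Tb_ext : forall t x, 0 <= t -> Tb t (iota x) = iota (Tt t x).
Notation U := (resolvent T alpha).

Let UL : linear U. Proof. exact: (resolvent_linear sepH T_semigroup c0_ge0 b0_ge0 T_bound alpha_gt). Qed.

Let UB : exists2 C, 0 <= C & forall x, `|U x| <= C * `|x|.
Proof. exact: (resolvent_bound sepH T_semigroup c0_ge0 b0_ge0 T_bound alpha_gt). Qed.

Let Vex : exists V : Ht -> Ht, forall x s, 0 < s -> ev (V x) s = U (ev x s).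
Proof.
apply: (entrance_map_exists T_semigroup c0_ge0 b0_ge0 T_bound Ht_entrance).
  by have [C _ HC] := UB; split=> //; exact: continuous_of_bound HC.
move=> t x t0; exact: (resolvent_commute sepH T_semigroup c0_ge0 b0_ge0 T_bound alpha_gt).
Qed.

Let V := sval (cid Vex).
Let V_ev x s : 0 < s -> ev (V x) s = U (ev x s). Proof. exact: svalP (cid Vex) x s. Qed.

Let evD := entrance_evD Ht_entrance.
Let evZ := entrance_evZ Ht_entrance.
Let evB := entrance_evB Ht_entrance.
Let ext := entrance_ext T_semigroup c0_ge0 b0_ge0 T_bound b_gt Ht_entrance.
Let Tt_ev := entrance_shift_ev T_semigroup Ht_entrance Tt_def.

Let VL : linear V.
Proof.
by move=> c x y; apply: ext => s s0; rewrite V_ev// !evD// !V_ev// UL.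
Qed.

Let iotaL : linear iota. Proof. by case: Hb_completion. Qed.

(* V applies the resolvent to each value of a path, so that iota is isometric to V. *)
Let iota_norm x : `|iota x| = `|V x|.
Proof.
apply/eqP; rewrite -(@eqrXn2 _ 2)//; apply/eqP; rewrite -!inner_norm.
have [_ _ ->] := Hb_completion; have [_ _ _ ->] := Ht_entrance.
by apply: eq_Rintegral => s; rewrite inE /= in_itv/= andbT => s0; rewrite V_ev.
Qed.

Let V_bound : exists2 C, 0 <= C & forall x, `|V x| <= C * `|x|.
Proof.
have [C C0 HC] := UB; exists C => // x.
apply: (entrance_norm_le T_semigroup c0_ge0 b0_ge0 T_bound b_gt Ht_entrance) => // s s0.
by rewrite V_ev.
Qed.

Lemma completion_embed_bounded : bounded_operator iota.
Proof.
have [C C0 HC] := V_bound; split=> //; apply: (@continuous_of_bound _ _ _ _ C) => // x.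
by rewrite iota_norm.
Qed.

(** [V] commutes with the shift, so the bound of the shift on [Ht] carries over, with the same
    constants, to the image of [iota], which is dense. *)
Lemma completion_bound t y : 0 <= t -> `|Tb t y| <= c0 * expR (b0 * t) * `|y|.
Proof.
move=> t0; have [_ dI _] := Hb_completion; have [_ Tc] := Tb_bounded t0.
apply: (@dense_le _ _ _ (fun y => `|Tb t y|) (fun y => c0 * expR (b0 * t) * `|y|) dI).
- by move=> x; apply: cvg_norm; exact: Tc.
- by move=> x; apply: cvgMr; apply: cvg_norm; exact: cvg_id.
move=> _ [x _ <-]; rewrite Tb_ext// !iota_norm.
have -> : V (Tt t x) = Tt t (V x).
  apply: ext => s s0; rewrite V_ev// !Tt_ev// V_ev//.
  by rewrite (resolvent_commute sepH T_semigroup c0_ge0 b0_ge0 T_bound alpha_gt).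
exact: (entrance_shift_bound T_semigroup c0_ge0 b0_ge0 T_bound b_gt Ht_entrance Tt_def).
Qed.

Let q h x := h^-1 *: (Tt h x - x).

Let q_iota h x : 0 < h -> iota (q h x) = h^-1 *: (Tb h (iota x) - iota x).
Proof. by move=> h0; rewrite (linearZf _ _ iotaL) (linearBf _ _ iotaL) Tb_ext// ltW. Qed.

(** The counterpart of the generator under the isometry: formally V A = alpha V - 1, and |A x| = |W
    x| is proved below. *)
Let W x := alpha *: V x - x.

(** At each s > 0 this is the limit of the resolvent quotient at [ev x s];
    [resolvent_quotient_bound] provides the domination needed to conclude in the norm of [Ht]. *)
Let Vq_cvg x : V (q h x) @[h --> 0^'+] --> W x.
Proof.
have [CU CU0 HCU] := UB.
have [C C0 HC] := resolvent_quotient_bound sepH T_semigroup c0_ge0 b0_ge0 T_bound alpha_gt.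
have ev_q h s : 0 < h -> 0 < s ->
    ev (V (q h x)) s = h^-1 *: (T h (U (ev x s)) - U (ev x s)).
  move=> h0 s0; rewrite V_ev// /q evZ// evB// Tt_ev ?ltW//.
  rewrite (linearZf _ _ UL) (linearBf _ _ UL).
  by rewrite (resolvent_commute sepH T_semigroup c0_ge0 b0_ge0 T_bound alpha_gt)// ltW.
have ev_W s : 0 < s -> ev (W x) s = alpha *: U (ev x s) - ev x s.
  by move=> s0; rewrite /W evB// evZ// V_ev.
apply: cvg_at_right_of_seq => u u0 uc.
(* The uniform bound holds for h <= 1; the truncation eventually has no effect. *)
pose h n := Num.min (u n) 1.
have h0 n : 0 < h n by rewrite /h lt_min u0 ltr01.
have h1 n : h n <= 1 by rewrite /h ge_min lexx orbT.
have hc : h n @[n --> \oo] --> 0.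
  apply: (@squeeze_norm _ R^o _ _ u) uc => n.
  by rewrite subr0 gtr0_norm// /h ge_min lexx.
have : V (q (h n) x) - W x @[n --> \oo] --> (0 : Ht).
  apply: (entrance_cvg0 T_semigroup c0_ge0 b0_ge0 T_bound b_gt Ht_entrance
    (x := x) (C := C + (`|alpha| * CU + 1))).
  - by rewrite !addr_ge0// mulr_ge0.
  - move=> n s s0; rewrite evB// ev_q// ev_W// mulrDl.
    apply: le_trans (ler_normB _ _) _; apply: lerD; first exact: HC.
    apply: le_trans (ler_normB _ _) _; rewrite mulrDl mul1r lerD2r normrZ -mulrA.
    by rewrite ler_wpM2l.
  - move=> s s0; rewrite -(subrr (ev (W x) s)); under eq_fun do rewrite evB//.
    apply: cvgB; last exact: cvg_cst.
    under eq_fun do rewrite ev_q//; rewrite ev_W//.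
    exact: (resolvent_quotient_cvg sepH T_semigroup c0_ge0 b0_ge0 T_bound alpha_gt).
move=> /subr_cvg0; apply: cvg_trans; apply: near_eq_cvg.
move/cvgrPdist_lt : uc => /(_ _ ltr01); apply: filterS => n.
rewrite sub0r normrN gtr0_norm// => un; congr (V (q _ x)).
by rewrite /h min_l// ltW.
Qed.

(** The quotients are Cauchy in [Hb] because their images under [V] converge in [Ht]. So on [iota x]
    the [lim] in [generator] is a genuine limit. *)
Lemma completion_generator_cvg x :
  h^-1 *: (Tb h (iota x) - iota x) @[h --> 0^'+] --> generator Tb (iota x).
Proof.
suff c : cvg (h^-1 *: (Tb h (iota x) - iota x) @[h --> 0^'+]) by exact: c.
apply: cvg_cauchy_filter => e e0.
have e2 : 0 < e / 2 by rewrite divr_gt0.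
have n1 : \forall h \near 0^'+, `|W x - V (q h x)| < e / 2.
  by move/cvgrPdist_lt : (@Vq_cvg x); exact.
have n2 : \forall h \near (0 : R)^'+, 0 < h by exact: nbhs_right_gt.
have [h0 [H1 H0]] := filter_ex (filterI n1 n2).
exists (iota (q h0 x)); near=> h.
have h_gt : 0 < h by near: h.
rewrite -q_iota// -(linearBf _ _ iotaL) iota_norm (linearBf _ _ VL).
rewrite (_ : _ - _ = (W x - V (q h x)) - (W x - V (q h0 x))); last first.
  by rewrite opprB [RHS]addrC subrKA.
apply: le_lt_trans (ler_normB _ _) _.
have H2 : `|W x - V (q h x)| < e / 2 by near: h.
by rewrite (splitr e) ltrD.
Unshelve. all: by end_near. Qed.

Let Ab x := generator Tb (iota x).

Let q_cvg x : iota (q h x) @[h --> 0^'+] --> Ab x.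
Proof.
have := @completion_generator_cvg x; apply: cvg_trans; apply: near_eq_cvg.
near=> h; rewrite q_iota//; near: h; exact: nbhs_right_gt.
Unshelve. all: by end_near. Qed.

Lemma completion_generator_bounded : bounded_operator (fun x => generator Tb (iota x)).
Proof.
have L : linear Ab.
  move=> c x y.
  have H1 : c *: iota (q h x) + iota (q h y) @[h --> 0^'+] --> c *: Ab x + Ab y.
    by apply: cvgD => //; apply: cvgZr.
  apply: (@cvg_unique _ (@norm_hausdorff _ _) _ _ _ _ (@q_cvg _) _).
  move: H1; apply: cvg_trans; apply: near_eq_cvg.
  near=> h; have h0 : 0 <= h by rewrite ltW.
  rewrite -iotaL /q; congr (iota _).
  rewrite (_ : Tt h (c *: x + y) = c *: Tt h x + Tt h y); last first.
    apply: ext => s s0; rewrite Tt_ev// !evD// !Tt_ev//.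
    exact: (semigroup_linear T_semigroup).
  rewrite scalerA mulrC -scalerA -scalerDr; congr (_ *: _).
  by rewrite scalerBr opprD addrACA.
split=> //; have [C C0 HC] := V_bound.
apply: (@continuous_of_bound _ _ _ _ (`|alpha| * C + 1)) => // x.
(* Both are limits of the same numbers |iota (q h x)| = |V (q h x)|. *)
have -> : `|Ab x| = `|W x|.
  have H1 : `|iota (q h x)| @[h --> 0^'+] --> `|Ab x| by apply: cvg_norm.
  have H2 : `|V (q h x)| @[h --> 0^'+] --> `|W x| by apply: cvg_norm; exact: Vq_cvg.
  apply: (@cvg_unique R (@norm_hausdorff _ R^o) _ _ _ _ H1).
  by move: H2; under eq_fun do rewrite -iota_norm.
apply: le_trans (ler_normB _ _) _; rewrite mulrDl mul1r lerD2r normrZ -mulrA.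
by rewrite ler_wpM2l.
Unshelve. all: by end_near. Qed.

Lemma completion_semigroup : strongly_continuous_semigroup Tb.
Proof.
have [_ dI _] := Hb_completion.
have Tc t : 0 <= t -> continuous (Tb t) by move=> /Tb_bounded[].
split=> //.
- move=> x; apply: (dense_eq dI) => //; first exact: Tc.
    by move=> y; exact: cvg_id.
  move=> _ [y _ <-]; rewrite Tb_ext//.
  by rewrite (entrance_shift0 T_semigroup c0_ge0 b0_ge0 T_bound b_gt Ht_entrance Tt_def).
- move=> r t x r0 t0; move: x; apply: (dense_eq dI).
  + exact/Tc/addr_ge0.
  + by move=> x; apply: continuous_comp; exact: Tc.
  move=> _ [y _ <-]; rewrite !Tb_ext ?addr_ge0//.
  by rewrite (entrance_shiftD T_semigroup c0_ge0 b0_ge0 T_bound b_gt Ht_entrance Tt_def).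
move=> y; apply/cvgrPdist_lt => e e0.
(* [M] bounds [Tb h] for 0 <= h <= 1. A nearby point of the dense image costs at most (M + 1) de = e
   / 2. *)
pose M := c0 * expR b0; have M0 : 0 <= M by rewrite mulr_ge0 ?expR_ge0.
pose de := e / 2 / (M + 1); have de0 : 0 < de by rewrite !divr_gt0// ltr_wpDl.
have [y' [Hz [z _ zE]]] := dI (ball y de) (ex_intro _ y (ballxx _ de0)) (ball_open _ _).
have zy : `|y - iota z| < de by rewrite zE; move: Hz; rewrite -ball_normE.
(* On the image of [iota], differentiability at 0 gives continuity there: the increment is h times
   its quotient. *)
have zc : h *: (h^-1 *: (Tb h (iota z) - iota z)) @[h --> 0^'+] --> 0 *: generator Tb (iota z).
  apply: cvgZ; last exact: completion_generator_cvg.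
  by apply: cvg_at_right_filter; exact: cvg_id.
have e2 : 0 < e / 2 by rewrite divr_gt0.
rewrite scale0r in zc; move/cvgrPdist_lt : zc => /(_ _ e2) zc.
near=> h; have h0 : 0 < h by [].
have h1 : h <= 1 by near: h; apply: nbhs_right_le.
have : `|0 - h *: (h^-1 *: (Tb h (iota z) - iota z))| < e / 2 by near: h.
rewrite sub0r normrN scalerA divff ?gt_eqF// scale1r => Hz'.
rewrite (_ : _ - _ = (y - iota z) - Tb h (y - iota z) - (Tb h (iota z) - iota z)); last first.
  by rewrite (linearBf _ _ (Tb_bounded (ltW h0)).1) !opprB addrAC subrKA subrKA.
apply: le_lt_trans (ler_normB _ _) _; rewrite (splitr e) ltr_leD//; last exact: ltW.
apply: lt_le_trans (_ : (M + 1) * de <= _); last by rewrite /de mulrC divfK// gt_eqF// ltr_wpDl.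
apply: le_lt_trans (ler_normB _ _) _; rewrite mulrDl mul1r addrC.
apply: ler_ltD => //; apply: le_trans (completion_bound _ (ltW h0)) _.
apply: ler_pM => //; rewrite ?mulr_ge0 ?expR_ge0//; last exact: ltW.
by rewrite ler_wpM2l// ler_expR ler_piMr.
Unshelve. all: by end_near. Qed.

Lemma completion_ftc (x : Ht) (r u t : R) (a : Hb) : r <= u -> u <= t ->
  inner (Tb (t - r) (iota x)) a - inner (Tb (t - u) (iota x)) a =
  \int[@lebesgue_measure R]_(v in `]r, u]) inner (Tb (t - v) (generator Tb (iota x))) a.
Proof.
apply: (semigroup_ftc completion_semigroup c0_ge0 b0_ge0 completion_bound).
exact: completion_generator_cvg.
Qed.

End Extension.

Lemma dense_range_separable {R : realType} (V K : hilbertType R) (f : V -> K) :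
  separable V -> continuous f -> dense (range f) -> separable K.
Proof.
move=> [D [cD dD]] fc df; exists (f @` D); split; first exact: card_le_trans (card_image_le _ _) cD.
move=> O O0 oO; have [y [Oy [x _ xy]]] := df O O0 oO.
have oP : open (f @^-1` O) by apply: open_comp => // z _; exact: fc.
have [x' [Ox' Dx']] := dD (f @^-1` O) (ex_intro _ x (eq_ind_r O Oy xy)) oP.
by exists (f x'); split=> //; exists x'.
Qed.

Lemma cadlag_seq {R : realType} (V : normedModType R) (y : R -> V) (s : R) (u : nat -> R) :
  cadlag y -> 0 <= s -> (forall n, s <= u n) -> u n @[n --> \oo] --> s ->
  y (u n) @[n --> \oo] --> y s.
Proof. by move=> [yr _] s0; apply: cvg_seq_right; exact: yr. Qed.

(** Right and left limits bound the path near every point, and compactness of [0, t] makes the bound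
    uniform. *)
Lemma cadlag_bounded {R : realType} (V : normedModType R) (y : R -> V) (t : R) :
  cadlag y -> exists2 M : R, 0 <= M & forall s, 0 <= s -> s <= t -> `|y s| <= M.
Proof.
move=> [yr yl].
have loc (x : R) : 0 <= x -> exists M : R, \forall s \near x, 0 <= s -> `|y s| <= M.
  move=> x0.
  have r : \forall s \near x^'+, `|y s| <= `|y x| + 1.
    have /cvgrPdist_le/(_ _ ltr01) := yr _ x0; apply: filterS => s ys.
    rewrite -lerBlDl; apply: le_trans ys; rewrite distrC; exact: lerB_dist.
  have [Ml l] : exists Ml : R, \forall s \near x^'-, 0 <= s -> `|y s| <= Ml.
    (* At 0 no left limit is given, but the bound concerns s >= 0 only and is vacuous to the left of
       0. *)
    move: x0; rewrite le_eqVlt => /predU1P[<-|x0].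
      by exists 0; near=> s => s0; exfalso; move: s0; apply/negP; rewrite -ltNge.
    move/cvg_ex : (yl _ x0) => [lim lv].
    exists (`|lim| + 1); have /cvgrPdist_le/(_ _ ltr01) := lv; apply: filterS => s ys _.
    rewrite -lerBlDl; apply: le_trans ys; rewrite distrC; exact: lerB_dist.
  pose M := Num.max (`|y x| + 1) Ml; exists M.
  move: r l; rewrite !near_withinE => r l; near=> s => s0.
  have [sx|sx|->] := ltgtP s x.
  - rewrite le_max; apply/orP; right; move: sx s0; near: s; exact: l.
  - rewrite le_max; apply/orP; left; move: sx; near: s; exact: r.
  - by rewrite le_max lerDl ler01.
have /compact_near_coveringP cpt := @segment_compact R 0 t.
have : \forall M \near +oo, `[0, t]%classic `<=` [set s | 0 <= s -> `|y s| <= M].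
  apply: (cpt R +oo (fun M s => 0 <= s -> `|y s| <= M)) => x /=; rewrite in_itv/= => /andP[x0 _].
  have [M HM] := loc _ x0.
  exists ([set s | 0 <= s -> `|y s| <= M], [set N | M <= N]).
    by split=> /=; [exact: HM|apply: nbhs_pinfty_ge; exact: num_real].
  by move=> [s N] /= [Hs MN] s0; exact: le_trans (Hs s0) MN.
move=> H; have [M [M0 HM]] := filter_ex (filterI (nbhs_pinfty_ge (num_real 0)) H).
by exists M => // s s0 st; apply: HM => //=; rewrite in_itv/= s0.
Unshelve. all: by end_near. Qed.

Lemma Rintegral_itv_le {R : realType} (r s M : R) (f : R -> R) : r <= s -> 0 <= M ->
  (@lebesgue_measure R).-integrable `]r, s]%classic (EFin \o f) ->
  (forall v, `]r, s]%classic v -> `|f v| <= M) ->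
  `|\int[@lebesgue_measure R]_(v in `]r, s]) f v| <= M * (s - r).
Proof.
move=> rs M0 i fM.
have mI : measurable (`]r, s]%classic : set (measurableTypeR R)) by exact: measurable_itv.
apply: le_trans (le_normr_Rintegral mI i) _.
have -> : M * (s - r) = \int[@lebesgue_measure R]_(v in `]r, s]) M.
  have L := lebesgue_measure_itv `]r, s]; rewrite /= lte_fin in L.
  transitivity (M * fine (@lebesgue_measure R `]r, s]%classic)).
    by rewrite L; move: rs; rewrite le_eqVlt => /predU1P[->|->]; rewrite ?ltxx ?subrr.
  by apply/esym; exact: (Rintegral_cst (@lebesgue_measure R) mI).
apply: le_Rintegral => //; last first.
  apply: (bounded_integrable (M := M)) => //; rewrite ?lebesgue_itv_lty// => v _.
  by rewrite ger0_norm.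
by have := integrable_norm i.
Qed.

(** * Paths of the mild solution *)

Section MildPaths.
Context {R : realType} (V K : hilbertType R) (sepK : separable K) (S : R -> K -> K).
Hypothesis S_semigroup : strongly_continuous_semigroup S.
Variables (c0 b0 : R) (c0_ge0 : 0 <= c0) (b0_ge0 : 0 <= b0).
Hypothesis S_bound : forall t x, 0 <= t -> `|S t x| <= c0 * expR (b0 * t) * `|x|.
Notation mu := (@lebesgue_measure R).
Variables (A : V -> K).
Hypothesis A_bounded : bounded_operator A.

Definition mild_integral (y : R -> V) (t : R) : K :=
  bochner_integral mu `[0, t]%classic (fun s => S (t - s) (A (y s))).

Section Path.
Variables (y : R -> V) (y_cadlag : cadlag y).

Let bound t : exists2 M : R, 0 <= M & forall r s, 0 <= r -> r <= s -> s <= t ->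
  `|S (s - r) (A (y r))| <= M.
Proof.
have [M M0 HM] := cadlag_bounded t y_cadlag.
have [C C0 HC] := bound_of_bounded_operator A_bounded.
exists (c0 * expR (b0 * t) * (C * M)); first by rewrite !mulr_ge0 ?expR_ge0.
move=> r s r0 rs st.
have le_st : s - r <= t by lra.
apply: (@le_trans _ _ (c0 * expR (b0 * t) * `|A (y r)|)).
  by apply: (semigroup_bound_le c0_ge0 b0_ge0 S_bound) => //; rewrite subr_ge0.
rewrite ler_wpM2l ?mulr_ge0 ?expR_ge0//; apply: le_trans (HC _) _.
by rewrite ler_wpM2l// HM// (le_trans rs).
Qed.

Lemma mild_integrable t : 0 <= t ->
  bochner_integrable mu `[0, t]%classic (fun s => S (t - s) (A (y s))).
Proof.
move=> t0; have [M M0 HM] := bound t.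
apply: (@bochner_right_continuous_segment _ _ _ _ M sepK t0); last first.
  by move=> x /=; rewrite in_itv/= => /andP[x0 xt]; exact: HM.
move=> x; rewrite /= in_itv/= => /andP[x0 xt] u Hu ux.
have u0 n : 0 <= t - u n by have [_ /=] := Hu n; rewrite in_itv/= subr_ge0 => /andP[].
apply: (semigroup_continuous2 S_semigroup c0_ge0 b0_ge0 S_bound) => //.
- by rewrite subr_ge0.
- by apply: cvgB => //; exact: cvg_cst.
apply: (@cvg_comp _ _ _ _ A _ (nbhs (y x))); last exact: A_bounded.2.
by apply: (cadlag_seq y_cadlag) => // n; have [] := Hu n.
Qed.

Lemma mild_weak t a : 0 <= t ->
  mu.-integrable `[0, t]%classic (EFin \o (fun s => inner (S (t - s) (A (y s))) a)) /\
  inner (mild_integral y t) a = \int[mu]_(s in `[0, t]) inner (S (t - s) (A (y s))) a.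
Proof.
move=> t0; apply: (bochner_weak sepK _ (bochner_integralP (mild_integrable t0))).
exact: (measurable_itv _ : measurable (`[0, t]%classic : set (measurableTypeR R))).
Qed.

(** By the semigroup law, [S (t - s)] maps the integral up to s to the part over [0, s] of the
    integral up to t. *)
Lemma mild_shift (s t : R) (a : K) : 0 <= s -> s <= t ->
  inner (mild_integral y t) a - inner (S (t - s) (mild_integral y s)) a =
  \int[mu]_(v in `]s, t]) inner (S (t - v) (A (y v))) a.
Proof.
move=> s0 st; have t0 := le_trans s0 st; have ts : 0 <= t - s by rewrite subr_ge0.
have [Sb _ SD _] := S_semigroup; have [g Hg] := adjoint_exists (Sb _ ts).
rewrite Hg; have [it ->] := mild_weak a t0; have [_ ->] := mild_weak (g a) s0.
rewrite -(Rintegral_itvB it) ?bnd_simp//; congr (_ - _).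
apply: eq_Rintegral => v; rewrite inE /= in_itv/= => /andP[v0 vs].
by rewrite -Hg -SD ?subr_ge0// addrA subrK.
Qed.

Lemma mild_dist t : exists2 M : R, 0 <= M & forall r s, 0 <= r -> r <= s -> s <= t ->
  `|mild_integral y s - S (s - r) (mild_integral y r)| <= M * (s - r).
Proof.
have [M M0 HM] := bound t; exists M => // r s r0 rs st.
have sr0 : 0 <= s - r by rewrite subr_ge0.
apply: norm_le_inner => [|a]; first by rewrite mulr_ge0.
rewrite innerBl mild_shift//.
have mI : measurable (`]r, s]%classic : set (measurableTypeR R)) by exact: measurable_itv.
have [i _] := mild_weak a (le_trans r0 rs).
have {}i : mu.-integrable `]r, s]%classic (EFin \o (fun v => inner (S (s - v) (A (y v))) a)).
  apply: integrableS i => // v /=; rewrite !in_itv/= => /andP[rv ->].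
  by rewrite (le_trans r0 (ltW rv)).
apply: le_trans (ler_norm _) _; rewrite mulrAC.
apply: Rintegral_itv_le => // [|v]; first by rewrite mulr_ge0.
rewrite /= in_itv/= => /andP[rv vs]; apply: le_trans (inner_le_norm _ _) _.
by rewrite ler_wpM2r// HM// (le_trans r0 (ltW rv)).
Qed.

(* For the left limits no equicontinuity of S is available: one compares both values
   with the orbit issued from a fixed earlier time. *)
Lemma mild_cadlag : cadlag (mild_integral y).
Proof.
split=> t t0.
  have [M M0 HM] := mild_dist (t + 1).
  apply: cvg_at_right_of_seq => u ut uc.
  have su : S `|u n - t| (mild_integral y t) @[n --> \oo] --> mild_integral y t.
    apply: (semigroup_cvg0 S_semigroup) => //; rewrite -(normr0 R) -(subrr t).
    by apply: cvg_norm; apply: cvgB => //; exact: cvg_cst.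
  have mu0 : M * (u n - t) @[n --> \oo] --> 0.
    by rewrite -(mulr0 M) -(subrr t); apply: cvgMr; apply: cvgB => //; exact: cvg_cst.
  apply/cvgrPdist_le => e e0; have e2 : 0 < e / 2 by rewrite divr_gt0.
  near=> n; have un : t < u n by [].
  rewrite (_ : _ - _ = (mild_integral y t - S (u n - t) (mild_integral y t)) -
    (mild_integral y (u n) - S (u n - t) (mild_integral y t))); last by rewrite opprB subrKA.
  apply: le_trans (ler_normB _ _) _; rewrite (splitr e); apply: lerD.
    rewrite -[u n - t]gtr0_norm ?subr_gt0//; near: n.
    by move/cvgrPdist_le : su; apply.
  apply: le_trans (HM _ _ t0 (ltW un) _) _.
    have : `|t - u n| <= 1 by near: n; move/cvgrPdist_le : uc; apply.
    by rewrite ler_norml; lra.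
  apply: le_trans (ler_norm _) _; rewrite -normrN -sub0r; near: n.
  by move/cvgrPdist_le : mu0; apply.
suff H : mild_integral y s @[s --> t^'-] --> mild_integral y t by apply/cvg_ex; exists (mild_integral y t).
have [M M0 HM] := mild_dist t.
apply: cvg_at_left_of_seq => u ut uc; apply/cvgrPdist_le => e e0.
(* e / 4 for each of the two distances to the orbit of [Z] and e / 2 for the continuity of that
   orbit; s is cut off at 0. *)
pose de := e / 4 / (M + 1); have de0 : 0 < de by rewrite !divr_gt0// ltr_wpDl.
pose s := Num.max 0 (t - de).
have s0 : 0 <= s by rewrite /s le_max lexx.
have st : s < t by rewrite /s gt_max t0 ltrBlDr ltrDl.
have sde : M * (t - s) <= e / 4.
  apply: (@le_trans _ _ ((M + 1) * de)); last by rewrite /de mulrC divfK// gt_eqF// ltr_wpDl.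
  apply: ler_pM => //; [by rewrite subr_ge0 ltW|by rewrite lerDl|].
  by rewrite lerBlDr -lerBlDl /s le_max lexx orbT.
pose Z := mild_integral y s.
have su : S `|u n - s| Z @[n --> \oo] --> S (t - s) Z.
  apply: (semigroup_continuous S_semigroup c0_ge0 b0_ge0 S_bound) => //; first by rewrite subr_ge0 ltW.
  have -> : t - s = `|t - s| by rewrite gtr0_norm ?subr_gt0.
  by apply: cvg_norm; apply: cvgB => //; exact: cvg_cst.
have e2 : 0 < e / 2 by rewrite divr_gt0.
have ts0 : 0 < t - s by rewrite subr_gt0.
near=> n; have un : u n < t by [].
have sn : s < u n.
  have : `|t - u n| < t - s by near: n; move/cvgrPdist_lt : uc; apply.
  by rewrite ltr_norml; lra.
rewrite (_ : _ - _ = (mild_integral y t - S (t - s) Z) - (mild_integral y (u n) - S (u n - s) Z) +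
  (S (t - s) Z - S (u n - s) Z)); last first.
  by rewrite opprB addrAC !subrKA.
apply: le_trans (ler_normD _ _) _; rewrite (splitr e); apply: lerD; last first.
  rewrite -[u n - s]gtr0_norm ?subr_gt0//; near: n.
  by move/cvgrPdist_le : su; apply.
apply: le_trans (ler_normB _ _) _.
have H1 := HM s t s0 (ltW st) (lexx _).
have H2 := HM s (u n) s0 (ltW sn) (ltW un).
have H3 : M * (u n - s) <= M * (t - s) by rewrite ler_wpM2l// lerD2r ltW.
lra.
Unshelve. all: by end_near. Qed.

Variables (iota : V -> K).
Hypothesis iota_bounded : bounded_operator iota.
Hypothesis ftc : forall (x : V) (r u t : R) (a : K), r <= u -> u <= t ->
  inner (S (t - r) (iota x)) a - inner (S (t - u) (iota x)) a =
  \int[mu]_(v in `]r, u]) inner (S (t - v) (A x)) a.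

Definition mild_solution (x0 : K) (z : R -> V) (t : R) : K :=
  S t x0 + iota (z t) + mild_integral z t.

Lemma mild_solution_cadlag x0 : cadlag (mild_solution x0 y).
Proof.
have [yr yl] := y_cadlag; have [mr ml] := mild_cadlag.
have Sc (t : R) : 0 <= t -> forall u : nat -> R, (forall n, 0 <= u n) -> u n @[n --> \oo] --> t ->
    S (u n) x0 @[n --> \oo] --> S t x0.
  by move=> t0 u u0; exact: (semigroup_continuous S_semigroup c0_ge0 b0_ge0 S_bound).
split=> t t0.
  apply: cvgD; last exact: mr.
  apply: cvgD.
    by apply: cvg_at_right_of_seq => u ut; apply: Sc => // n; exact: le_trans (ltW (ut n)).
  by apply: (@cvg_comp _ _ _ _ iota _ (nbhs (y t))); [exact: yr|exact: iota_bounded.2].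
move/cvg_ex : (yl _ t0) => [l1 y1]; move/cvg_ex : (ml _ t0) => [l2 y2].
apply/cvg_ex; exists (S t x0 + iota l1 + l2).
apply: cvgD => //; apply: cvgD.
  apply: cvg_at_left_of_seq => u ut uc.
  have c : S `|u n| x0 @[n --> \oo] --> S t x0.
    by apply: Sc => //; [exact: ltW|rewrite -(gtr0_norm t0); exact: cvg_norm].
  apply: cvg_trans c; apply: near_eq_cvg; move/cvgrPdist_lt : uc => /(_ _ t0).
  by apply: filterS => n; rewrite ltr_norml => H; rewrite gtr0_norm//; lra.
by apply: (@cvg_comp _ _ _ _ iota _ (nbhs l1)) => //; exact: iota_bounded.2.
Qed.

(* Summation by parts turns the increments of the mild solution into Riemann sums. *)
Lemma mild_solution_increment x0 (k : R -> K -> V) (s t : R) (a : K) :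
  (forall u b x, 0 <= u -> inner (S u (iota x)) b = inner x (k u b)) ->
  0 <= s -> s <= t ->
  \sum_(j < n.+1)
    inner (y (gridpt s ((t - s) / n.+1%:R) j.+1) - y (gridpt s ((t - s) / n.+1%:R) j))
      (k (t - gridpt s ((t - s) / n.+1%:R) j) a) @[n --> \oo] -->
  inner (mild_solution x0 y t) a - inner (S (t - s) (mild_solution x0 y s)) a.
Proof.
move=> Hk s0 st; have [Sb S0 SD _] := S_semigroup.
have ts0 : 0 <= t - s by rewrite subr_ge0.
pose G u v := inner (S (t - u) (iota (y v))) a.
pose g v x := inner (S (t - v) (A (y x))) a.
pose dl n : R := (t - s) / n.+1%:R.
have dl0 n : 0 <= dl n by rewrite divr_ge0.
have ge n j : (j <= n.+1)%N -> gridpt s (dl n) j <= t.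
  by move=> jn; rewrite -[leRHS](gridpt_end s t n); exact: gridpt_le.
have gS n j : gridpt s (dl n) j <= gridpt s (dl n) j.+1 by exact: gridpt_le.
have [M M0 HM] := bound t.
have gb v x : `]s, t]%classic v -> `]s, t]%classic x -> `|g v x| <= (c0 * expR (b0 * t) * M) * `|a|.
  rewrite /= !in_itv/= => /andP[sv vt] /andP[sx xt].
  apply: le_trans (inner_le_norm _ _) _; rewrite ler_wpM2r//.
  have le_vt : t - v <= t by lra.
  apply: (@le_trans _ _ (c0 * expR (b0 * t) * `|A (y x)|)).
    by apply: (semigroup_bound_le c0_ge0 b0_ge0 S_bound) => //; rewrite subr_ge0.
  rewrite ler_wpM2l ?mulr_ge0 ?expR_ge0//.
  have x0' : 0 <= x by apply: le_trans (ltW sx).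
  by have := HM x x x0' (lexx _) xt; rewrite subrr S0.
have [||_ Hr] := @riemann_cvg _ s t g _ st _ gb.
- move=> x _; apply: (@eq_measurable_fun _ _ (measurableTypeR R) _ _ (fun v => inner (S `|t - v| (A (y x))) a)).
    by move=> v; rewrite inE /= in_itv/= => /andP[_ vt]; rewrite /g ger0_norm// subr_ge0.
  apply: measurable_funTS; apply: continuous_measurable_fun.
  exact: (semigroup_inner_continuous S_semigroup c0_ge0 b0_ge0 S_bound).
- move=> v; rewrite /= in_itv/= => /andP[sv vt] x; rewrite /= in_itv/= => /andP[sx xt] u Hu ux.
  apply: cvg_inner; last exact: cvg_cst.
  apply: (semigroup_continuous2 S_semigroup c0_ge0 b0_ge0 S_bound); rewrite ?subr_ge0//.
    exact: cvg_cst.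
  apply: (@cvg_comp _ _ _ _ A _ (nbhs (y x))); last exact: A_bounded.2.
  apply: (cadlag_seq y_cadlag) => //; first exact: le_trans (ltW sx).
  by move=> n; have [] := Hu n.
have -> : inner (mild_solution x0 y t) a - inner (S (t - s) (mild_solution x0 y s)) a =
    (G t t - G s s) + \int[mu]_(v in `]s, t]) g v v.
  rewrite -mild_shift// /G subrr S0 /mild_solution !(linearDf _ _ (Sb _ ts0).1).
  rewrite -SD// subrK !innerDl; ring.
(* The diagonal values of [G] telescope. Each diagonal step consists of an increment of y with the
   semigroup at the left grid point, and of a change of semigroup time with y at the right grid
   point; the latter is the integral over the cell by [ftc]. *)
have E n : \sum_(j < n.+1) inner (y (gridpt s (dl n) j.+1) - y (gridpt s (dl n) j))
      (k (t - gridpt s (dl n) j) a) =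
    (G t t - G s s) + \sum_(j < n.+1) \int[mu]_(v in cell s (dl n) j)
      g v (gridpt s (dl n) j.+1).
  pose p j := G (gridpt s (dl n) j) (gridpt s (dl n) j).
  have -> : G t t - G s s = \sum_(j < n.+1) (p j.+1 - p j).
    rewrite -(big_mkord xpredT (fun j => p j.+1 - p j)) telescope_sumr//.
    by rewrite /p gridpt_end gridpt0.
  rewrite -big_split/=; apply: eq_bigr => j _.
  have jn : (j <= n.+1)%N by exact: ltnW.
  rewrite -ftc ?gS ?ge// /p /G innerBl -!Hk ?subr_ge0 ?ge//.
  ring.
under eq_fun do rewrite E.
by apply: cvgD; [exact: cvg_cst|exact: Hr].
Qed.

End Path.
End MildPaths.

(** * Characteristic functionals of the increments *)

Section Laws.
Context {R : realType} d (Omega : measurableType d) d' (T : measurableType d').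
Variables (P : probability Omega R) (nu : probability T R) (U : Omega -> T).
Hypotheses (mU : measurable_fun setT U)
  (lawU : forall B, measurable B -> nu B = P (U @^-1` B)).

Lemma Rintegral_law (f : T -> R) : bounded_measurable f ->
  \int[nu]_x f x = \int[P]_w f (U w).
Proof.
move=> [mf [M fM]].
have comp (g : T -> R) : bounded_measurable g -> bounded_measurable (g \o U).
  by move=> [mg [N gN]]; split; [exact: measurableT_comp|exists N => w; exact: gN].
pose C := [set g : T -> R | bounded_measurable g /\ \int[nu]_x g x = \int[P]_w g (U w)].
suff : C f by case.
apply: (@monotone_class_measurable _ _ _ C _ _ f M) => //; last first.
  move=> B mB; split; first exact: bounded_measurable_indic.
  have mB' : measurable (U @^-1` B) by rewrite -[_ @^-1` _]setTI; exact: mU.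
  have indic d0 (T0 : measurableType d0) (m : probability T0 R) (D : set T0) :
      measurable D -> \int[m]_x (\1_D x : R) = fine (m D).
    move=> mD; have := @Rintegral_indicM _ _ _ m D (fun=> 1) mD.
    rewrite (Rintegral_cst m mD) mul1r => <-.
    by apply: eq_Rintegral => w _; rewrite mulr1.
  by rewrite indic// lawU// -indic.
split.
  move=> c g h [bg Eg] [bh Eh]; split.
    by apply: bounded_measurableD => //; exact: bounded_measurableZ.
  have H1 := @Rintegral_lin _ _ _ nu c 1 g h bg bh.
  have H2 := @Rintegral_lin _ _ _ P c 1 _ _ (comp _ bg) (comp _ bh).
  under eq_Rintegral do rewrite -[h _]mul1r.
  under [RHS]eq_Rintegral do rewrite -[h _]mul1r.
  by rewrite H1 [RHS]H2 Eg Eh.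
move=> g_ g N Cg gN gc; split.
  by apply: (@bounded_measurable_lim _ _ _ g_ g N) => // n; have [[]] := Cg n.
have H1 : \int[nu]_x g_ n x @[n --> \oo] --> \int[nu]_x g x.
  by apply: (@Rintegral_bounded_lim _ _ _ nu setT g_ g N) => // n; have [[]] := Cg n.
have H2 : \int[P]_w g_ n (U w) @[n --> \oo] --> \int[P]_w g (U w).
  apply: (@Rintegral_bounded_lim _ _ _ P setT (fun n w => g_ n (U w)) (g \o U) N) => //.
    by move=> n; have [[mg _] _] := Cg n; exact: measurableT_comp.
have E : (fun n => \int[nu]_x g_ n x) = (fun n => \int[P]_w g_ n (U w)).
  by apply/funext => n; have [] := Cg n.
rewrite -E in H2; exact: (@cvg_unique R (@norm_hausdorff _ R^o) _ _ _ _ H1 H2).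
Qed.

Lemma cintegral_law (f : T -> R[i]) : cbounded_measurable f ->
  cintegral nu setT f = cintegral P setT (fun w => f (U w)).
Proof.
by move=> [fr fi]; rewrite /cintegral (Rintegral_law fr) (Rintegral_law fi).
Qed.

End Laws.

Lemma cis_bounded {R : realType} (x : R) :
  `|complex.Re (cis x)| <= 1 /\ `|complex.Im (cis x)| <= 1.
Proof. by rewrite cisE/= cos_max sin_max. Qed.

Lemma cintegral_cis_lim {R : realType} d (Omega : measurableType d) (P : probability Omega R)
    (f_ : nat -> Omega -> R) (f : Omega -> R) :
  (forall n, measurable_fun setT (f_ n)) -> (forall w, f_ n w @[n --> \oo] --> f w) ->
  ccvg (fun n => cintegral P setT (fun w => cis (f_ n w))) (cintegral P setT (fun w => cis (f w))).
Proof.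
move=> mf cf; apply: (@cintegral_lim _ _ _ P _ _ 1).
- by move=> n; exact: cbounded_measurable_cis.
- by move=> n w; exact: cis_bounded.
- by move=> w; exact: ccvg_cis.
Qed.

(** Each value is a telescoping sum starting from y 0 = 0, so an increment collects the weights of
    all later values. *)
Lemma inner_abel {R : realType} (V : hilbertType R) (y a : nat -> V) m : y 0%N = 0 ->
  \sum_(j < m) inner (y j.+1 - y j) (\sum_(j <= i < m) a i) =
  \sum_(i < m) inner (y i.+1) (a i).
Proof.
move=> y0; elim: m => [|m IH]; first by rewrite !big_ord0.
rewrite [RHS]big_ord_recr/= -IH big_ord_recr/= big_nat1.
have E : \sum_(j < m) inner (y j.+1 - y j) (\sum_(j <= i < m.+1) a i) =
    \sum_(j < m) inner (y j.+1 - y j) (\sum_(j <= i < m) a i) +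
    inner (y m) (a m).
  have -> : y m = \sum_(j < m) (y j.+1 - y j).
    by rewrite -(big_mkord xpredT (fun j => y j.+1 - y j)) telescope_sumr// y0 subr0.
  rewrite inner_suml -big_split/=; apply: eq_bigr => j _.
  by rewrite big_nat_recr ?innerDr//= ltnW.
by rewrite E innerBl -addrA [X in _ + X]addrC subrK.
Qed.

(** * Joint characteristic functions of independent increments *)

Section Levy.
Context {R : realType} (V : hilbertType R) (sepV : separable V).
Context d (Omega : measurableType d) (P : probability Omega R).
Variables (psi : V -> R[i]) (Y : R -> Omega -> V).
Hypotheses (Y_measurable : measurable_process Y) (Y_0 : forall w, Y 0 w = 0)
  (Y_indep : independent_increments P Y)
  (Y_char : forall r t c, 0 <= r -> r <= t ->
     cintegral P setT (fun w => cis (inner (Y t w - Y r w) c)) =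
     cexp (- ((t - r)%:C * psi c))).

Let mI t c : 0 <= t -> measurable_fun setT (fun w => inner (Y t w) c).
Proof. by move=> t0; apply: measurable_inner_comp => //; exact: Y_measurable. Qed.

Let mD r t c : 0 <= r -> 0 <= t -> measurable_fun setT (fun w => inner (Y t w - Y r w) c).
Proof.
by move=> r0 t0; under eq_fun do rewrite innerBl; apply: measurable_funB; exact: mI.
Qed.

(* Sorting the times of [l] and summing by parts turns the combination into a sum over
   independent increments. *)
Lemma levy_trig (l : seq (R * V)) (r r' : R) c :
  (forall p, p \in l -> 0 <= p.1 <= r) -> 0 <= r -> r <= r' ->
  cintegral P setT (fun w => cis (trig_comb Y l w + inner (Y r' w - Y r w) c)) =
  cintegral P setT (fun w => cis (trig_comb Y l w)) * cexp (- ((r' - r)%:C * psi c)).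
Proof.
move=> lr r0 rr'.
pose e (p q : R * V) := p.1 <= q.1.
pose l' := sort e l; pose m := size l'.
have l'r p : p \in l' -> 0 <= p.1 <= r by rewrite mem_sort; exact: lr.
have l'E w : trig_comb Y l w = trig_comb Y l' w.
  by apply: perm_big; rewrite perm_sym perm_sort.
have sl' : sorted e l' by apply: sort_sorted => p q; exact: le_total.
pose tm j := (nth (r, 0) l' j).1.
have tm_bd j : 0 <= tm j <= r.
  rewrite /tm; have [jm|jm] := ltnP j m; first by apply/l'r/mem_nth.
  by rewrite nth_default//= r0 lexx.
have tmS j : tm j <= tm j.+1.
  have [jm|jm] := ltnP j.+1 m; last first.
    by have /andP[_] := tm_bd j; rewrite /tm (nth_default _ jm).
  by have /(sortedP (r, 0)) := sl'; apply.
(* Time 0 comes first, so that the Abel summation starts from Y_0 = 0. As [nth] defaults to r, the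
   sorted times are followed by r and then by r', and the increment number m + 1 is Y_r' - Y_r. The
   increment ending at r has weight [A m], an empty sum. *)
pose t i := if i is j.+1 then (if (j <= m)%N then tm j else r') else 0.
have t_mono i : t i <= t i.+1.
  case: i => [|j] /=; first by case/andP: (tm_bd 0).
  have [jm|jm] := ltnP j m; first by rewrite (ltnW jm).
  case: ifP => // _; have /andP[_ h] := tm_bd j; exact: le_trans h rr'.
have t0 i : 0 <= t i by elim: i => [|i IH] //; exact: le_trans (t_mono i).
pose a i := (nth (r, 0) l' i).2.
pose A j := \sum_(j <= i < m) a i.
pose U i w : V := Y (t i.+1) w - Y (t i) w.
pose phi i (x : borel V) : R[i] := cis (inner (x : V) (if i == m.+1 then c else A i)).
have mU i : measurable_fun setT (U i : Omega -> borel V).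
  by apply: measurable_weak => // b; exact: mD.
have mphi i : cbounded_measurable (phi i).
  by apply: cbounded_measurable_cis; exact: measurable_inner.
have trigE w : cis (trig_comb Y l w) = \prod_(i < m.+1) phi i (U i w).
  have -> : \prod_(i < m.+1) phi i (U i w) =
      cis (\sum_(i < m.+1) inner (U i w) (A i)).
    rewrite cis_sum; apply: eq_bigr => i _; rewrite /phi ifF//.
    by apply/negbTE; rewrite neq_ltn ltn_ord.
  congr cis; rewrite big_ord_recr/= [A m]big_geq// inner0r addr0.
  rewrite (@inner_abel _ _ (fun i => Y (t i) w) a m) ?Y_0// l'E /trig_comb (big_nth (r, 0)).
  rewrite big_mkord; apply: eq_bigr => i _.
  by rewrite /t /= ltnW.
have lastE w : cis (inner (Y r' w - Y r w) c) = phi m.+1 (U m.+1 w).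
  by rewrite /phi eqxx /U /t ltnn leqnn /tm nth_default.
have indep n := independent_prod mU (fun B mB => Y_indep n (t0 0%N) t_mono mB) mphi.
rewrite -(Y_char c r0 rr') (eq_cintegral P lastE) (eq_cintegral P trigE) indep.
rewrite -(big_ord_recr m.+1 (fun i => cintegral P setT (fun w => phi i (U i w))))/=.
rewrite -indep; apply: eq_cintegral => w.
by rewrite big_ord_recr/= cisD trigE lastE.
Qed.

(** Plays the role of measurability with respect to [Y] up to time s, in a form to which [levy_trig]
    applies directly. The constants [e n] accommodate the deterministic initial state. *)
Definition past (s : R) (L : Omega -> R) : Prop :=
  exists (l : nat -> seq (R * V)) (e : nat -> R),
    (forall n p, p \in l n -> 0 <= p.1 <= s) /\
    forall w, e n + trig_comb Y (l n) w @[n --> \oo] --> L w.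

Let mtrig s l : (forall p, p \in l -> 0 <= p.1 <= s) ->
  measurable_fun setT (trig_comb Y l).
Proof.
move=> ls; apply: (measurable_trig_comb (I := [set t | 0 <= t])) => //.
by move=> p /ls/andP[].
Qed.

Lemma past_measurable s L : past s L -> measurable_fun setT L.
Proof.
move=> [l [e [ls lL]]].
apply: (@measurable_fun_cvg _ _ _ _ (fun n w => e n + trig_comb Y (l n) w)) => // n.
by apply: measurable_funD; [exact: measurable_cst|exact: mtrig (ls n)].
Qed.

Lemma past_le s s' L : s <= s' -> past s L -> past s' L.
Proof.
move=> ss [l [e [ls lL]]]; exists l, e; split=> // n p /ls /andP[->] /= /le_trans; exact.
Qed.

Lemma pastD s L L' : past s L -> past s L' -> past s (fun w => L w + L' w).
Proof.
move=> [l [e [ls lL]]] [l' [e' [ls' lL']]].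
exists (fun n => l n ++ l' n), (fun n => e n + e' n); split=> [n p|w].
  by rewrite mem_cat => /orP[/ls|/ls'].
by under eq_fun do rewrite trig_comb_cat addrACA; apply: cvgD.
Qed.

Lemma past_cst s c : past s (fun=> c).
Proof.
exists (fun=> [::]), (fun=> c); split=> // w; rewrite /trig_comb.
by under eq_fun do rewrite big_nil addr0; exact: cvg_cst.
Qed.

Lemma past_sum (I : eqType) (r : seq I) s (F : I -> Omega -> R) :
  (forall i, i \in r -> past s (F i)) -> past s (fun w => \sum_(i <- r) F i w).
Proof.
elim: r => [|i r IH] H.
  by under eq_fun do rewrite big_nil; exact: past_cst.
under eq_fun do rewrite big_cons; apply: pastD; first by apply: H; rewrite inE eqxx.
by apply: IH => j jr; apply: H; rewrite inE jr orbT.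
Qed.

Lemma past_increment (s r r' : R) c : 0 <= r <= s -> 0 <= r' <= s ->
  past s (fun w => inner (Y r' w - Y r w) c).
Proof.
move=> rs rs'; exists (fun=> [:: (r', c); (r, - c)]), (fun=> 0); split=> [_ p|w].
  by rewrite !inE => /orP[] /eqP ->.
rewrite /trig_comb; under eq_fun do rewrite !big_cons big_nil /= addr0 innerNr add0r -innerBl.
exact: cvg_cst.
Qed.

(** The characters are bounded, so [levy_trig] passes to pointwise limits of exponents. *)
Lemma past_levy (L : Omega -> R) (s r r' : R) c : past s L -> 0 <= s <= r -> r <= r' ->
  cintegral P setT (fun w => cis (L w + inner (Y r' w - Y r w) c)) =
  cintegral P setT (fun w => cis (L w)) * cexp (- ((r' - r)%:C * psi c)).
Proof.
move=> [l [e [ls lL]]] /andP[s0 sr] rr'.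
have r0 := le_trans s0 sr; have r'0 := le_trans r0 rr'.
have mE n : measurable_fun setT (fun w => e n + trig_comb Y (l n) w).
  by apply: measurable_funD; [exact: measurable_cst|exact: mtrig (ls n)].
have H1 : ccvg (fun n => cintegral P setT (fun w =>
      cis (e n + trig_comb Y (l n) w + inner (Y r' w - Y r w) c)))
    (cintegral P setT (fun w => cis (L w + inner (Y r' w - Y r w) c))).
  apply: cintegral_cis_lim.
    by move=> n; apply: measurable_funD => //; exact: mD.
  by move=> w; apply: cvgD => //; exact: cvg_cst.
have H2 : ccvg (fun n => cintegral P setT (fun w => cis (e n + trig_comb Y (l n) w)))
    (cintegral P setT (fun w => cis (L w))) by exact: cintegral_cis_lim.
apply: (ccvg_unique H1); have := ccvgM H2 (ccvg_cst (cexp (- ((r' - r)%:C * psi c)))).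
suff -> : (fun n => cintegral P setT (fun w =>
      cis (e n + trig_comb Y (l n) w + inner (Y r' w - Y r w) c))) =
    (fun n => cintegral P setT (fun w => cis (e n + trig_comb Y (l n) w)) *
      cexp (- ((r' - r)%:C * psi c))) by [].
apply/funext => n.
have mt : measurable_fun setT (trig_comb Y (l n)) by exact: mtrig (ls n).
transitivity (cis (e n) * cintegral P setT (fun w => cis (trig_comb Y (l n) w + inner (Y r' w - Y r w) c))).
  rewrite -cintegralZ; last first.
    by apply: cbounded_measurable_cis; apply: measurable_funD => //; exact: mD.
  by apply: eq_cintegral => w; rewrite -cisD addrA.
rewrite levy_trig//; last by move=> p /ls /andP[->] /= /le_trans; exact.
rewrite mulrA -cintegralZ; last exact: cbounded_measurable_cis.
by congr (_ * _); apply: eq_cintegral => w; rewrite -cisD.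
Qed.

(** Induction on n: increments already treated end before the next one begins and are absorbed into
    the past. *)
Lemma past_levy_sum (L : Omega -> R) (s : R) (u : nat -> R) (c : nat -> V) n :
  past s L -> 0 <= s -> s <= u 0%N -> (forall j, u j <= u j.+1) ->
  cintegral P setT (fun w => cis (L w + \sum_(j < n) inner (Y (u j.+1) w - Y (u j) w) (c j))) =
  cintegral P setT (fun w => cis (L w)) *
    cexp (- \sum_(j < n) ((u j.+1 - u j)%:C * psi (c j))).
Proof.
move=> pL s0 su0 uS.
have u_mono i j : (i <= j)%N -> u i <= u j.
  by move=> ij; rewrite -(subnKC ij); elim: (j - i)%N => [|k IH]; rewrite ?addn0// addnS (le_trans IH).
have su j : s <= u j by apply: le_trans su0 _; exact: u_mono.
elim: n => [|n IH].
  rewrite big_ord0 oppr0 cexp0 mulr1; apply: eq_cintegral => w.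
  by rewrite big_ord0 addr0.
rewrite big_ord_recr/= opprD cexpD mulrA -IH.
rewrite -(@past_levy _ (u n)) ?lexx ?andbT//.
- by apply: eq_cintegral => w; rewrite big_ord_recr/= addrA.
- apply: pastD; first exact: past_le pL.
  apply: (@past_sum _ (index_enum 'I_n) _ (fun (j : 'I_n) w => inner (Y (u j.+1) w - Y (u j) w) (c j))) => j _.
  apply: past_increment; rewrite (le_trans s0)//= u_mono// ltnW//.
- exact: le_trans s0 (su n).
Qed.

End Levy.

(** * Characteristic functional of the mild solution *)

Section RightEndpointSums.
Context {R : realType}.
Notation mu := (@lebesgue_measure R).

Lemma lebesgue_cell (s delta : R) k : 0 <= delta -> fine (mu (cell s delta k)) = delta.
Proof.
move=> d0; have := lebesgue_measure_itv `]gridpt s delta k, gridpt s delta k.+1].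
rewrite /= lte_fin => ->; rewrite gridptS; move: d0; rewrite le_eqVlt => /predU1P[<-|d0].
  by rewrite addr0 ltxx.
by rewrite ltrDl d0/= addrAC subrr add0r.
Qed.

Lemma riemann_sum_cvg (f : R -> R) (s t : R) : continuous f -> s <= t ->
  \sum_(j < n.+1) ((t - s) / n.+1%:R) * f (t - gridpt s ((t - s) / n.+1%:R) j)
    @[n --> \oo] --> \int[mu]_(u in `]0, t - s]) f u.
Proof.
move=> fc st; have ts0 : 0 <= t - s by rewrite subr_ge0.
have [M M0 fM] : exists2 M : R, 0 <= M & forall u, 0 <= u -> u <= t - s -> `|f u| <= M.
  apply: cadlag_bounded; split=> u _; first exact/cvg_at_right_filter/fc.
  by apply/cvg_ex; exists (f u); exact/cvg_at_left_filter/fc.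
have [|v y|v _ y _ u _ uy|_] := @riemann_cvg _ 0 (t - s) (fun _ => f) M ts0.
- by move=> y _; exact: measurable_cst.
- by move=> _; rewrite /= in_itv/= => /andP[/ltW y0 yt]; exact: fM.
- by apply: (@cvg_comp _ _ _ u f _ (nbhs y)) => //; exact: fc.
rewrite subr0; apply: cvg_trans; apply: near_eq_cvg; apply: nearW => n.
set dl := (t - s) / n.+1%:R.
have dl0 : 0 <= dl by rewrite divr_ge0.
(* Reversing time turns the left grid points of [s, t] into the right endpoints of the cells of ]0,
   t - s]. *)
rewrite [RHS](reindex_inj rev_ord_inj)/=; apply: eq_bigr => j _.
have mC : measurable (cell 0 dl j : set (measurableTypeR R)) by exact: measurable_itv.
transitivity (f (gridpt 0 dl j.+1) * fine (mu (cell 0 dl j))).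
  exact: (Rintegral_cst mu mC).
rewrite lebesgue_cell// mulrC; congr (_ * f _).
have jn : (j.+1 <= n.+1)%N by exact: ltn_ord.
rewrite -{1}(gridpt_end s t n) -/dl /gridpt add0r opprD addrACA subrr add0r -mulrBr -natrB ?leq_subr//.
by rewrite subKn.
Qed.

End RightEndpointSums.

(** * Uniqueness of continuous logarithms *)

Section ComplexContinuity.
Context {R : realType}.

Lemma normc_ge_Im (z : R[i]) : `|complex.Im z|%:C <= `|z|.
Proof.
by case: z => a b; rewrite normc_def/= lecR -(sqrtr_sqr b) ler_wsqrtr// lerDr sqr_ge0.
Qed.

Lemma ccvg_of_continuous (V : normedModType R) (g : V -> R[i]) (x : V) (u : nat -> V) :
  continuous (g : V -> R[i]^o) -> u n @[n --> \oo] --> x -> ccvg (fun n => g (u n)) (g x).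
Proof.
move=> gc ux.
have c : (fun n => g (u n) : R[i]^o) @ \oo --> (g x : R[i]^o).
  by apply: (@cvg_comp _ _ _ u (g : V -> R[i]^o) _ (nbhs x)) => //; exact: gc.
split; apply/cvgrPdist_lt => e e0.
  have /cvgrPdist_lt/(_ e%:C) := c; rewrite ltcR => /(_ e0); apply: filterS => n.
  move=> h; rewrite -ltcR; apply: le_lt_trans h.
  by apply: le_trans (normc_ge_Re _); case: (g x) => a b; case: (g (u n)).
have /cvgrPdist_lt/(_ e%:C) := c; rewrite ltcR => /(_ e0); apply: filterS => n.
move=> h; rewrite -ltcR; apply: le_lt_trans h.
by apply: le_trans (normc_ge_Im _); case: (g x) => a b; case: (g (u n)).
Qed.

(** Were h 1 positive, the intermediate value theorem would give a value in ]0, pi], where the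
    cosine is below 1. The negative case follows by changing sign. *)
Lemma cos_eq1_continuous (h : R -> R) : continuous h -> h 0 = 0 ->
  (forall c, cos (h c) = 1) -> h 1 = 0.
Proof.
suff H (g : R -> R) : continuous g -> g 0 = 0 -> (forall c, cos (g c) = 1) -> g 1 <= 0.
  move=> hc h0 h1; apply/eqP; rewrite eq_le H//= -oppr_le0.
  apply: (H (fun c => - h c)); rewrite ?h0 ?oppr0//.
    by move=> c; apply: cvgN; exact: hc.
  by move=> c; rewrite cosN.
move=> gc g0 g1; rewrite leNgt; apply/negP => gp.
pose m := Num.min (g 1) pi.
have m0 : 0 < m by rewrite /m lt_min gp pi_gt0.
have [c _ cm] : exists2 c, c \in `[0, 1] & g c = m.
  apply: IVT; rewrite ?ler01//; first exact: continuous_subspaceT.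
  by rewrite g0 min_l ?max_r ?(ltW gp)// (ltW m0) /m ge_min lexx.
have := @ltr_cos R 0 m; rewrite !in_itv/= lexx pi_ge0 ltW//= [m <= pi]ge_min lexx orbT.
by move=> /(_ isT isT); rewrite -cm g1 cos0 ltxx cm m0.
Qed.

(** Moduli determine the real parts. The difference of the imaginary parts is continuous, has cosine
    1 everywhere and starts from 0. *)
Lemma cexp_continuous_inj (g h : R -> R[i]) :
  (forall c u, u n @[n --> \oo] --> c -> ccvg (fun n => g (u n)) (g c)) ->
  (forall c u, u n @[n --> \oo] --> c -> ccvg (fun n => h (u n)) (h c)) ->
  g 0 = h 0 -> (forall c, cexp (g c) = cexp (h c)) -> g 1 = h 1.
Proof.
move=> gc hc gh0 gh.
have E c : expR (complex.Re (g c)) * cos (complex.Im (g c)) =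
      expR (complex.Re (h c)) * cos (complex.Im (h c)) /\
    expR (complex.Re (g c)) * sin (complex.Im (g c)) =
      expR (complex.Re (h c)) * sin (complex.Im (h c)).
  have := gh c; rewrite /cexp; move: (g c) (h c) => [a b] [a' b'] /=.
  by move=> /eqP; rewrite eq_complex/= !mul0r !subr0 !addr0 => /andP[/eqP -> /eqP ->].
have ReE c : expR (complex.Re (g c)) = expR (complex.Re (h c)).
  have [E1 E2] := E c; apply/eqP; rewrite -(@eqrXn2 _ 2)// ?expR_ge0//; apply/eqP.
  have H (x y : R) : (x * cos y) ^+ 2 + (x * sin y) ^+ 2 = x ^+ 2.
    by rewrite !exprMn -mulrDr cos2Dsin2 mulr1.
  by rewrite -(H _ (complex.Im (g c))) E1 E2 H.
have Im0 : complex.Im (g 1) - complex.Im (h 1) = 0.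
  apply: (@cos_eq1_continuous (fun c => complex.Im (g c) - complex.Im (h c))).
  - move=> c; apply/(@cvg_nbhsP _ R^o) => u uc.
    by apply: cvgB; [have [] := gc _ _ uc|have [] := hc _ _ uc].
  - by rewrite gh0 subrr.
  - move=> c; have [E1 E2] := E c; rewrite cosB.
    have := mulfI (lt0r_neq0 (expR_gt0 (complex.Re (h c)))).
    by move: E1 E2; rewrite ReE => E1 E2 inj; rewrite (inj _ _ E1) (inj _ _ E2) -!expr2 cos2Dsin2.
have := expR_inj (ReE 1); move/eqP : Im0; rewrite subr_eq0 => /eqP.
by case: (g 1) (h 1) => a b [a' b'] /= -> ->.
Qed.

End ComplexContinuity.

Section MildCharacteristic.
Context {R : realType} (V K : hilbertType R) (sepV : separable V) (sepK : separable K).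
Variable S : R -> K -> K.
Hypothesis S_semigroup : strongly_continuous_semigroup S.
Variables (c0 b0 : R) (c0_ge0 : 0 <= c0) (b0_ge0 : 0 <= b0).
Hypothesis S_bound : forall t x, 0 <= t -> `|S t x| <= c0 * expR (b0 * t) * `|x|.
Notation mu := (@lebesgue_measure R).
Variables (A iota : V -> K).
Hypotheses (A_bounded : bounded_operator A) (iota_bounded : bounded_operator iota).
Hypothesis ftc : forall (x : V) (r u t : R) (a : K), r <= u -> u <= t ->
  inner (S (t - r) (iota x)) a - inner (S (t - u) (iota x)) a =
  \int[mu]_(v in `]r, u]) inner (S (t - v) (A x)) a.

Lemma kernel_exists : exists k : R -> K -> V, forall u b x, 0 <= u ->
  inner (S u (iota x)) b = inner x (k u b).
Proof.
have H u : exists g : K -> V, 0 <= u -> forall x b, inner (S u (iota x)) b = inner x (g b).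
  have [u0|u0] := leP 0 u; last by exists (fun=> 0).
  have [Sb _ _ _] := S_semigroup.
  have [g Hg] : exists g : K -> V, forall x b, inner (S u (iota x)) b = inner x (g b).
    apply: adjoint_exists; split.
      by move=> c x y; rewrite iota_bounded.1 (Sb _ u0).1.
    by move=> x; apply: continuous_comp; [exact: iota_bounded.2|exact: (Sb _ u0).2].
  by exists g.
have [k Hk] := choice H; exists k => u b x u0; exact: Hk.
Qed.

Variable k : R -> K -> V.
Hypothesis kE : forall u b x, 0 <= u -> inner (S u (iota x)) b = inner x (k u b).

(** Tested on x, the difference is an integral of <S_(u-v) A x, a>, and A is bounded in the norm of
    [V]. The resulting norm continuity of k is what the continuity of [psi] can be combined with. *)
Lemma kernel_lipschitz (t : R) a : exists2 M : R, 0 <= M & forall r u, 0 <= r -> r <= u ->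
  u <= t -> `|k u a - k r a| <= M * (u - r).
Proof.
have [C C0 HC] := bound_of_bounded_operator A_bounded.
have [Sb _ _ _] := S_semigroup.
exists (c0 * expR (b0 * t) * C * `|a|); first by rewrite !mulr_ge0 ?expR_ge0.
move=> r u r0 ru ut; have u0 := le_trans r0 ru; have ur0 : 0 <= u - r by rewrite subr_ge0.
apply: norm_le_inner => [|x]; first by rewrite !mulr_ge0 ?expR_ge0.
rewrite innerC innerBr -!kE//.
(* For v from 0 to u - r the time u - v runs from u down to r. *)
have := @ftc x 0 (u - r) u a ur0; rewrite lerBlDr lerDl => /(_ r0).
rewrite subr0 subKr => ->; apply: le_trans (ler_norm _) _.
have -> : c0 * expR (b0 * t) * C * `|a| * (u - r) * `|x| =
    c0 * expR (b0 * t) * (C * `|x|) * `|a| * (u - r - 0) by rewrite subr0; ring.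
have bd v : `]0, u - r]%classic v -> `|inner (S (u - v) (A x)) a| <= c0 * expR (b0 * t) * (C * `|x|) * `|a|.
  rewrite /= in_itv/= => /andP[v0 vu]; apply: le_trans (inner_le_norm _ _) _.
  rewrite ler_wpM2r//; have uv0 : 0 <= u - v by lra.
  have uvt : u - v <= t by lra.
  apply: (@le_trans _ _ (c0 * expR (b0 * t) * `|A x|)).
    exact: (semigroup_bound_le c0_ge0 b0_ge0 S_bound).
  by rewrite ler_wpM2l// mulr_ge0 ?expR_ge0.
have mI : measurable (`]0, u - r]%classic : set (measurableTypeR R)) by exact: measurable_itv.
apply: Rintegral_itv_le => //; first by rewrite !mulr_ge0 ?expR_ge0.
apply: (@bounded_integrable _ (measurableTypeR R) R mu _ _ _ mI _ _ bd); first exact: lebesgue_itv_lty.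
apply: (@eq_measurable_fun _ _ (measurableTypeR R) _ _ (fun v => inner (S `|u - v| (A x)) a)).
  move=> v; rewrite inE /= in_itv/= => /andP[_ vt]; rewrite ger0_norm//; lra.
apply: measurable_funTS; apply: continuous_measurable_fun.
exact: (semigroup_inner_continuous S_semigroup c0_ge0 b0_ge0 S_bound).
Qed.

Lemma kernel_cvg a (u : R) (u_ : nat -> R) : 0 <= u -> (forall n, 0 <= u_ n) ->
  u_ n @[n --> \oo] --> u -> k (u_ n) a @[n --> \oo] --> k u a.
Proof.
move=> u0 un0 uc; have [M M0 HM] := kernel_lipschitz (u + 1) a.
have d0 : M * `|u - u_ n| @[n --> \oo] --> 0.
  rewrite -(mulr0 M) -(normr0 R) -(subrr u).
  by apply: cvgMr; apply: cvg_norm; apply: cvgB => //; exact: cvg_cst.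
apply/cvgrPdist_le => e e0; near=> n.
have un1 : u_ n <= u + 1.
  have : `|u - u_ n| <= 1 by near: n; move/cvgrPdist_le : uc; apply.
  by rewrite ler_norml; lra.
apply: (@le_trans _ _ (M * `|u - u_ n|)); last first.
  apply: le_trans (ler_norm _) _; rewrite -normrN -sub0r; near: n.
  by move/cvgrPdist_le : d0; apply.
have [uun|unu] := leP u (u_ n).
  by rewrite distrC [`|u - _|]distrC [`|u_ n - u|]ger0_norm ?subr_ge0//; apply: HM.
rewrite [`|u - _|]ger0_norm ?subr_ge0 ?(ltW unu)//; apply: HM => //; first exact: ltW.
by rewrite lerDl.
Unshelve. all: by end_near. Qed.

Variables (psi : V -> R[i]) (psi_continuous : continuous (psi : V -> R[i]^o)).

Let psi_seq a (u : R) (u_ : nat -> R) : u_ n @[n --> \oo] --> u ->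
  ccvg (fun n => psi (k `|u_ n| a)) (psi (k `|u| a)).
Proof.
by move=> uc; apply: ccvg_of_continuous => //; apply: kernel_cvg => //; exact: cvg_norm.
Qed.

Let sum_complex n (F : 'I_n -> R[i]) (d : 'I_n -> R) :
  \sum_(j < n) ((d j)%:C * F j) =
  (\sum_(j < n) d j * complex.Re (F j)) +i* (\sum_(j < n) d j * complex.Im (F j)).
Proof.
pose p (z : R[i]) (xy : R * R) := z = xy.1 +i* xy.2.
suff : p (\sum_(j < n) ((d j)%:C * F j))
  (\sum_(j < n) d j * complex.Re (F j), \sum_(j < n) d j * complex.Im (F j)) by [].
rewrite /p/=; elim/big_rec3: _ => [|j x y z _ ->] //.
by case: (F j) => a b; apply/eqP; rewrite eq_complex/= !mul0r subr0 addr0 !eqxx.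
Qed.

Lemma kernel_sum_cvg (s t : R) a : s <= t ->
  ccvg (fun n => \sum_(j < n.+1) ((gridpt s ((t - s) / n.+1%:R) j.+1 -
      gridpt s ((t - s) / n.+1%:R) j)%:C * psi (k (t - gridpt s ((t - s) / n.+1%:R) j) a)))
    (cintegral mu `]0, t - s]%classic (fun u => psi (k u a))).
Proof.
move=> st; have ts0 : 0 <= t - s by rewrite subr_ge0.
have cr : continuous (fun u : R => complex.Re (psi (k `|u| a))).
  by move=> u; apply/(@cvg_nbhsP _ R^o) => u_ uc; have [] := psi_seq a uc.
have ci : continuous (fun u : R => complex.Im (psi (k `|u| a))).
  by move=> u; apply/(@cvg_nbhsP _ R^o) => u_ uc; have [] := psi_seq a uc.
have E n (j : 'I_n.+1) : `|t - gridpt s ((t - s) / n.+1%:R) j| = t - gridpt s ((t - s) / n.+1%:R) j.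
  rewrite ger0_norm// subr_ge0 -[leRHS](gridpt_end s t n); apply: gridpt_le.
    by rewrite divr_ge0.
  exact: ltnW.
have EI (f : R -> R) : \int[mu]_(u in `]0, t - s]) f `|u| = \int[mu]_(u in `]0, t - s]) f u.
  apply: eq_Rintegral => u; rewrite inE /= in_itv/= => /andP[u0 _]; by rewrite gtr0_norm.
split=> /=.
  rewrite -(EI (fun u => complex.Re (psi (k u a)))); apply: cvg_trans (riemann_sum_cvg cr st).
  apply: near_eq_cvg; apply: nearW => n; rewrite sum_complex/=; apply: eq_bigr => j _.
  by rewrite E gridptS addrAC subrr add0r.
rewrite -(EI (fun u => complex.Im (psi (k u a)))); apply: cvg_trans (riemann_sum_cvg ci st).
apply: near_eq_cvg; apply: nearW => n; rewrite sum_complex/=; apply: eq_bigr => j _.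
by rewrite E gridptS addrAC subrr add0r.
Qed.

Context d (Omega : measurableType d) (P : probability Omega R) (Y : R -> Omega -> V).
Hypotheses (Y_measurable : measurable_process Y) (Y_cadlag : forall w, cadlag (Y ^~ w))
  (Y_0 : forall w, Y 0 w = 0) (Y_indep : independent_increments P Y)
  (Y_char : forall r t c, 0 <= r -> r <= t ->
     cintegral P setT (fun w => cis (inner (Y t w - Y r w) c)) =
     cexp (- ((t - r)%:C * psi c))).
Variable x0 : K.
Notation X t w := (mild_solution S A iota x0 (Y ^~ w) t).

Lemma mild_solution0 w : X 0 w = x0.
Proof.
have [_ S0 _ _] := S_semigroup.
rewrite /mild_solution S0 Y_0 (linear0f iota_bounded.1) addr0.
rewrite (_ : mild_integral _ _ _ _ = 0) ?addr0//; apply: inner_ext => a.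
have [_ ->] := mild_weak sepK S_semigroup c0_ge0 b0_ge0 S_bound A_bounded (Y_cadlag w) a (lexx 0).
by rewrite set_itv1 Rintegral_set1 inner0l.
Qed.

(** Summation by parts on [0, t], where the initial value is deterministic. It gives the
    measurability of X and shows that the past of X lies in the past of [Y]. *)
Lemma mild_solution_past t a : 0 <= t -> past Y t (fun w => inner (X t w) a).
Proof.
move=> t0; pose u n := gridpt 0 (t / n.+1%:R).
have u_bd n j : (j <= n.+1)%N -> 0 <= u n j <= t.
  move=> jn; have d0 : 0 <= t / n.+1%:R by rewrite divr_ge0.
  by rewrite /u gridpt_ge//= -[leRHS](gridpt_end 0 t n) subr0 gridpt_le.
exists (fun n => [seq (u n j.+1, k (t - u n j) a) | j <- seq.iota 0 n.+1] ++
                 [seq (u n j, - k (t - u n j) a) | j <- seq.iota 0 n.+1]).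
exists (fun=> inner (S t x0) a); split.
  move=> n p; rewrite mem_cat => /orP[] /mapP[j]; rewrite mem_iota add0n => /andP[_ jn] -> /=.
    exact: u_bd.
  by apply: u_bd; exact: ltnW.
move=> w; have := mild_solution_increment sepK S_semigroup c0_ge0 b0_ge0 S_bound A_bounded
  (Y_cadlag w) ftc (x0 := x0) (a := a) kE (lexx 0) t0.
under eq_fun do rewrite subr0; rewrite mild_solution0 subr0 => H.
have : inner (S t x0) a + \sum_(j < n.+1) inner (Y (u n j.+1) w - Y (u n j) w) (k (t - u n j) a)
    @[n --> \oo] --> inner (S t x0) a + (inner (X t w) a - inner (S t x0) a).
  by apply: cvgD; [exact: cvg_cst|exact: H].
rewrite addrC subrK; apply: cvg_trans; apply: near_eq_cvg; apply: nearW => n.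
congr (_ + _); rewrite trig_comb_cat /trig_comb !big_map -big_split.
rewrite -[seq.iota 0 n.+1]/(index_iota 0 n.+1) big_mkord; apply: eq_bigr => j _.
by rewrite /= innerNr innerBl.
Qed.

(** The grid sums have deterministic coefficients, so the factorisation is exact for every n. On the
    left the limit is dominated convergence, on the right a Riemann sum. *)
Lemma mild_solution_char (L : Omega -> R) (s t : R) a : 0 <= s -> s <= t -> past Y s L ->
  cintegral P setT (fun w => cis (L w + (inner (X t w) a - inner (S (t - s) (X s w)) a))) =
  cintegral P setT (fun w => cis (L w)) *
    cexp (- cintegral mu `]0, t - s]%classic (fun u => psi (k u a))).
Proof.
move=> s0 st pL; pose u n := gridpt s ((t - s) / n.+1%:R).
have d0 n : 0 <= (t - s) / n.+1%:R by rewrite divr_ge0 ?subr_ge0.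
have su n j : s <= u n j by exact: gridpt_ge.
have mL := past_measurable Y_measurable pL.
pose D n w := \sum_(j < n.+1) inner (Y (u n j.+1) w - Y (u n j) w) (k (t - u n j) a).
have mD n : measurable_fun setT (D n).
  apply: measurable_sum => j; under eq_fun do rewrite innerBl.
  by apply: measurable_funB; apply: measurable_inner_comp => //; apply: Y_measurable;
    exact: le_trans (su _ _).
have H1 : ccvg (fun n => cintegral P setT (fun w => cis (L w + D n w)))
    (cintegral P setT (fun w => cis (L w + (inner (X t w) a - inner (S (t - s) (X s w)) a)))).
  apply: cintegral_cis_lim; first by move=> n; exact: measurable_funD.
  move=> w; apply: cvgD; first exact: cvg_cst.
  exact: (mild_solution_increment sepK S_semigroup c0_ge0 b0_ge0 S_bound A_bounded
    (Y_cadlag w) ftc kE s0 st).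
apply: (ccvg_unique H1).
have cN z_ (z : R[i]) : ccvg z_ z -> ccvg (fun n => - z_ n) (- z).
  move=> zc; rewrite -mulN1r (_ : (fun _ => _) = fun n => -1 * z_ n).
    exact: ccvgM (ccvg_cst _) zc.
  by apply/funext => n; rewrite mulN1r.
have := ccvgM (ccvg_cst (cintegral P setT (fun w => cis (L w))))
  (ccvg_cexp (cN _ _ (kernel_sum_cvg a st))).
suff -> : (fun n => cintegral P setT (fun w => cis (L w + D n w))) =
  (fun n => cintegral P setT (fun w => cis (L w)) *
    cexp (- \sum_(j < n.+1) ((u n j.+1 - u n j)%:C * psi (k (t - u n j) a)))) by [].
apply/funext => n.
apply: (@past_levy_sum _ _ sepV _ _ P psi Y Y_measurable Y_0 Y_indep Y_char L s (u n)
  (fun j => k (t - u n j) a) n.+1 pL s0).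
  exact: su.
by move=> j; exact: gridpt_le.
Qed.

End MildCharacteristic.

(** * Strong Markov property *)

Section UpperGrid.
Context {R : realType}.

(** Strictly above r: it equals (k + 1) / (n + 1) when k / (n + 1) <= r < (k + 1) / (n + 1). These
    cells are differences of events of the form {tau < c}. *)
Definition upgrid (n : nat) (r : R) : R := (Num.truncn (r * n.+1%:R)).+1%:R / n.+1%:R.

Lemma upgrid_gt n r : r < upgrid n r.
Proof. by rewrite /upgrid ltr_pdivlMr// truncnS_gt. Qed.

Lemma upgrid_le n r : 0 <= r -> upgrid n r <= r + n.+1%:R^-1.
Proof.
move=> r0; have := @truncn_itv R (r * n.+1%:R).
rewrite mulr_ge0// => /(_ isT) /andP[h _].
rewrite /upgrid ler_pdivrMr// mulrDl mulVf ?pnatr_eq0// -addn1 natrD.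
by rewrite lerD2r.
Qed.

Lemma upgrid_cvg r : 0 <= r -> upgrid n r @[n --> \oo] --> r.
Proof.
move=> r0; have h : n.+1%:R^-1 @[n --> \oo] --> (0 : R) by exact: cvg_harmonic.
apply: (@squeeze_norm _ R^o _ _ (fun n => n.+1%:R^-1)) h => n.
rewrite ger0_norm ?subr_ge0 ?(ltW (upgrid_gt _ _))//.
by rewrite lerBlDl upgrid_le.
Qed.

Lemma upgridE n (r : R) k : k%:R / n.+1%:R <= r -> r < k.+1%:R / n.+1%:R ->
  Num.truncn (r * n.+1%:R) = k.
Proof.
move=> kr rk; have r0 : 0 <= r by apply: le_trans kr; rewrite divr_ge0.
by apply: truncn_def; rewrite -ler_pdivrMr// kr -ltr_pdivlMr.
Qed.

End UpperGrid.

Section StoppedMeasurable.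
Context {R : realType} (K : hilbertType R) (sepK : separable K).
Context d (T0 : measurableType d) (tau : T0 -> \bar R) (X : R -> T0 -> K).
Hypotheses (tau_ge0 : forall w, (0 <= tau w)%E)
  (Xr : forall w t, 0 <= t -> X s w @[s --> t^'+] --> X t w).

(** The space [T0] is generic since the lemma is used for the full sigma-algebra of [Omega] and for
    the natural filtration at time v. The gap between u and v leaves room for the approximating
    times, which exceed tau. *)
Lemma stopped_measurable (u v : R) : 0 <= u -> u < v ->
  (forall c, c <= v -> measurable [set w | (tau w < c%:E)%E]) ->
  measurable [set w | (tau w <= u%:E)%E] ->
  (forall c, 0 <= c <= v -> measurable_fun setT (X c : T0 -> borel K)) ->
  measurable_fun [set w | (tau w <= u%:E)%E] ((fun w => X (fine (tau w)) w) : T0 -> borel K).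
Proof.
move=> u0 uv mlt mle mX.
(* From mesh index [N] on, a grid point just above a time at most u does not exceed v. *)
have [N _ HN] : \forall n \near \oo, (n.+1%:R^-1 : R) < v - u.
  have h : n.+1%:R^-1 @[n --> \oo] --> (0 : R) by exact: cvg_harmonic.
  have uv0 : 0 < v - u by rewrite subr_gt0.
  move/cvgrPdist_lt : h => /(_ _ uv0); apply: filterS => n.
  by rewrite sub0r normrN ger0_norm.
have fin w : (tau w <= u%:E)%E -> [/\ 0 <= fine (tau w), fine (tau w) <= u & tau w = (fine (tau w))%:E].
  by have := tau_ge0 w; case: (tau w) => [r| |]//=; rewrite !lee_fin.
apply: measurable_weak => // a.
apply: (@measurable_fun_cvg _ _ _ _
  (fun n w => inner (X (upgrid (n + N) (fine (tau w))) w) a)); last first.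
  move=> w /= /fin[t0 tu _]; apply: cvg_inner; last exact: cvg_cst.
  apply: (@cvg_seq_right _ _ (X ^~ w)); first exact: Xr.
    by move=> n; exact/ltW/upgrid_gt.
  by have := upgrid_cvg t0; rewrite -(cvg_shiftn N).
move=> n; set m := (n + N)%N.
have dm : (m.+1%:R^-1 : R) < v - u by apply: HN => /=; exact: leq_addl.
pose C k := [set w | (tau w <= u%:E)%E] `&` ([set w | (tau w < (k.+1%:R / m.+1%:R)%:E)%E] `\`
  [set w | (tau w < (k%:R / m.+1%:R)%:E)%E]).
have CE k w : C k w -> k%:R / m.+1%:R <= u /\ upgrid m (fine (tau w)) = k.+1%:R / m.+1%:R.
  move=> [/= tu [t1 /negP]]; rewrite -leNgt => t2; have [r0 ru E] := fin w tu.
  move: t1 t2; rewrite E !lee_fin lte_fin => t1 t2; split; first exact: le_trans ru.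
  by rewrite /upgrid (@upgridE _ _ _ k).
have kv k : k%:R / m.+1%:R <= u -> k.+1%:R / m.+1%:R <= v.
  move=> ku; rewrite -addn1 natrD mulrDl mul1r.
  by move: dm ku; set q := m.+1%:R^-1; lra.
have mC k : measurable (C k).
  have [ku|uk] := leP (k%:R / m.+1%:R) u; last first.
    rewrite (_ : C k = set0) //; apply/seteqP; split=> // w /CE[]; by rewrite leNgt uk.
  apply: measurableI => //; apply: measurableD; apply: mlt; first exact: kv.
  exact: le_trans ku (ltW uv).
have -> : [set w | (tau w <= u%:E)%E] = \bigcup_k C k.
  apply/seteqP; split=> [w tu|w [k _ []]//].
  have [r0 ru E] := fin w tu; exists (Num.truncn (fine (tau w) * m.+1%:R)) => //.
  have := @truncn_itv R (fine (tau w) * m.+1%:R); rewrite mulr_ge0// => /(_ isT) /andP[h1 h2].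
  split=> //; split=> /=; first by rewrite E lte_fin ltr_pdivlMr.
  by apply/negP; rewrite -leNgt E lee_fin ler_pdivrMr.
apply/measurable_fun_bigcup => // k.
have [ku|uk] := leP (k%:R / m.+1%:R) u; last first.
  rewrite (_ : C k = set0); first exact: measurable_fun_set0.
  by apply/seteqP; split=> // w /CE[]; rewrite leNgt uk.
apply: (@eq_measurable_fun _ _ _ _ _ (fun w => inner (X (k.+1%:R / m.+1%:R) w) a)).
  by move=> w; rewrite inE => /CE[_ ->].
apply: measurable_funTS; apply: measurable_inner_comp => //; apply: mX.
by rewrite kv// andbT divr_ge0.
Qed.

End StoppedMeasurable.

(** * Events before a stopping time *)

Section Filtration.
Context {R : realType} (K : hilbertType R) (sepK : separable K).
Context d (Omega : measurableType d) (X : R -> Omega -> K).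
Hypothesis X_measurable : measurable_process X.
Notation N := (natural_filtration X).

Let gens (t : R) : set (set Omega) := [set A | exists s (B : set (borel K)),
  [/\ 0 <= s <= t, measurable B & A = X s @^-1` B]].

Lemma natural_filtration_measurable t : N t `<=` measurable.
Proof.
apply: smallest_sub; first exact: sigma_algebra_measurable.
move=> _ [s [B [/andP[s0 _] mB ->]]]; rewrite -[_ @^-1` _]setTI.
exact: X_measurable.
Qed.

Lemma natural_filtration_le s t : s <= t -> N s `<=` N t.
Proof.
move=> st; apply: sub_sigma_algebra2 => _ [r [B [/andP[r0 rs] mB ->]]].
by exists r, B; split=> //; rewrite r0 (le_trans rs).
Qed.

Variable tau : Omega -> \bar R.
Hypothesis tau_stop : stopping_time (right_limit_filtration N) tau.

(** {tau < c} is a countable union of {tau <= r} with r < c, and the right limit of the filtration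
    at such r is contained in its value at c. *)
Lemma stopped_lt (A : set Omega) (c : R) :
  (forall t, 0 <= t -> right_limit_filtration N t (A `&` [set w | (tau w <= t%:E)%E])) ->
  N c (A `&` [set w | (tau w < c%:E)%E]).
Proof.
move=> HA; have [tau0 _] := tau_stop.
have [sig0 _ sigU] := smallest_sigma_algebra [set: Omega] (gens c).
have [c0|c0] := leP c 0.
  rewrite (_ : _ `&` _ = set0); first exact: sig0.
  apply/seteqP; split=> // w [_ /=]; rewrite ltNge => /negP; apply.
  by apply: le_trans (tau0 w); rewrite lee_fin.
(* The levels c - c / (m + 1) increase to c and stay nonnegative, as the hypothesis concerns
   nonnegative times. *)
have -> : A `&` [set w | (tau w < c%:E)%E] =
    \bigcup_m (A `&` [set w | (tau w <= (c - c / m.+1%:R)%:E)%E]).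
  apply/seteqP; split=> [w [Aw /=]|w [m _ [Aw /= h]]]; last first.
    split=> //=; apply: le_lt_trans h _.
    by rewrite lte_fin ltrBlDr ltrDl divr_gt0.
  have := tau0 w; case E : (tau w) => [r| |]//; rewrite lee_fin lte_fin => r0 rc.
  have h := @cvg_div_natS R c; have cr0 : 0 < c - r by rewrite subr_gt0.
  move/cvgrPdist_lt : h => /(_ _ cr0)[m _ /(_ m (leqnn m))].
  rewrite /= sub0r normrN ger0_norm ?divr_ge0 ?(ltW c0)// => h.
  by exists m => //; split=> //=; rewrite E lee_fin; move: h; set q := c / _; lra.
apply: sigU => m; apply: HA; last by rewrite ltrBlDr ltrDl divr_gt0.
by rewrite subr_ge0 ler_pdivrMr// ler_peMr ?(ltW c0)// ler1n.
Qed.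

Lemma stopping_lt c : N c [set w | (tau w < c%:E)%E].
Proof.
rewrite -[X in N c X]setTI; apply: stopped_lt => t t0; rewrite setTI.
by have [_] := tau_stop; exact.
Qed.

Lemma stopped_cell (A : set Omega) (a c : R) : a <= c ->
  (forall t, 0 <= t -> right_limit_filtration N t (A `&` [set w | (tau w <= t%:E)%E])) ->
  N c (A `&` [set w | (a%:E <= tau w < c%:E)%E]).
Proof.
move=> ac HA.
have -> : A `&` [set w | (a%:E <= tau w < c%:E)%E] =
    (A `&` [set w | (tau w < c%:E)%E]) `\` [set w | (tau w < a%:E)%E].
  apply/seteqP; split=> w /=.
    by move=> [Aw /andP[a1 a2]]; split=> //; apply/negP; rewrite -leNgt.
  by move=> [[Aw a2] /negP]; rewrite -leNgt => a1; split=> //; rewrite a1.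
apply: (@measurableD _ (g_sigma_algebraType (gens c))); first exact: stopped_lt.
by have := natural_filtration_le ac; apply; exact: stopping_lt.
Qed.

End Filtration.

(** * From fixed times to stopping times *)

Section StrongMarkov.
Context {R : realType} (K : hilbertType R) (sepK : separable K).
Context d (Omega : measurableType d) (P : probability Omega R) (X : R -> Omega -> K).
Hypotheses (X_measurable : measurable_process X) (X_cadlag : forall w, cadlag (X ^~ w)).
Variables (S : R -> K -> K) (m : R -> probability (borel K) R).
Hypothesis S_bounded : forall t, 0 <= t -> bounded_operator (S t).
Hypothesis markov_char : forall (l : seq (R * K)) (s t : R) (a : K),
  (forall p, p \in l -> 0 <= p.1 <= s) -> 0 <= s -> s <= t ->
  cintegral P setT (fun w => cis (trig_comb X l w + inner (X t w) a)) =
  cintegral P setT (fun w => cis (trig_comb X l w + inner (S (t - s) (X s w)) a)) *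
    charfun (m (t - s)) a.
Notation N := (natural_filtration X).

(** The defect exp (i <y, a>) - Q_t (exp (i <., a>)) (x) of the Markov property on a character. *)
Let err (t : R) (a x y : K) : R[i] :=
  cis (inner y a) + (- charfun (m t) a) * cis (inner (S t x) a).

Let mSX s t a : 0 <= s -> 0 <= t -> measurable_fun setT (fun w => inner (S t (X s w)) a).
Proof.
move=> s0 t0; have [g Hg] := adjoint_exists (S_bounded t0).
by under eq_fun do rewrite Hg; apply: measurable_inner_comp => //; exact: X_measurable.
Qed.

Let mXa s a : 0 <= s -> measurable_fun setT (fun w => inner (X s w) a).
Proof. by move=> s0; apply: measurable_inner_comp => //; exact: X_measurable. Qed.

Let err_bounded s t a : 0 <= s -> 0 <= t ->
  cbounded_measurable (fun w => err t a (X s w) (X (s + t) w)).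
Proof.
move=> s0 t0; apply: cbounded_measurableD.
  by apply: cbounded_measurable_cis; apply: mXa; exact: addr_ge0.
by apply: cbounded_measurableM; [exact: cbounded_measurable_cst|
  apply: cbounded_measurable_cis; exact: mSX].
Qed.

(** Against characters of X up to time s this is [markov_char]; [trig_events] extends it to
    events. *)
Let err_orthogonal s t a A : 0 <= s -> 0 <= t -> N s A ->
  \int[P]_(w in A) complex.Re (err t a (X s w) (X (s + t) w)) = 0 /\
  \int[P]_(w in A) complex.Im (err t a (X s w) (X (s + t) w)) = 0.
Proof.
move=> s0 t0 NA; have st0 : 0 <= s + t by exact: addr_ge0.
apply: (@trig_events _ _ sepK _ _ P X [set u | 0 <= u <= s]
  (fun w => err t a (X s w) (X (s + t) w))) => //.
- by move=> u /andP[u0 _]; exact: X_measurable.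
- exact: err_bounded.
move=> l ls.
have ml : measurable_fun setT (trig_comb X l).
  by apply: (measurable_trig_comb (I := [set u | 0 <= u <= s])) => // u /andP[u0 _]; exact: X_measurable.
transitivity (cintegral P setT (fun w => cis (trig_comb X l w + inner (X (s + t) w) a)) +
  (- charfun (m t) a) * cintegral P setT (fun w => cis (trig_comb X l w + inner (S t (X s w)) a))).
  have b1 : cbounded_measurable (fun w => cis (trig_comb X l w + inner (X (s + t) w) a)).
    by apply: cbounded_measurable_cis; apply: measurable_funD => //; exact: mXa.
  have b2 : cbounded_measurable (fun w => cis (trig_comb X l w + inner (S t (X s w)) a)).
    by apply: cbounded_measurable_cis; apply: measurable_funD => //; exact: mSX.
  rewrite -cintegralZ// -cintegralD//; last first.
    by apply: cbounded_measurableM => //; exact: cbounded_measurable_cst.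
  apply: eq_cintegral => w; rewrite /err !cisD [LHS]mulrDr; congr (_ + _).
  exact: mulrCA.
have sE : s + t - s = t by rewrite addrAC subrr add0r.
by rewrite (markov_char a ls s0) ?lerDl// sE mulNr mulrC subrr.
Qed.

Variable tau : Omega -> \bar R.
Hypothesis tau_stop : stopping_time (right_limit_filtration N) tau.
Notation G := (stopped_sigma_algebra (right_limit_filtration N) tau).
Let E := [set w | (tau w < +oo)%E].

Let tau_ge0 w : (0 <= tau w)%E. Proof. by case: tau_stop. Qed.

Let EP w : E w -> 0 <= fine (tau w) /\ tau w = (fine (tau w))%:E.
Proof. by rewrite /E /=; have := tau_ge0 w; case: (tau w) => [r| |]//=; rewrite lee_fin. Qed.

Let le_measurable (n : nat) : measurable [set w | (tau w <= n%:R%:E)%E].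
Proof.
apply: (natural_filtration_measurable X_measurable (t := n.+1%:R)).
by have [_] := tau_stop; apply => //; rewrite ltr_nat.
Qed.

Let E_bigcup : E = \bigcup_n [set w | (tau w <= n%:R%:E)%E].
Proof.
apply/seteqP; split=> w; last by move=> [n _ /=] /le_lt_trans; apply; exact: ltry.
move=> /EP[r0 rE]; exists (Num.truncn (fine (tau w))).+1 => //=.
by rewrite rE lee_fin ltW// truncnS_gt.
Qed.

Let E_measurable : measurable E.
Proof. by rewrite E_bigcup; exact: bigcup_measurable. Qed.

Let X_shift_right t w c : 0 <= t -> 0 <= c -> X (s + t) w @[s --> c^'+] --> X (c + t) w.
Proof.
move=> t0 cc0; apply: cvg_at_right_of_seq => u uc ucc.
apply: (cadlag_seq (X_cadlag w)); first exact: addr_ge0.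
  by move=> n; rewrite lerD2r ltW.
by apply: cvgD => //; exact: cvg_cst.
Qed.

Let stopped_process_measurable t : 0 <= t ->
  measurable_fun E ((fun w => X (fine (tau w) + t) w) : Omega -> borel K).
Proof.
move=> t0; rewrite E_bigcup; apply/measurable_fun_bigcup => // n.
apply: (@stopped_measurable _ _ sepK _ _ tau (fun c => X (c + t)) tau_ge0 _ _ n.+1%:R) => //.
- by move=> w c c0; exact: X_shift_right.
- by rewrite ltr_nat.
- move=> c _; apply: (natural_filtration_measurable X_measurable (t := c)).
  exact: stopping_lt.
- by move=> c /andP[c0 _]; apply: X_measurable; exact: addr_ge0.
Qed.

Let stopped_value_adapted (B : set (borel K)) : measurable B ->
  G (E `&` [set w | B (X (fine (tau w)) w)]).
Proof.
move=> mB; split.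
  have := stopped_process_measurable (lexx 0) E_measurable mB.
  by under eq_fun do rewrite addr0.
move=> u u0 v uv.
have mle : N v [set w | (tau w <= u%:E)%E] by have [_] := tau_stop; exact.
(* [Omega] is given the natural filtration at time v as its sigma-algebra, so that measurability of
   the stopped value for it is an instance of the general lemma. *)
pose Nv := g_sigma_algebraType [set A | exists s (B : set (borel K)),
  [/\ 0 <= s <= v, measurable B & A = X s @^-1` B]].
have Xr w t : 0 <= t -> X s w @[s --> t^'+] --> X t w.
  by move=> t0; have [+ _] := X_cadlag w; exact.
have Nlt c : c <= v -> measurable ([set w | (tau w < c%:E)%E] : set Nv).
  by move=> cv; have := natural_filtration_le cv; apply; exact: stopping_lt.
have NX c : 0 <= c <= v -> measurable_fun setT (X c : Nv -> borel K).
  move=> /andP[c0 cv] _ C mC; rewrite setTI; apply: sub_sigma_algebra.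
  by exists c, C; rewrite c0 cv.
have := @stopped_measurable _ _ sepK _ Nv tau X tau_ge0 Xr u v u0 uv Nlt mle NX.
move=> /(_ mle _ mB); congr (N v _); apply/seteqP; split=> w.
  move=> [tu Bw]; split=> //; split=> //.
  by apply: le_lt_trans tu _; exact: ltry.
by move=> [[_ Bw] tu]; split.
Qed.

Section Orthogonal.
Variables (h : K -> K -> R) (M t : R).
Hypotheses (t_ge0 : 0 <= t) (h_bounded : forall x y, `|h x y| <= M)
  (h_continuous : forall x y (x_ y_ : nat -> K), x_ n @[n --> \oo] --> x ->
     y_ n @[n --> \oo] --> y -> h (x_ n) (y_ n) @[n --> \oo] --> h x y)
  (h_measurable : forall s, 0 <= s -> measurable_fun setT (fun w => h (X s w) (X (s + t) w)))
  (h_orthogonal : forall s B, 0 <= s -> N s B ->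
     \int[P]_(w in B) h (X s w) (X (s + t) w) = 0).

(* The time [tau] is approximated from above by times with values in a grid, on whose
   level sets the Markov property at a fixed time applies. *)
Lemma stopped_orthogonal A : G A ->
  \int[P]_(w in A `&` E) h (X (fine (tau w)) w) (X (fine (tau w) + t) w) = 0.
Proof.
move=> [mA GA]; have mAE : measurable (A `&` E) by exact: measurableI.
pose C n k := [set w | ((k%:R / n.+1%:R)%:E <= tau w < (k.+1%:R / n.+1%:R)%:E)%E].
pose s n k : R := k.+1%:R / n.+1%:R.
have s0 n k : 0 <= s n k by rewrite divr_ge0.
have NC n k : N (s n k) (A `&` C n k).
  by apply: stopped_cell => //; rewrite ler_pM2r ?invr_gt0// ler_nat.
have mC n k : measurable (A `&` C n k) by exact: natural_filtration_measurable (NC n k).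
pose H n k w := h (X (s n k) w) (X (s n k + t) w).
have bH n k : bounded_measurable (H n k).
  by split; [exact: (h_measurable (s0 n k))|exists M => w; exact: h_bounded].
(* Finitely many cells, reaching n + 1; a finite value of tau is eventually covered, and where tau
   is infinite every term is 0. *)
pose Z n w := \sum_(k < n.+1 * n.+1) \1_(A `&` C n k) w * H n k w.
have Z0 n : \int[P]_w Z n w = 0.
  rewrite Rintegral_sum//.
    apply: big1 => k _; rewrite Rintegral_indicM//; exact: h_orthogonal.
  move=> k; apply: bounded_measurable_integrable => //.
  by apply: bounded_measurableM => //; exact: bounded_measurable_indic.
have M0 : 0 <= M by apply: le_trans (h_bounded 0 0).
have Zout n w : ~ (A `&` E) w -> Z n w = 0.
  move=> AEw; apply: big1 => k _; rewrite indicE memNset ?mul0r// => -[Aw /andP[_ tk]].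
  by apply: AEw; split=> //; apply: lt_trans tk _; exact: ltry.
pose k0 n w := Num.truncn (fine (tau w) * n.+1%:R).
have Zin n w : (A `&` E) w -> Z n w = if (k0 n w < n.+1 * n.+1)%N then H n (k0 n w) w else 0.
  move=> [Aw Ew]; have [r0 rE] := EP Ew.
  have ind k : \1_(A `&` C n k) w = (k == k0 n w)%:R :> R.
    rewrite indicE; congr (_%:R); congr nat_of_bool; apply/idP/eqP.
      rewrite inE => -[_]; rewrite /C /= rE lee_fin lte_fin => /andP[h1 h2].
      by rewrite /k0 (upgridE h1 h2).
    move=> ->; rewrite inE; split=> //; rewrite /C /= rE lee_fin lte_fin.
    have := @truncn_itv R (fine (tau w) * n.+1%:R); rewrite mulr_ge0// => /(_ isT).
    by rewrite ler_pdivrMr// ltr_pdivlMr.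
  rewrite /Z; under eq_bigr do rewrite ind.
  case: ifP => [kN|/negbT kN].
    rewrite (bigD1 (Ordinal kN))//= eqxx mul1r big1 ?addr0// => k kk.
    by rewrite (_ : _ == _ = false) ?mul0r//; apply: contraNF kk => /eqP kk; apply/eqP/val_inj.
  apply: big1 => k _; rewrite (_ : _ == _ = false) ?mul0r//.
  by apply: contraNF kN => /eqP <-.
have Zlim w : Z n w @[n --> \oo] -->
    \1_(A `&` E) w * h (X (fine (tau w)) w) (X (fine (tau w) + t) w).
  have [AEw|AEw] := pselect ((A `&` E) w); last first.
    rewrite indicE memNset// mul0r; under eq_fun do rewrite Zout//; exact: cvg_cst.
  rewrite indicE mem_set// mul1r; have [r0 rE] := EP AEw.2.
  have uc := upgrid_cvg r0.
  have : h (X (upgrid n (fine (tau w))) w) (X (upgrid n (fine (tau w)) + t) w)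
      @[n --> \oo] --> h (X (fine (tau w)) w) (X (fine (tau w) + t) w).
    apply: h_continuous.
      by apply: (cadlag_seq (X_cadlag w)) => // n; exact/ltW/upgrid_gt.
    apply: (cadlag_seq (X_cadlag w)); first exact: addr_ge0.
      by move=> n; rewrite lerD2r; exact/ltW/upgrid_gt.
    by apply: cvgD => //; exact: cvg_cst.
  apply: cvg_trans; apply: near_eq_cvg.
  exists (Num.truncn (fine (tau w))) => // n /= tn.
  rewrite Zin// ifT// /k0 truncn_lt_nat ?mulr_ge0// natrM ltr_pM2r//.
  by apply: lt_le_trans (truncnS_gt _) _; rewrite ler_nat.
have bZ n : bounded_measurable (Z n).
  rewrite /Z; elim: (n.+1 * n.+1)%N => [|j IH].
    by under eq_fun do rewrite big_ord0; exact: bounded_measurable_cst.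
  under eq_fun do rewrite big_ord_recr/=; apply: bounded_measurableD => //.
  by apply: bounded_measurableM => //; exact: bounded_measurable_indic.
have ZM n w : `|Z n w| <= M.
  have [AEw|AEw] := pselect ((A `&` E) w); last by rewrite Zout// normr0.
  by rewrite Zin//; case: ifP => _; rewrite ?normr0//; exact: h_bounded.
have := @Rintegral_bounded_lim _ _ _ P setT Z _ M measurableT (fun n => (bZ n).1) ZM Zlim.
rewrite Rintegral_indicM//; under eq_fun do rewrite Z0.
move=> c0; apply: (@cvg_unique R (@norm_hausdorff _ R^o) _ _ _ _ c0).
exact: cvg_cst.
Qed.

End Orthogonal.

Section Expectation.
Variable t : R.
Hypothesis t_ge0 : 0 <= t.

Let bounded_on (f : K -> R) (M : R) A u : 0 <= u -> measurable_fun setT (f : borel K -> R) ->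
  (forall x, `|f x| <= M) -> measurable A ->
  P.-integrable (A `&` E) (EFin \o (fun w => f (X (fine (tau w) + u) w))).
Proof.
move=> u0 mf fM mA; have mAE : measurable (A `&` E) by exact: measurableI.
apply: (bounded_integrable (M := M)) => //.
- by apply: le_lt_trans (probability_le1 _ mAE) _; rewrite ltry.
- apply: (@measurable_comp _ _ _ _ _ _ setT (f : borel K -> R)) => //.
  exact: measurable_funS (stopped_process_measurable u0).
Qed.

Lemma mehler_bounded (f : K -> R) (M : R) x : measurable_fun setT (f : borel K -> R) ->
  (forall x, `|f x| <= M) -> bounded_measurable (fun y : borel K => f (S t x + (y : K))) /\
  `|mehler S m t f x| <= M.
Proof.
move=> mf fM.
have b : bounded_measurable (fun y : borel K => f (S t x + (y : K))).
  split; last by exists M.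
  apply: (@measurableT_comp _ _ _ _ _ _ (f : borel K -> R)) => //.
  apply: measurable_weak => // a; under eq_fun do rewrite innerDl.
  by apply: measurable_funD; [exact: measurable_cst|exact: measurable_inner].
split=> //.
have i := bounded_measurable_integrable (m t) measurableT b.
apply: le_trans (le_normr_Rintegral measurableT i) _.
have <- : \int[m t]_y M = M by exact: (congr1 (@complex.Re R) (cintegral_cst (m t) M%:C)).
apply: le_Rintegral => //; first by have := integrable_norm i.
by apply: bounded_measurable_integrable => //; exact: bounded_measurable_cst.
Qed.

Lemma mehler_trig a x :
  mehler S m t (fun y => cos (inner y a)) x =
    complex.Re (charfun (m t) a * cis (inner (S t x) a)) /\
  mehler S m t (fun y => sin (inner y a)) x =
    complex.Im (charfun (m t) a * cis (inner (S t x) a)).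
Proof.
rewrite mulrC -cintegralZ; last by apply: cbounded_measurable_cis; exact: measurable_inner.
split=> /=; apply: eq_Rintegral => y _.
  transitivity (complex.Re (cis (inner (S t x) a + inner (y : K) a))); last by rewrite cisD.
  by rewrite -innerDl cisE.
transitivity (complex.Im (cis (inner (S t x) a + inner (y : K) a))); last by rewrite cisD.
by rewrite -innerDl cisE.
Qed.

(** Measurability of [mehler S m t f] is included, so that it is produced by the same monotone class
    argument. *)
Let class : set (K -> R) := [set f | [/\ measurable_fun setT (f : borel K -> R),
  (exists M : R, forall x, `|f x| <= M),
  measurable_fun setT (mehler S m t f : borel K -> R) &
  forall A, G A -> \int[P]_(w in A `&` E) mehler S m t f (X (fine (tau w)) w) =
                   \int[P]_(w in A `&` E) f (X (fine (tau w) + t) w)]].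

Let bounded_on0 (f : K -> R) (M : R) A : measurable_fun setT (f : borel K -> R) ->
  (forall x, `|f x| <= M) -> measurable A ->
  P.-integrable (A `&` E) (EFin \o (fun w => f (X (fine (tau w)) w))).
Proof.
by move=> mf fM mA; have := bounded_on (lexx 0) mf fM mA; under eq_fun do rewrite addr0.
Qed.

Let class_monotone : monotone_class class.
Proof.
split.
  move=> c f g [mf [M fM] mQf Ef] [mg [M' gM] mQg Eg].
  have QE x : mehler S m t (fun x => c * f x + g x) x = c * mehler S m t f x + mehler S m t g x.
    have [bf _] := mehler_bounded x mf fM; have [bg _] := mehler_bounded x mg gM.
    rewrite /mehler RintegralD//; [|apply: bounded_measurable_integrable => //..].
      by rewrite RintegralZl//; exact: bounded_measurable_integrable.
    exact: bounded_measurableZ.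
  split.
  - by apply: measurable_funD => //; apply: measurable_funM => //; exact: measurable_cst.
  - exists (`|c| * M + M') => x; apply: le_trans (ler_normD _ _) _.
    by rewrite normrM lerD// ler_wpM2l.
  - rewrite (_ : mehler _ _ _ _ = fun x => c * mehler S m t f x + mehler S m t g x); last exact/funext.
    by apply: measurable_funD => //; apply: measurable_funM => //; exact: measurable_cst.
  move=> A GA; have mA := GA.1; have mAE : measurable (A `&` E) by exact: measurableI.
  under eq_Rintegral do rewrite QE.
  have if' := bounded_on t_ge0 mf fM mA; have ig := bounded_on t_ge0 mg gM mA.
  have iQf := bounded_on0 mQf (fun x => (mehler_bounded x mf fM).2) mA.
  have iQg := bounded_on0 mQg (fun x => (mehler_bounded x mg gM).2) mA.
  rewrite (RintegralD mAE (integrable_realZ mAE c iQf) iQg) (RintegralZl c mAE iQf).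
  by rewrite (RintegralD mAE (integrable_realZ mAE c if') ig) (RintegralZl c mAE if') Ef// Eg.
move=> f_ f M Cf fM fc.
have mf n : measurable_fun setT (f_ n : borel K -> R) by have [] := Cf n.
have bl : measurable_fun setT (f : borel K -> R) /\ forall x, `|f x| <= M.
  split; first exact: (@measurable_fun_cvg _ (borel K) R setT (fun n => f_ n : borel K -> R)).
  move=> x; rewrite -(cvg_lim (@Rhausdorff R) (cvg_norm (fc x))).
  apply: limr_le; first by apply/cvg_ex; eexists; exact: cvg_norm (fc x).
  exact: nearW.
have Qc x : mehler S m t (f_ n) x @[n --> \oo] --> mehler S m t f x.
  apply: (@Rintegral_bounded_lim _ _ _ (m t) setT
    (fun n (y : borel K) => f_ n (S t x + (y : K))) _ M) => //.
  by move=> n; have [[]] := mehler_bounded x (mf n) (fM n).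
have mQ n : measurable_fun setT (mehler S m t (f_ n) : borel K -> R) by have [] := Cf n.
split; [exact: bl.1|by exists M; exact: bl.2| |].
  exact: (@measurable_fun_cvg _ (borel K) R setT (fun n => mehler S m t (f_ n) : borel K -> R)).
move=> A GA; have mA := GA.1; have mAE : measurable (A `&` E) by exact: measurableI.
have iM : P.-integrable (A `&` E) (EFin \o (fun=> M)).
  by apply: bounded_measurable_integrable => //; exact: bounded_measurable_cst.
have lim1 : \int[P]_(w in A `&` E) mehler S m t (f_ n) (X (fine (tau w)) w) @[n --> \oo] -->
    \int[P]_(w in A `&` E) mehler S m t f (X (fine (tau w)) w).
  have [|||_ + _] := @Rintegral_dominated _ _ _ P (A `&` E)
    (fun n w => mehler S m t (f_ n) (X (fine (tau w)) w))
    (fun w => mehler S m t f (X (fine (tau w)) w)) (fun=> M) mAE _ _ iM.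
  - move=> n; have := bounded_on0 (mQ n) (fun x => (mehler_bounded x (mf n) (fM n)).2) mA.
    by move=> /measurable_int/measurable_EFinP.
  - by move=> w _; exact: Qc.
  - by move=> n w _; have [] := mehler_bounded (X (fine (tau w)) w) (mf n) (fM n).
  - by [].
have lim2 : \int[P]_(w in A `&` E) f_ n (X (fine (tau w) + t) w) @[n --> \oo] -->
    \int[P]_(w in A `&` E) f (X (fine (tau w) + t) w).
  have [|||_ + _] := @Rintegral_dominated _ _ _ P (A `&` E)
    (fun n w => f_ n (X (fine (tau w) + t) w))
    (fun w => f (X (fine (tau w) + t) w)) (fun=> M) mAE _ _ iM.
  - move=> n; have := bounded_on t_ge0 (mf n) (fM n) mA.
    by move=> /measurable_int/measurable_EFinP.
  - by move=> w _; exact: fc.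
  - by [].
  - by [].
have eqn : (fun n => \int[P]_(w in A `&` E) mehler S m t (f_ n) (X (fine (tau w)) w)) =
    (fun n => \int[P]_(w in A `&` E) f_ n (X (fine (tau w) + t) w)).
  by apply/funext => n; have [_ _ _] := Cf n; exact.
rewrite eqn in lim1; exact: (@cvg_unique R (@norm_hausdorff _ R^o) _ _ _ _ lim1 lim2).
Qed.

Let class_trig a : class (fun x => cos (inner x a)) /\ class (fun x => sin (inner x a)).
Proof.
have [Sl Sc] := S_bounded t_ge0.
have mq : cbounded_measurable (fun x : borel K => charfun (m t) a * cis (inner (S t (x : K)) a)).
  apply: cbounded_measurableM; first exact: cbounded_measurable_cst.
  apply: cbounded_measurable_cis; apply: measurable_of_continuous => x.
  by apply: cvg_inner; [exact: Sc|exact: cvg_cst].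
have mc : bounded_measurable (fun x : borel K => cos (inner (x : K) a)).
  by apply: bounded_measurable_cos; exact: measurable_inner.
have ms : bounded_measurable (fun x : borel K => sin (inner (x : K) a)).
  by apply: bounded_measurable_sin; exact: measurable_inner.
have [[mqr [Mr qr]] [mqi [Mi qi]]] := mq.
have QE1 : mehler S m t (fun y => cos (inner y a)) =
    fun x => complex.Re (charfun (m t) a * cis (inner (S t x) a)).
  by apply/funext => x; have [] := mehler_trig a x.
have QE2 : mehler S m t (fun y => sin (inner y a)) =
    fun x => complex.Im (charfun (m t) a * cis (inner (S t x) a)).
  by apply/funext => x; have [] := mehler_trig a x.
have ecv x y (x_ y_ : nat -> K) : x_ n @[n --> \oo] --> x -> y_ n @[n --> \oo] --> y ->
    ccvg (fun n => err t a (x_ n) (y_ n)) (err t a x y).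
  move=> xc yc; apply: ccvgD; first by apply: ccvg_cis; apply: cvg_inner => //; exact: cvg_cst.
  apply: ccvgM; first exact: ccvg_cst.
  apply: ccvg_cis; apply: cvg_inner; last exact: cvg_cst.
  by apply: (@cvg_comp _ _ _ _ (S t) _ (nbhs x)) => //; exact: Sc.
have reE x y : complex.Re (err t a x y) =
    cos (inner y a) - complex.Re (charfun (m t) a * cis (inner (S t x) a)).
  by rewrite /err mulNr cisE; case: (charfun _ _ * _).
have imE x y : complex.Im (err t a x y) =
    sin (inner y a) - complex.Im (charfun (m t) a * cis (inner (S t x) a)).
  by rewrite /err mulNr cisE; case: (charfun _ _ * _).
split.
  split; [exact: mc.1|exact: mc.2|by rewrite QE1|].
  rewrite QE1 => A GA; have mA := GA.1; have mAE : measurable (A `&` E) by exact: measurableI.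
  have := @stopped_orthogonal (fun x y => complex.Re (err t a x y)) (1 + Mr) t t_ge0 _ _ _ _ A GA.
  under eq_Rintegral do rewrite reE.
  rewrite (RintegralB mAE (bounded_on t_ge0 mc.1 (fun x => cos_max _) mA) (bounded_on0 mqr qr mA)).
  move=> H; apply/esym/eqP; rewrite -subr_eq0; apply/eqP; apply: H.
  - move=> x y; rewrite reE; apply: le_trans (ler_normB _ _) _; apply: lerD; [exact: cos_max|exact: qr].
  - by move=> x y x_ y_ xc yc; have [] := ecv _ _ _ _ xc yc.
  - by move=> s s0; have [[]] := err_bounded a s0 t_ge0.
  - by move=> s B s0 NB; have [] := err_orthogonal a s0 t_ge0 NB.
split; [exact: ms.1|exact: ms.2|by rewrite QE2|].
rewrite QE2 => A GA; have mA := GA.1; have mAE : measurable (A `&` E) by exact: measurableI.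
have := @stopped_orthogonal (fun x y => complex.Im (err t a x y)) (1 + Mi) t t_ge0 _ _ _ _ A GA.
under eq_Rintegral do rewrite imE.
rewrite (RintegralB mAE (bounded_on t_ge0 ms.1 (fun x => sin_max _) mA) (bounded_on0 mqi qi mA)).
move=> H; apply/esym/eqP; rewrite -subr_eq0; apply/eqP; apply: H.
- move=> x y; rewrite imE; apply: le_trans (ler_normB _ _) _; apply: lerD; [exact: sin_max|exact: qi].
- by move=> x y x_ y_ xc yc; have [] := ecv _ _ _ _ xc yc.
- by move=> s s0; have [_ []] := err_bounded a s0 t_ge0.
- by move=> s B s0 NB; have [] := err_orthogonal a s0 t_ge0 NB.
Qed.

Lemma stopped_cond_expectation (f : K -> R) : measurable_fun setT (f : borel K -> R) ->
  (exists M : R, forall x, `|f x| <= M) ->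
  cond_expectation_on P G E (fun w => f (X (fine (tau w) + t) w))
    (fun w => mehler S m t f (X (fine (tau w)) w)).
Proof.
move=> mf [M fM]; have [_ _ mQ EQ] := trig_class sepK class_monotone class_trig mf fM.
split.
- by have := bounded_on t_ge0 mf fM measurableT; rewrite setTI.
- move=> B mB; apply: (stopped_value_adapted (B := mehler S m t f @^-1` B)).
  by rewrite -[_ @^-1` _]setTI; exact: mQ.
- exact: EQ.
Qed.

End Expectation.
End StrongMarkov.

(** * Identification of the characteristic functionals and conclusion *)

Lemma measurable_continuous_map {R : realType} (V K : hilbertType R) (f : V -> K) :
  separable K -> continuous f -> measurable_fun setT (f : borel V -> borel K).
Proof.
move=> sepK fc; apply: measurable_weak => // a; apply: measurable_of_continuous => x.
by apply: cvg_inner; [exact: fc|exact: cvg_cst].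
Qed.

Theorem theorem4p1 (R : realType)
  (H : hilbertType R) (H_separable : separable H)
  (T : R -> H -> H) (T_semigroup : strongly_continuous_semigroup T)
  (c0 b0 : R) (c0_ge0 : 0 <= c0) (b0_ge0 : 0 <= b0)
  (T_bound : forall t x, 0 <= t -> `|T t x| <= c0 * expR (b0 * t) * `|x|)
  (b : R) (b_gt : b0 < b)
  (Ht : hilbertType R) (Ht_separable : separable Ht) (ev : Ht -> R -> H)
  (Ht_entrance : is_entrance_space T b ev)
  (J : H -> Ht) (J_def : forall x s, 0 < s -> ev (J x) s = T s x)
  (Tt : R -> Ht -> Ht)
  (Tt_def : forall t x s, 0 <= t -> 0 < s -> ev (Tt t x) s = ev x (t + s))
  (alpha : R) (alpha_gt : b0 < alpha)
  (Hb : hilbertType R) (iota : Ht -> Hb)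
  (Hb_completion : is_minus_completion T b alpha ev iota)
  (Tb : R -> Hb -> Hb)
  (Tb_bounded : forall t, 0 <= t -> bounded_operator (Tb t))
  (Tb_ext : forall t x, 0 <= t -> Tb t (iota x) = iota (Tt t x))
  (lambda0 : probability (borel Ht) R)
  (lambda0_centered : centered lambda0)
  (lambda0_id : infinitely_divisible lambda0)
  (lambda0_moment :
     (\int[lambda0]_x ((`|(x : Ht)| ^+ 2)%R)%:E < +oo)%E)
  (psit0 : Ht -> R[i]) (psit0_continuous : continuous (psit0 : Ht -> R[i]^o))
  (psit0_0 : psit0 0 = 0)
  (psit0_def : forall a, charfun lambda0 a = cexp (- psit0 a))
  (psi : R -> H -> R[i])
  (psi_continuous : forall s, 0 < s -> continuous (psi s : H -> R[i]^o))
  (psi_0 : forall s, 0 < s -> psi s 0 = 0)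
  (psi_def : forall s a, 0 < s ->
     cexp (- psi s a) =
     cintegral lambda0 setT
       (fun x : borel Ht => cexp (0 +i* inner (ev (x : Ht) s) a)))
  (mu : R -> probability (borel H) R)
  (mu_sc : sc_semigroup T mu)
  (mu_centered : forall t, 0 <= t -> centered (mu t))
  (mu_charfun : forall t a, 0 <= t ->
     charfun (mu t) a =
     cexp (- cintegral (@lebesgue_measure R) `]0, t] (fun s => psi s a)))
  (mut : R -> probability (borel Ht) R)
  (mut_def : forall t (B : set (borel Ht)), 0 <= t -> measurable B ->
     mut t B = pushforward (mu t) (J : borel H -> borel Ht) B)
  (mub : R -> probability (borel Hb) R)
  (mub_def : forall t (B : set (borel Hb)), 0 <= t -> measurable B ->
     mub t B = pushforward (mut t) (iota : borel Ht -> borel Hb) B)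
  (d : measure_display) (Omega : measurableType d) (P : probability Omega R)
  (gamma : R -> probability (borel Ht) R)
  (gamma_charfun : forall t a, 0 <= t ->
     charfun (gamma t) a = cexp (- (t%:C * psit0 a)))
  (Y : R -> Omega -> Ht)
  (Y_measurable : measurable_process Y)
  (Y_cadlag : forall w, cadlag (Y ^~ w))
  (Y_0 : forall w, Y 0 w = 0)
  (Y_indep : independent_increments P Y)
  (Y_law : forall r t (B : set (borel Ht)), 0 <= r -> r <= t -> measurable B ->
     P [set w | B (Y t w - Y r w)] = gamma (t - r) B)
  (xb : Hb) :
  let integrand t w := fun s : R => Tb (t - s) (generator Tb (iota (Y s w))) in
  let X := fun t w =>
    Tb t xb + iota (Y t w) +
    bochner_integral (@lebesgue_measure R) `[0, t] (integrand t w) in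
  [/\ forall t w, 0 <= t ->
        bochner_integrable (@lebesgue_measure R) `[0, t] (integrand t w),
      measurable_process X,
      forall w, cadlag (X ^~ w) &
      strong_markov P X (mehler Tb mub)].
Proof.
move=> integrand X.
have [iotaB iotaC] := completion_embed_bounded H_separable T_semigroup c0_ge0 b0_ge0 T_bound b_gt
  Ht_entrance alpha_gt Hb_completion.
have iota_bounded : bounded_operator iota by [].
have bound := completion_bound H_separable T_semigroup c0_ge0 b0_ge0 T_bound b_gt Ht_entrance
  Tt_def alpha_gt Hb_completion Tb_bounded Tb_ext.
have Tb_semigroup := completion_semigroup H_separable T_semigroup c0_ge0 b0_ge0 T_bound b_gt
  Ht_entrance Tt_def alpha_gt Hb_completion Tb_bounded Tb_ext.
have A_bounded := completion_generator_bounded H_separable T_semigroup c0_ge0 b0_ge0 T_bound b_gt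
  Ht_entrance Tt_def alpha_gt Hb_completion Tb_ext.
have ftc := completion_ftc H_separable T_semigroup c0_ge0 b0_ge0 T_bound b_gt
  Ht_entrance Tt_def alpha_gt Hb_completion Tb_bounded Tb_ext.
have sepHb : separable Hb.
  by apply: (dense_range_separable Ht_separable iotaC); have [] := Hb_completion.
have J_bounded := entrance_embed_bounded T_semigroup c0_ge0 b0_ge0 T_bound b_gt Ht_entrance J_def.
have [k kE] := kernel_exists Tb_semigroup iota_bounded.
(* [g] is the adjoint of iota J, which sends test vectors of [Hb] to arguments of the characteristic
   functional of [mu]. *)
have [g gE] : exists g : Hb -> H, forall x a, inner (iota (J x)) a = inner x (g a).
  apply: adjoint_exists; split; first by move=> c x y; rewrite J_bounded.1 iotaB.
  by move=> x; apply: continuous_comp; [exact: J_bounded.2|exact: iotaC].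
(* For s > 0, iota J (ev x s) = iota (Tt_s x) = Tb_s (iota x), so both sides are <Tb_s (iota x),
   a>. *)
have ev_inner x a s : 0 < s -> inner (ev x s) (g a) = inner x (k s a).
  move=> s0; rewrite -gE -kE ?ltW// Tb_ext ?ltW//.
  by rewrite (entrance_shift_embed T_semigroup c0_ge0 b0_ge0 T_bound b_gt Ht_entrance Tt_def J_def).
have cexpN (z z' : R[i]) : cexp (- z) = cexp (- z') -> cexp z = cexp z'.
  move=> zz; have cN (v : R[i]) : cexp v * cexp (- v) = 1 by rewrite -cexpD subrr cexp0.
  by rewrite -[cexp z]mulr1 -(cN z') -zz mulrCA cN mulr1.
(* By [ev_inner], along the ray c -> c (g a) both exponentials are the characteristic functional of
   [lambda0] at c k_s a. Both logarithms are continuous on the ray and vanish at c = 0; the claim is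
   their equality at c = 1. *)
have psiE a s : 0 < s -> psi s (g a) = psit0 (k s a).
  move=> s0.
  have scale (K : hilbertType R) (v : K) (c : R) (u : nat -> R) : u n @[n --> \oo] --> c ->
      u n *: v @[n --> \oo] --> c *: v by move=> uc; apply: cvgZ => //; exact: cvg_cst.
  rewrite -[g a]scale1r -[k s a]scale1r.
  apply: (@cexp_continuous_inj R (fun c => psi s (c *: g a)) (fun c => psit0 (c *: k s a))).
  - by move=> c u uc; apply: ccvg_of_continuous; [exact: psi_continuous|exact: scale].
  - by move=> c u uc; apply: ccvg_of_continuous => //; exact: scale.
  - by rewrite !scale0r psi_0// psit0_0.
  move=> c; apply: cexpN; rewrite psi_def// -psit0_def; apply: eq_cintegral => x.
  by rewrite !innerZr ev_inner.
have mub_char t a : 0 <= t -> charfun (mub t) a =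
    cexp (- cintegral (@lebesgue_measure R) `]0, t]%classic (fun u => psit0 (k u a))).
  move=> t0.
  rewrite -[charfun _ _]/(cintegral (mub t) setT (fun x : borel Hb => cis (inner (x : Hb) a))).
  have m_iota : measurable_fun setT (iota : borel Ht -> borel Hb).
    exact: measurable_continuous_map.
  have mJ : measurable_fun setT (J : borel H -> borel Ht).
    exact: measurable_continuous_map J_bounded.2.
  rewrite (cintegral_law m_iota (fun B mB => mub_def t B t0 mB)); last first.
    by apply: cbounded_measurable_cis; exact: measurable_inner.
  rewrite (cintegral_law mJ (fun B mB => mut_def t B t0 mB)); last first.
    apply: cbounded_measurable_cis; apply: measurable_of_continuous => x.
    by apply: cvg_inner; [exact: iotaC|exact: cvg_cst].
  transitivity (charfun (mu t) (g a)).
    by apply: eq_cintegral => x; rewrite gE.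
  rewrite mu_charfun//; congr (cexp (- _)); congr (_ +i* _);
  by apply: eq_Rintegral => u; rewrite inE /= in_itv/= => /andP[u0 _]; rewrite psiE.
have Y_char r t c : 0 <= r -> r <= t ->
    cintegral P setT (fun w => cis (inner (Y t w - Y r w) c)) = cexp (- ((t - r)%:C * psit0 c)).
  move=> r0 rt; rewrite -gamma_charfun ?subr_ge0//; apply/esym.
  apply: (@cintegral_law _ _ _ _ (borel Ht) P (gamma (t - r))
    (fun w => Y t w - Y r w) _ _ (fun x : borel Ht => cis (inner (x : Ht) c))).
  - apply: measurable_weak => // b'; under eq_fun do rewrite innerBl.
    by apply: measurable_funB; apply: measurable_inner_comp => //; apply: Y_measurable => //;
      exact: le_trans rt.
  - by move=> B mB; rewrite -Y_law.
  - by apply: cbounded_measurable_cis; exact: measurable_inner.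
have XE t w : X t w = mild_solution Tb (fun x => generator Tb (iota x)) iota xb (Y ^~ w) t by [].
have X_past t a : 0 <= t -> past Y t (fun w => inner (X t w) a).
  move=> t0; exact: (mild_solution_past sepHb Tb_semigroup c0_ge0 b0_ge0 bound A_bounded
    iota_bounded ftc kE Y_cadlag Y_0).
have X_measurable : measurable_process X.
  move=> t t0; apply: measurable_weak => // a.
  apply: (past_measurable (s := t) Y_measurable); exact: X_past.
have X_cadlag w : cadlag (X ^~ w).
  exact: (mild_solution_cadlag sepHb Tb_semigroup c0_ge0 b0_ge0 bound A_bounded (Y_cadlag w)
    iota_bounded).
split=> //.
  move=> t w t0; exact: (mild_integrable sepHb Tb_semigroup c0_ge0 b0_ge0 bound A_bounded (Y_cadlag w)).
move=> tau tau_stop t t0 f mf fb.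
apply: stopped_cond_expectation => // l r u a lr r0 ru.
have ur0 : 0 <= u - r by rewrite subr_ge0.
have [h Hh] := adjoint_exists (Tb_bounded _ ur0).
(* The term <Tb_(u-r) X_r, a> is counted as past; adding the increment of [mild_solution_char] to it
   restores <X_u, a>. *)
have pL : past Y r (fun w => trig_comb X l w + inner (Tb (u - r) (X r w)) a).
  apply: pastD; last by under eq_fun do rewrite Hh; exact: X_past.
  apply: (@past_sum _ _ _ _ _ _ l r (fun p w => inner (X p.1 w) p.2)) => p /lr /andP[p0 pr].
  exact: past_le pr (X_past _ _ p0).
rewrite mub_char//.
have <- := mild_solution_char Ht_separable sepHb Tb_semigroup c0_ge0 b0_ge0 bound A_bounded
  ftc kE psit0_continuous Y_measurable Y_cadlag Y_0 Y_indep Y_char xb a r0 ru pL.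
by apply: eq_cintegral => w; rewrite -!XE -addrA; congr (cis (_ + _)); rewrite addrCA subrr addr0.
Qed.
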